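(* The universal elliptic KZB connection $d+\omega$ on the trivial bundle $\mathfrak p\times\mathbb C\times\mathfrak h\to\mathbb C\times\mathfrak h$ is $\mathrm{SL}_2(\mathbb Z)\ltimes\mathbb Z^2$-invariant. That is, $$\gamma^\ast\omega=\mathrm{Ad}(\widetilde M_\gamma)\cdot\omega-d\widetilde M_\gamma\,\widetilde M_\gamma^{-1}$$ for all $\gamma\in\mathrm{SL}_2(\mathbb Z)\ltimes\mathbb Z^2$.
   Context: $\mathfrak h$ is the upper half plane and $e(u):=\exp(2\pi iu)$. $\mathfrak p=\mathbb L(\mathbf t,\mathbf a)^\wedge$ is the completed free complex Lie algebra on $\mathbf t,\mathbf a$ (closure of the free Lie algebra in $\mathbb C\langle\langle\mathbf t,\mathbf a\rangle\rangle$). A power series $f(\mathbf t,\mathbf a)$ acts on $x\in\mathfrak p$ by $f\cdot x:=f(\mathrm{ad}_{\mathbf t},\mathrm{ad}_{\mathbf a})(x)$. Elements of $\mathfrak p$ are regarded as derivations of $\mathfrak p$ via $\mathrm{ad}$ (injective). For $u\in\mathfrak p$, $u\,\partial/\partial\mathbf t$ is the continuous derivation $\mathbf t\mapsto u,\ \mathbf a\mapsto0$; similarly $u\,\partial/\partial\mathbf a$. The group $\mathrm{SL}_2(\mathbb Z)\ltimes\mathbb Z^2$ (with $(\gamma_1,v_1)(\gamma_2,v_2)=(\gamma_1\gamma_2,v_1\gamma_2+v_2)$) acts on $\mathbb C\times\mathfrak h$ by $(m,n):(\xi,\tau)\mapsto(\xi+m\tau+n,\tau)$ and $\gamma=\begin{pmatrix}a&b\\c&d\end{pmatrix}:(\xi,\tau)\mapsto(\xi/(c\tau+d),\gamma\tau)$.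 The factor of automorphy $\widetilde M$ (values in $\mathrm{Aut}\,\mathfrak p$, satisfying $\widetilde M_{gh}(x)=\widetilde M_g(hx)\widetilde M_h(x)$) is determined by $\widetilde M_\gamma(\xi,\tau)=M_\gamma(\tau)\circ e\big(\frac{c\xi\mathbf t}{c\tau+d}\big)$ for $\gamma\in\mathrm{SL}_2(\mathbb Z)$ and $\widetilde M_{(m,n)}=e(-m\mathbf t)$ for $(m,n)\in\mathbb Z^2$, where $M_\gamma(\tau)$ is the automorphism $\mathbf a\mapsto(c\tau+d)^{-1}\mathbf a+2\pi ic\,\mathbf t$, $\mathbf t\mapsto(c\tau+d)\mathbf t$, and $e(\cdot)$ acts through the action of power series on $\mathfrak p$ above. $\mathrm{Ad}(\widetilde M_\gamma)$ is conjugation by $\widetilde M_\gamma$ on $\mathrm{End}\,\mathfrak p$. $G_{2k}(\tau)=-\frac{B_{2k}}{4k}+\sum_{n\ge1}\sigma_{2k-1}(n)q^n$, $q=e(\tau)$, with $B_j$ the Bernoulli numbers ($\frac{x}{e^x-1}=\sum B_nx^n/n!$). With $\theta(u,\tau)=\sum_{n\in\mathbb Z}(-1)^nq^{\frac12(n+\frac12)^2}e^{(n+\frac12)u}$ and $\theta'$ its derivative in $u$, $$F(\xi,\eta,\tau)=2\pi i\,\frac{\theta'(0,\tau)\,\theta(2\pi i(\xi+\eta),\tau)}{\theta(2\pi i\xi,\tau)\,\theta(2\pi i\eta,\tau)}.$$ The connection is $\nabla f=df+\omega f$, $\omega=\frac1{2\pi i}d\tau\otimes\mathbf a\frac{\partial}{\partial\mathbf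 t}+\psi+\nu$, where $$\psi=\sum_{m\ge1}\frac{(2\pi i)^{2m+1}}{(2m)!}G_{2m+2}(\tau)d\tau\otimes\sum_{j+k=2m+1,\ j,k>0}(-1)^j[\mathrm{ad}_{\mathbf t}^j(\mathbf a),\mathrm{ad}_{\mathbf t}^k(\mathbf a)]\frac{\partial}{\partial\mathbf a},$$ $$\nu=\mathbf tF(\xi,\mathbf t,\tau)\cdot\mathbf a\,d\xi+\frac1{2\pi i}\Big(\frac1{\mathbf t}+\mathbf t\frac{\partial F}{\partial\mathbf t}(\xi,\mathbf t,\tau)\Big)\cdot\mathbf a\,d\tau.$$ It is meromorphic, with poles along $\{(\xi,\tau):\xi\in\mathbb Z+\mathbb Z\tau\}$. *)

(* Defs.v *)
From HB Require Import structures.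
From mathcomp Require Import all_boot all_order all_algebra.
From mathcomp Require Import all_classical all_reals all_analysis.
From mathcomp Require Import complex.

Set Implicit Arguments.
Unset Strict Implicit.
Unset Printing Implicit Defensive.
Import Order.TTheory GRing.Theory Num.Theory numFieldNormedType.Exports.

Local Open Scope classical_set_scope.
Local Open Scope ring_scope.

(* The structure on the right-hand side gives R[i] the topology, the norm and
   the complex differential calculus that MathComp-Analysis attaches to every
   numClosedFieldType: below, [derive1] and ['d] are complex derivatives. *)
Definition Cplx (R : realType) : numClosedFieldType := R[i].

Definition Cexp {R : realType} (z : Cplx R) : Cplx R :=
  let: Complex x y := (z : R[i]) in
  Complex (expR x * cos y) (expR x * sin y).

Definition twopii (R : realType) : Cplx R := Complex 0 (2 * pi).

Definition ce {R : realType} (u : Cplx R) : Cplx R := Cexp (twopii R * u).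

Definition uhp {R : realType} : set (Cplx R) :=
  [set tau | 0 < complex.Im (tau : R[i])].

Definition has_expansion {R : realType} (f : Cplx R -> Cplx R)
    (c : nat -> Cplx R) : Prop :=
  \forall z \near (0 : Cplx R)^',
    series (fun k => c k * (z : Cplx R) ^+ k) @ \oo --> (f z : Cplx R).

(* The coefficients of the power series to which f is equal on a punctured
   neighbourhood of 0; the value of f at 0 itself plays no role, so that f may
   be given by a formula with a removable singularity at 0. *)
Definition expansion {R : realType} (f : Cplx R -> Cplx R) : nat -> Cplx R :=
  xget (fun=> 0) [set c | has_expansion f c].

(* x / (e^x - 1) = \sum_n B_n x^n / n! *)
Definition bernoulli (R : realType) (n : nat) : Cplx R :=
  n`!%:R * expansion (fun x : Cplx R => x / (Cexp x - 1)) n.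

Definition sigma_div (s n : nat) : nat := (\sum_(d <- divisors n) d ^ s)%N.

(* [Gseries k tau] is G_{2k}(tau): the argument k is half the weight. *)
Definition Gseries {R : realType} (k : nat) (tau : Cplx R) : Cplx R :=
  - (bernoulli R (2 * k) / (4 * k)%:R)
  + limn (series (fun n : nat =>
      (sigma_div (2 * k - 1) n.+1)%:R * ce tau ^+ n.+1 : Cplx R)).

(* The sum of an absolutely convergent family indexed by the integers;
   Negz n is - (n + 1). *)
Definition zsum {R : realType} (u : int -> Cplx R) : Cplx R :=
  limn (series (fun n : nat => u (Posz n)))
  + limn (series (fun n : nat => u (Negz n))).

(* q^s stands for e(s tau). *)
Definition theta {R : realType} (u tau : Cplx R) : Cplx R :=
  zsum (fun n : int =>
    let nu : Cplx R := n%:~R + 2^-1 in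
    (-1) ^ n * ce (2^-1 * nu ^+ 2 * tau) * Cexp (nu * u)).

Definition kronF {R : realType} (xi eta tau : Cplx R) : Cplx R :=
  let I2 := twopii R in
  I2 * (derive1 (fun u => theta u tau) 0 * theta (I2 * (xi + eta)) tau
        / (theta (I2 * xi) tau * theta (I2 * eta) tau)).

(* A word in t and a: the letter t is [false] and the letter a is [true]. *)
Definition word : Type := seq bool.

(* A noncommutative formal power series, as its family of coefficients.
   Addition, scaling and finite sums are pointwise; the pointwise product of
   functions is not the product of C<<t,a>>, which is [nmul]. *)
Definition ncseries (R : realType) : Type := word -> Cplx R.

Definition mono (R : realType) (w : word) : ncseries R :=
  fun v => (v == w)%:R.

Definition nct (R : realType) : ncseries R := mono R [:: false].
Definition nca (R : realType) : ncseries R := mono R [:: true].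

Definition nmul {R : realType} (f g : ncseries R) : ncseries R :=
  fun w => \sum_(0 <= i < (size w).+1) f (take i w) * g (drop i w).

(* [ncad u] is ad_u; an element u of the Lie algebra is regarded as the
   derivation ad_u. *)
Definition ncad {R : realType} (u x : ncseries R) : ncseries R :=
  nmul u x - nmul x u.

Inductive freeLie {R : realType} : ncseries R -> Prop :=
| freeLie_t : freeLie (nct R)
| freeLie_a : freeLie (nca R)
| freeLie_add x y : freeLie x -> freeLie y -> freeLie (x + y)
| freeLie_scale (c : Cplx R) x : freeLie x -> freeLie (c *: x)
| freeLie_bracket x y : freeLie x -> freeLie y -> freeLie (ncad x y).

(* The closure of the free Lie algebra for the topology of C<<t,a>> in which
   the series of order >= n form a basis of neighbourhoods of 0. *)
Definition plie {R : realType} : set (ncseries R) :=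
  [set x | forall n : nat, exists2 y, freeLie y &
                           forall w : word, (size w < n)%N -> x w = y w].

(* [sum_words n F] is the sum of F w over the words w of length at most n.
   The infinite sums of series below are locally finite: in the coefficient of
   a word v, the terms with size w > size v vanish, because ad_t and ad_a raise
   degrees by 1, and because the series substituted for t and a have no
   constant term. *)
Definition sum_words {R : realType} (n : nat) (F : word -> Cplx R) : Cplx R :=
  \sum_(k < n.+1) \sum_(w : k.-tuple bool) F w.

(* f . x = f(ad_t, ad_a)(x): the monomial l_1 ... l_n of f acts by
   ad_{l_1} o ... o ad_{l_n}. *)
Definition ncact {R : realType} (f x : ncseries R) : ncseries R :=
  fun v => sum_words (size v) (fun w =>
    f w * foldr (fun (l : bool) y => ncad (if l then nca R else nct R) y) x w v).

(* \sum_k c_k t^k *)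
Definition tseries {R : realType} (c : nat -> Cplx R) : ncseries R :=
  fun w => if w == nseq (size w) false then c (size w) else 0.

(* e(lambda t) *)
Definition ce_t {R : realType} (lambda : Cplx R) : ncseries R :=
  tseries (fun k => (twopii R * lambda) ^+ k / k`!%:R).

(* The continuous algebra endomorphism t |-> U, a |-> V, for U and V without
   constant term. *)
Definition ncsubst {R : realType} (U V x : ncseries R) : ncseries R :=
  fun v => sum_words (size v) (fun w =>
    x w * foldr (fun (l : bool) y => nmul (if l then V else U) y)
                (mono R [::]) w v).

Definition ncder_word {R : realType} (U V : ncseries R) (w : word) :
    ncseries R :=
  \sum_(0 <= i < size w)
    nmul (mono R (take i w))
         (nmul (if nth false w i then V else U) (mono R (drop i.+1 w))).

(* The continuous derivation t |-> U, a |-> V, for U and V without constant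
   term. *)
Definition ncder {R : realType} (U V x : ncseries R) : ncseries R :=
  fun v => sum_words (size v) (fun w => x w * ncder_word U V w v).

Definition ddt {R : realType} (u : ncseries R) : ncseries R -> ncseries R :=
  ncder u 0.
Definition dda {R : realType} (u : ncseries R) : ncseries R -> ncseries R :=
  ncder 0 u.

(* A 1-form with values in End p on an open subset of C x h, with base point
   (xi, tau) and tangent vector (component along xi, component along tau). *)
Definition end_form (R : realType) : Type :=
  Cplx R * Cplx R -> Cplx R * Cplx R -> ncseries R -> ncseries R.

(* \sum_{j+k=2m+1, j,k>0} (-1)^j [ad_t^j(a), ad_t^k(a)] *)
Definition psi_elt (R : realType) (m : nat) : ncseries R :=
  \sum_(1 <= j < 2 * m + 1)
    (-1 : Cplx R) ^+ j *: ncad (iter j (ncad (nct R)) (nca R))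
                               (iter (2 * m + 1 - j) (ncad (nct R)) (nca R)).

(* The d tau coefficient of psi; the m-th term raises degrees by 2m+2, so that
   the terms with m > size v do not contribute to the coefficient of v. *)
Definition psi_tau {R : realType} (tau : Cplx R) (y : ncseries R) :
    ncseries R :=
  fun v => \sum_(1 <= m < (size v).+1)
    twopii R ^+ (2 * m + 1) / (2 * m)`!%:R * Gseries (m + 1) tau
    * dda (psi_elt R m) y v.

(* The d xi coefficient of nu: t F(xi,t,tau) . a *)
Definition nu_xi {R : realType} (xi tau : Cplx R) : ncseries R :=
  ncact (tseries (expansion (fun eta => eta * kronF xi eta tau))) (nca R).

(* The d tau coefficient of nu: (2 pi i)^-1 (1/t + t dF/dt(xi,t,tau)) . a *)
Definition nu_tau {R : realType} (xi tau : Cplx R) : ncseries R :=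
  (twopii R)^-1 *:
  ncact (tseries (expansion (fun eta : Cplx R =>
           eta^-1 + eta * derive1 (fun z => kronF xi z tau) eta))) (nca R).

Definition omega {R : realType} : end_form R := fun x v y =>
  v.1 *: ncad (nu_xi x.1 x.2) y
  + v.2 *: ((twopii R)^-1 *: ddt (nca R) y
            + psi_tau x.2 y
            + ncad (nu_tau x.1 x.2) y).

Definition poles {R : realType} : set (Cplx R * Cplx R) :=
  [set x | exists m n : int, x.1 = m%:~R + n%:~R * x.2].

Definition SL2Z : Type := {A : 'M[int]_2 | \det A == 1}.

Lemma SL2Z_mul_subproof (A B : SL2Z) : \det (val A *m val B) == 1.
Proof. by rewrite det_mulmx (eqP (valP A)) (eqP (valP B)). Qed.

Lemma SL2Z_one_subproof : \det (1%:M : 'M[int]_2) == 1.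
Proof. by rewrite det1. Qed.

Definition SL2Z_mul (A B : SL2Z) : SL2Z :=
  exist (fun M : 'M[int]_2 => \det M == 1) _ (SL2Z_mul_subproof A B).
Definition SL2Z_one : SL2Z :=
  exist (fun M : 'M[int]_2 => \det M == 1) _ SL2Z_one_subproof.

Definition jacgrp : Type := (SL2Z * 'rV[int]_2)%type.

Definition jacgrp_mul (g h : jacgrp) : jacgrp :=
  (SL2Z_mul g.1 h.1, g.2 *m val h.1 + h.2).

Lemma jacgrp_decomp (g : jacgrp) :
  g = jacgrp_mul (g.1, 0) (SL2Z_one, g.2).
Proof.
case: g => A v; rewrite /jacgrp_mul /= mul0mx add0r; congr (_, _).
by apply: val_inj; rewrite /= mulmx1.
Qed.

Definition entry {R : realType} (A : SL2Z) (i j : 'I_2) : Cplx R :=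
  (val A i j)%:~R.

Section GroupAction.
Context {R : realType}.
Local Notation C := (Cplx R).

Definition jfactor (A : SL2Z) (tau : C) : C := entry A 1 0 * tau + entry A 1 1.

Definition act_sl2 (A : SL2Z) (x : C * C) : C * C :=
  (x.1 / jfactor A x.2,
   (entry A 0 0 * x.2 + entry A 0 1) / jfactor A x.2).

Definition act_trans (v : 'rV[int]_2) (x : C * C) : C * C :=
  (x.1 + (v 0 0)%:~R * x.2 + (v 0 1)%:~R, x.2).

(* (gamma, v) = (gamma, 0) (1, v), cf. [jacgrp_decomp]. *)
Definition jacgrp_act (g : jacgrp) (x : C * C) : C * C :=
  act_sl2 g.1 (act_trans g.2 x).

Definition Mauto (A : SL2Z) (tau : C) : ncseries R -> ncseries R :=
  ncsubst (jfactor A tau *: nct R)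
          ((jfactor A tau)^-1 *: nca R + (twopii R * entry A 1 0) *: nct R).

Definition Mtilde_sl2 (A : SL2Z) (x : C * C) (y : ncseries R) : ncseries R :=
  Mauto A x.2 (ncact (ce_t (entry A 1 0 * x.1 / jfactor A x.2)) y).

Definition Mtilde_trans (v : 'rV[int]_2) (y : ncseries R) : ncseries R :=
  ncact (ce_t (- (v 0 0)%:~R)) y.

(* The cocycle relation M~_{gh}(x) = M~_g(hx) o M~_h(x), for the decomposition
   [jacgrp_decomp] of a general element. *)
Definition Mtilde (g : jacgrp) (x : C * C) (y : ncseries R) : ncseries R :=
  Mtilde_sl2 g.1 (act_trans g.2 x) (Mtilde_trans g.2 y).

(* The inverse of the restriction of M to p, assumed bijective. *)
Definition pinverse (M : ncseries R -> ncseries R) :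
    ncseries R -> ncseries R :=
  pinv_ (fun=> 0) plie M.

Definition Ad (M D : ncseries R -> ncseries R) : ncseries R -> ncseries R :=
  M \o D \o pinverse M.

Definition pullback (f : C * C -> C * C) (alpha : end_form R) : end_form R :=
  fun x v => alpha (f x) ('d f x v).

(* d M~_g, computed coefficientwise on C<<t,a>>. *)
Definition dMtilde (g : jacgrp) : end_form R := fun x v y w =>
  'd (fun z : C * C => Mtilde g z y w) x v.

End GroupAction.

(* Main.v *)
(* M~_g(x) is the substitution t |-> J t, a |-> J^-1 e(rho t).a + 2 pi i c t, where
   J = c tau + d and rho = c xi + c n - d m. The composites omega M~, M~ omega and
   d M~ are derivations along M~, so that the identity only has to be compared on t
   and on a. There it amounts to
   - D(e^st) = ((e^(s ad_t) - 1)/ad_t . a) e^st for the derivation D = a d/dt, which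
     accounts for the term a d/dt and for d M~;
   - G_2k(g tau) = J^(2k) G_2k(tau) for k >= 2, which accounts for psi;
   - F(xi/J, eta/J, g tau) = J e(c xi eta/J) F(xi, eta, tau) and
     F(xi + m tau + n, eta, tau) = e(-m eta) F(xi, eta, tau), which account for nu.
   The G_2k with k >= 2 are expansion coefficients at z = 0 of the lattice sum of the
   (z + m tau + n)^-4. The law for F follows from
   theta(2 pi i z/J, g tau) = const e(c z^2/2J) theta(2 pi i z, tau): by the triple
   product, the Taylor coefficients u of each side solve z u' = u l for series l whose
   coefficients are the G_2k, and the modularity of the G_2k shows that the two l can
   differ in degree 2 only. *)
Require Import Defs.
From HB Require Import structures.
From mathcomp Require Import all_boot all_order all_algebra.
From mathcomp Require Import all_classical all_reals all_analysis.
From mathcomp Require Import complex.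
From mathcomp Require Import ring lra zify.
Import Order.TTheory GRing.Theory Num.Theory numFieldNormedType.Exports.
Local Open Scope classical_set_scope.
Local Open Scope ring_scope.
Set Implicit Arguments.
Unset Strict Implicit.
Unset Printing Implicit Defensive.

(** * Complex numbers and absolutely summable families *)

(** The obstacle is the law of theta under SL_2(Z), which is reached here without Poisson summation
    and without Liouville's theorem. Everything analytic is reduced to absolutely summable families
    over arbitrary index types, to dominated convergence, and to the uniqueness of Taylor
    coefficients at 0. The exponent 4 makes the lattice sum absolutely convergent, so that a change
    of basis of Z^2 merely permutes its terms. The price is that weight 2 stays invisible: G_2 is
    only quasi-modular, and its defect appears as a Gaussian factor exp(delta z^2). The constant
    delta is found afterwards by replacing z by z + 1, a lattice translation on both sides, which
    forces delta = pi i c/J. The same Gaussian produces the cross term e(c xi eta/J) in the law of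
    F. On the algebraic side, linear maps that respect the filtration by order of series serve as
    the continuous ones. The inverse of M~ never has to be computed with: every y in p has the form
    M~(Y), and the identity is compared at Y. *)

(* The norm that MathComp-Analysis puts on [Cplx R] takes its values in [Cplx R]. *)
Definition nrm {R : realType} (z : Cplx R) : R := ComplexField.Normc.normc z.
Definition toC {R : realType} (x : R) : Cplx R := Complex x 0.
Definition cplx {R : realType} (x y : R) : Cplx R := Complex x y.
Definition ReC {R : realType} (z : Cplx R) : R := complex.Re (z : R[i]).
Definition ImC {R : realType} (z : Cplx R) : R := complex.Im (z : R[i]).

Section Modulus.
Context {R : realType}.
Local Notation C := (Cplx R).
Implicit Types z w : C.

Lemma normE z : `|z| = toC (nrm z).
Proof. by case: z => x y; rewrite [LHS](@normc_def R). Qed.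

Lemma toC_inj : injective (@toC R).
Proof. by move=> x y []. Qed.
Lemma toC0 : toC 0 = 0 :> C. Proof. by []. Qed.
Lemma toC1 : toC 1 = 1 :> C. Proof. by []. Qed.
Lemma toCD (x y : R) : toC (x + y) = toC x + toC y.
Proof. exact: (rmorphD (real_complex R)). Qed.
Lemma toCM (x y : R) : toC (x * y) = toC x * toC y.
Proof. exact: (rmorphM (real_complex R)). Qed.
Lemma toCN (x : R) : toC (- x) = - toC x.
Proof. exact: (rmorphN (real_complex R)). Qed.
Lemma toCX (x : R) n : toC (x ^+ n) = toC x ^+ n.
Proof. exact: (rmorphXn (real_complex R)). Qed.
Lemma toCV (x : R) : toC x^-1 = (toC x)^-1.
Proof. exact: (fmorphV (real_complex R)). Qed.
Lemma toC_nat n : toC n%:R = n%:R :> C.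
Proof. exact: (rmorph_nat (real_complex R)). Qed.
Lemma toC_int (n : int) : toC n%:~R = n%:~R :> C.
Proof. exact: (rmorph_int (real_complex R)). Qed.
Lemma toC_sum I (s : seq I) (P : pred I) (F : I -> R) :
  toC (\sum_(i <- s | P i) F i) = \sum_(i <- s | P i) toC (F i).
Proof. exact: (rmorph_sum (real_complex R)). Qed.
Lemma le_toC (x y : R) : (toC x <= toC y) = (x <= y).
Proof. exact: lecR. Qed.
Lemma lt_toC (x y : R) : (toC x < toC y) = (x < y).
Proof. exact: ltcR. Qed.

Lemma nrm0 : nrm (0 : C) = 0. Proof. exact: ComplexField.Normc.normc0. Qed.
Lemma nrm1 : nrm (1 : C) = 1. Proof. exact: ComplexField.Normc.normc1. Qed.
Lemma nrm_ge0 z : 0 <= nrm z.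
Proof. by rewrite -le_toC -normE normr_ge0. Qed.
Lemma nrm_eq0 z : (nrm z == 0) = (z == 0).
Proof. by rewrite -(inj_eq toC_inj) -normE toC0 normr_eq0. Qed.
Lemma nrm_gt0 z : (0 < nrm z) = (z != 0).
Proof. by rewrite lt_neqAle eq_sym nrm_eq0 nrm_ge0 andbT. Qed.
Lemma nrmM z w : nrm (z * w) = nrm z * nrm w.
Proof. exact: ComplexField.Normc.normcM. Qed.
Lemma nrmV z : nrm z^-1 = (nrm z)^-1.
Proof. by apply: toC_inj; rewrite toCV -!normE normfV. Qed.
Lemma nrmN z : nrm (- z) = nrm z.
Proof. by apply: toC_inj; rewrite -!normE normrN. Qed.
Lemma nrmX z n : nrm (z ^+ n) = nrm z ^+ n.
Proof. by apply: toC_inj; rewrite toCX -!normE normrX. Qed.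
Lemma nrmD z w : nrm (z + w) <= nrm z + nrm w.
Proof. by rewrite -le_toC toCD -!normE ler_normD. Qed.
Lemma nrmB z w : nrm (z - w) <= nrm z + nrm w.
Proof. by rewrite -(nrmN w) nrmD. Qed.
Lemma nrm_dist z w : nrm (z - w) = nrm (w - z).
Proof. by rewrite -nrmN opprB. Qed.
Lemma nrm_lb z w : nrm z - nrm w <= nrm (z - w).
Proof. by rewrite lerBlDr -{1}(subrK w z) nrmD. Qed.
Lemma nrm_sum I (s : seq I) (P : pred I) (F : I -> C) :
  nrm (\sum_(i <- s | P i) F i) <= \sum_(i <- s | P i) nrm (F i).
Proof.
elim/big_ind2: _ => [|x a y b xa yb|//]; first by rewrite nrm0.
by rewrite (le_trans (nrmD _ _))// lerD.
Qed.
Lemma nrm_toC (x : R) : nrm (toC x) = `|x|.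
Proof. by rewrite /nrm /toC /= expr0n/= addr0 sqrtr_sqr. Qed.
Lemma nrm_nat n : nrm (n%:R : C) = n%:R.
Proof. by rewrite -toC_nat nrm_toC normr_nat. Qed.
Lemma nrm_int (n : int) : nrm (n%:~R : C) = `|n%:~R|.
Proof. by rewrite -toC_int nrm_toC. Qed.

Lemma nrm2E z : nrm z ^+ 2 = ReC z ^+ 2 + ImC z ^+ 2.
Proof. by case: z => x y; rewrite sqr_sqrtr// addr_ge0 ?sqr_ge0. Qed.
Lemma Re_nrm z : `|ReC z| <= nrm z.
Proof.
rewrite -(@ler_pXn2r _ 2)// ?nnegrE ?nrm_ge0// nrm2E real_normK ?num_real//.
by rewrite lerDl sqr_ge0.
Qed.
Lemma Im_nrm z : `|ImC z| <= nrm z.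
Proof.
rewrite -(@ler_pXn2r _ 2)// ?nnegrE ?nrm_ge0// nrm2E real_normK ?num_real//.
by rewrite lerDr sqr_ge0.
Qed.

Lemma ReCD z w : ReC (z + w) = ReC z + ReC w.
Proof. by case: z; case: w. Qed.
Lemma ImCD z w : ImC (z + w) = ImC z + ImC w.
Proof. by case: z; case: w. Qed.
Lemma ReCM z w : ReC (z * w) = ReC z * ReC w - ImC z * ImC w.
Proof. by case: z; case: w. Qed.
Lemma ImCM z w : ImC (z * w) = ReC z * ImC w + ImC z * ReC w.
Proof. by case: z; case: w => *; rewrite /ImC/= addrC// addrC. Qed.
Lemma CplxP z w : ReC z = ReC w -> ImC z = ImC w -> z = w.
Proof. by case: z => a b; case: w => c d /= -> ->. Qed.
Lemma CplxE z : z = toC (ReC z) + cplx 0 1 * toC (ImC z).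
Proof. by apply: CplxP; rewrite ?ReCD ?ImCD ?ReCM ?ImCM /=; ring. Qed.

(** A positive element of [Cplx R] is real, so complex and real tolerances are interchangeable. *)
Lemma cvgC_P (T : Type) (F : set_system T) {FF : Filter F} (f : T -> C) (l : C) :
  f @ F --> l <-> (forall e : R, 0 < e -> \forall x \near F, nrm (l - f x) < e).
Proof.
split.
- move=> /cvgrPdist_lt fl e e0; have /fl : 0 < toC e :> C by rewrite lt_toC.
  by apply: filterS => x; rewrite normE lt_toC.
- move=> fl; apply/cvgrPdist_lt => e e0.
  have eE : e = toC (ReC e) by apply: CplxP => //; move: e0; rewrite ltcE => /andP[/eqP].
  have : 0 < ReC e by rewrite -lt_toC -eE.
  by move=> /fl; apply: filterS => x; rewrite normE eE lt_toC.
Qed.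

Lemma cvgCD (T : Type) (F : set_system T) {FF : Filter F} (f g : T -> C) (a b : C) :
  f @ F --> a -> g @ F --> b -> f x + g x @[x --> F] --> a + b.
Proof. exact: cvgD. Qed.

Lemma cvgCM (T : Type) (F : set_system T) {FF : Filter F} (f g : T -> C) (a b : C) :
  f @ F --> a -> g @ F --> b -> f x * g x @[x --> F] --> a * b.
Proof. exact: cvgM. Qed.

Lemma cvgCZ (T : Type) (F : set_system T) {FF : Filter F} (f : T -> C) (a c : C) :
  f @ F --> a -> c * f x @[x --> F] --> c * a.
Proof. by move=> fa; apply: cvgCM fa; exact: cvg_cst. Qed.

Lemma cvgCX (T : Type) (F : set_system T) {FF : Filter F} (f : T -> C) (a : C) n :
  f @ F --> a -> f x ^+ n @[x --> F] --> a ^+ n.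
Proof.
move=> fa; elim: n => [|n IH]; first by under eq_fun do rewrite expr0; exact: cvg_cst.
by rewrite exprS; under eq_fun do rewrite exprS; exact: cvgCM.
Qed.

Lemma cvgC_sum (T : Type) (F : set_system T) {FF : Filter F} (I : Type) (s : seq I)
    (f : I -> T -> C) (a : I -> C) : (forall i, f i @ F --> a i) ->
  \sum_(i <- s) f i x @[x --> F] --> \sum_(i <- s) a i.
Proof.
move=> fa; elim: s => [|i s IH].
  by rewrite big_nil; under eq_fun do rewrite big_nil; exact: cvg_cst.
by rewrite big_cons; under eq_fun do rewrite big_cons; exact: cvgCD (fa i) IH.
Qed.

Lemma cvgC_uniq (F : set_system nat) {FF : ProperFilter F} (f : nat -> C) (l l' : C) :
  f @ F --> l -> f @ F --> l' -> l = l'.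
Proof. by apply: cvg_unique; exact: norm_hausdorff. Qed.

Lemma lim_C (f : nat -> C) (l : C) : f @ \oo --> l -> limn f = l.
Proof. by move=> /cvg_lim; apply; exact: norm_hausdorff. Qed.

End Modulus.

Section RealSums.
Context {R : realType}.

(** The index type is arbitrary, so that sums over integers and over pairs of integers can be
    reindexed and rearranged without reference to an order of summation. *)
Definition bsum {T : eqType} (g : T -> R) :=
  exists B, forall s : seq T, uniq s -> \sum_(i <- s) g i <= B.

Lemma bsum_le (T : eqType) (g h : T -> R) : (forall i, g i <= h i) -> bsum h -> bsum g.
Proof. by move=> gh [B hB]; exists B => s /hB; apply: le_trans; apply: ler_sum. Qed.

Lemma bsumZ (T : eqType) (g : T -> R) c : 0 <= c -> bsum g -> bsum (fun i => c * g i).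
Proof.
move=> c0 [B gB]; exists (c * B) => s us; rewrite -mulr_sumr.
by rewrite ler_wpM2l// gB.
Qed.

Lemma bsumD (T : eqType) (g h : T -> R) : bsum g -> bsum h -> bsum (fun i => g i + h i).
Proof.
move=> [B gB] [D hD]; exists (B + D) => s us; rewrite big_split.
by rewrite lerD ?gB ?hD.
Qed.

Lemma bsum_inj (T U : eqType) (g : T -> R) (phi : U -> T) :
  injective phi -> bsum g -> bsum (g \o phi).
Proof.
move=> phi_inj [B gB]; exists B => s us.
by have := gB (map phi s); rewrite big_map map_inj_uniq//; exact.
Qed.

Lemma sum_subseq (T : eqType) (g : T -> R) (s t : seq T) :
  (forall i, 0 <= g i) -> uniq s -> uniq t -> {subset s <= t} ->
  \sum_(i <- s) g i <= \sum_(i <- t) g i.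
Proof.
move=> g0 us ut st.
have pe : perm_eq t (s ++ [seq x <- t | x \notin s]).
  apply: uniq_perm => //.
    rewrite cat_uniq us filter_uniq// andbT/=; apply/hasPn => x.
    by rewrite mem_filter => /andP[].
  move=> x; rewrite mem_cat mem_filter; case: (boolP (x \in s)) => //= xs.
  by rewrite st.
by rewrite (perm_big _ pe) big_cat/= lerDl sumr_ge0.
Qed.

Lemma bsum_prod (T U : eqType) (g : T -> R) (h : U -> R) :
  (forall i, 0 <= g i) -> (forall i, 0 <= h i) -> bsum g -> bsum h ->
  bsum (fun p : T * U => g p.1 * h p.2).
Proof.
move=> g0 h0 [B gB] [D hD]; exists (B * D) => s us.
set s1 := undup (unzip1 s); set s2 := undup (unzip2 s).
have u12 : uniq (allpairs pair s1 s2).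
  by rewrite allpairs_uniq ?undup_uniq// => -[? ?] [? ?].
have gh0 (p : T * U) : 0 <= g p.1 * h p.2 by rewrite mulr_ge0.
apply: le_trans (sum_subseq gh0 us u12 _) _.
  move=> [x y] xs; apply/allpairsP; exists (x, y); split => //=.
    by rewrite mem_undup; apply/mapP; exists (x, y).
  by rewrite mem_undup; apply/mapP; exists (x, y).
rewrite big_allpairs_dep/=.
rewrite (eq_bigr (fun i => g i * \sum_(j <- s2) h j)); last first.
  by move=> i _; rewrite mulr_sumr.
by rewrite -mulr_suml ler_pM ?sumr_ge0 ?gB ?hD ?undup_uniq.
Qed.

(** A finite set whose sum is within e of the supremum leaves less than e for every finite set
    disjoint from it. *)
Lemma bsum_tail (T : eqType) (g : T -> R) : (forall i, 0 <= g i) -> bsum g ->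
  forall e, 0 < e -> exists2 s0, uniq s0 &
    forall s, uniq s -> (forall i, i \in s -> i \notin s0) -> \sum_(i <- s) g i < e.
Proof.
move=> g0 [B gB] e e0.
pose A := [set x | exists2 s, uniq s & x = \sum_(i <- s) g i].
have supA : has_sup A.
  split; first by exists 0; exists [::]; rewrite ?big_nil.
  by exists B => _ [s us ->]; exact: gB.
have [_ [s0 us0 ->] lts0] := sup_adherent e0 supA.
exists s0 => // s us dis.
have : \sum_(i <- s0 ++ s) g i <= sup A.
  apply: (ub_le_sup supA.2); exists (s0 ++ s) => //.
  rewrite cat_uniq us0 us andbT/=; apply/hasPn => x xs.
  exact: dis.
by rewrite big_cat/=; move: lts0; set a := \sum_(i <- s0) _; lra.
Qed.

Lemma bsum_real (T : eqType) (g : T -> R) : (forall i, 0 <= g i) -> bsum g ->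
  exists S, forall e, 0 < e -> exists s0 : seq T, forall s, uniq s -> {subset s0 <= s} ->
    `|S - \sum_(i <- s) g i| < e.
Proof.
move=> g0 [B gB].
pose A := [set x | exists2 s, uniq s & x = \sum_(i <- s) g i].
have supA : has_sup A.
  split; first by exists 0; exists [::]; rewrite ?big_nil.
  by exists B => _ [s us ->]; exact: gB.
exists (sup A) => e e0.
have [_ [s0 us0 ->] lts0] := sup_adherent e0 supA.
exists s0 => s us s0s.
have h1 := sum_subseq g0 us0 us s0s.
have h2 : \sum_(i <- s) g i <= sup A by apply: (ub_le_sup supA.2); exists s.
by rewrite ger0_norm; lra.
Qed.

Lemma bsum_nat (g : nat -> R) : (forall i, 0 <= g i) ->
  (exists B, forall n, \sum_(i < n) g i <= B) -> bsum g.
Proof.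
move=> g0 [B gB]; exists B => s us.
apply: le_trans (gB (\max_(i <- s) i).+1).
rewrite -(big_mkord xpredT g) /index_iota subn0.
apply: sum_subseq => //; first exact: iota_uniq.
by move=> i si; rewrite mem_iota/= add0n ltnS; exact: (leq_bigmax_seq i (P := xpredT) (F := id)).
Qed.

Lemma bsum_geo (q : R) : 0 <= q < 1 -> bsum (fun n : nat => q ^+ n).
Proof.
move=> /andP[q0 q1]; apply: bsum_nat => [i|]; first exact: exprn_ge0.
exists (1 - q)^-1 => n.
have : (1 - q) * \sum_(i < n) q ^+ i = 1 - q ^+ n by rewrite -opprB mulNr -subrX1 opprB.
move=> h; rewrite -(ler_pM2l (_ : 0 < 1 - q)) ?subr_gt0// h divff; last by rewrite subr_eq0 gt_eqF.
by rewrite gerBl exprn_ge0.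
Qed.

Lemma bsum_int (g : int -> R) : (forall i, 0 <= g i) ->
  bsum (fun n : nat => g n%:Z) -> bsum (fun n : nat => g (- n%:Z)) -> bsum g.
Proof.
move=> g0 [B gB] [D gD]; exists (B + D) => s us.
pose f (x : bool * nat) : int := if x.1 then x.2%:Z else - x.2%:Z.
pose sp := undup [seq `|x|%N | x <- s].
(* Zero lies in both halves; counting it twice only weakens the upper bound. *)
apply: (@le_trans _ _ (\sum_(i <- undup ([seq i%:Z | i : nat <- sp] ++ [seq - i%:Z | i : nat <- sp])) g i)).
  apply: sum_subseq => //; first exact: undup_uniq.
  move=> x xs; rewrite mem_undup mem_cat.
  have xsp : `|x|%N \in sp by rewrite mem_undup map_f.
  by case: (ger0P x) => x0; apply/orP; [left|right]; apply/mapP; exists `|x|%N => //; lia.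
apply: (@le_trans _ _ (\sum_(i <- ([seq i%:Z | i : nat <- sp] ++ [seq - i%:Z | i : nat <- sp])) g i)).
  elim: (_ ++ _) => [|x l IH]; first by rewrite big_nil.
  rewrite /= big_cons; case: ifP => _; last by rewrite big_cons lerD2l.
  by rewrite (le_trans IH)// lerDr.
by rewrite big_cat !big_map lerD ?gB ?gD ?undup_uniq.
Qed.

End RealSums.

Section Sums.
Context {R : realType}.
Local Notation C := (Cplx R).

Definition summ {T : eqType} (f : T -> C) := bsum (fun i => nrm (f i)).

(* [hs f S]: the unordered family f has sum S. *)
Definition hs {T : eqType} (f : T -> C) (S : C) :=
  forall e : R, 0 < e -> exists s0 : seq T, forall s, uniq s -> {subset s0 <= s} ->
    nrm (S - \sum_(i <- s) f i) < e.

Definition tot {T : eqType} (f : T -> C) : C := xget 0 [set S | hs f S].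

Lemma hs_common (T : eqType) (f g : T -> C) S S' : hs f S -> hs g S' ->
  forall e : R, 0 < e -> exists2 s, uniq s &
    nrm (S - \sum_(i <- s) f i) < e /\ nrm (S' - \sum_(i <- s) g i) < e.
Proof.
move=> fS gS e e0; have [s1 h1] := fS e e0; have [s2 h2] := gS e e0.
exists (undup (s1 ++ s2)); first exact: undup_uniq.
by split; [apply: h1|apply: h2]; rewrite ?undup_uniq// => x xs;
  rewrite mem_undup mem_cat xs ?orbT.
Qed.

Lemma nrm_small (z : C) : (forall e : R, 0 < e -> nrm z < e) -> z = 0.
Proof.
move=> h; apply/eqP; rewrite -nrm_eq0; apply: contraT => z0.
by have := h (nrm z); rewrite lt_neqAle eq_sym z0 nrm_ge0 ltxx => /(_ isT).
Qed.

Lemma hs_uniq (T : eqType) (f : T -> C) S S' : hs f S -> hs f S' -> S = S'.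
Proof.
move=> fS fS'; apply/subr0_eq/nrm_small => e e0.
have e2 : 0 < e / 2 by lra.
have [s _ [h1 h2]] := hs_common fS fS' e2.
have -> : S - S' = (S - \sum_(i <- s) f i) - (S' - \sum_(i <- s) f i) by ring.
by apply: le_lt_trans (nrmB _ _) _; lra.
Qed.

Lemma hsE (T : eqType) (f : T -> C) S : hs f S -> tot f = S.
Proof. by move=> fS; apply: xget_unique => // S' fS'; exact: hs_uniq fS' fS. Qed.

Lemma hsD (T : eqType) (f g : T -> C) S S' : hs f S -> hs g S' ->
  hs (fun i => f i + g i) (S + S').
Proof.
move=> fS gS e e0; have e2 : 0 < e / 2 by lra.
have [s1 h1] := fS _ e2; have [s2 h2] := gS _ e2.
exists (s1 ++ s2) => s us ss; rewrite big_split/= opprD addrACA.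
have g1 := h1 s us (fun x xs => ss x (etrans (mem_cat x s1 s2) (introT orP (or_introl xs)))).
have g2 := h2 s us (fun x xs => ss x (etrans (mem_cat x s1 s2) (introT orP (or_intror xs)))).
apply: le_lt_trans (nrmD _ _) _.
lra.
Qed.

Lemma hsZ (T : eqType) (f : T -> C) S c : hs f S -> hs (fun i => c * f i) (c * S).
Proof.
move=> fS e e0; have e2 : 0 < e / (nrm c + 1) by rewrite divr_gt0// ltr_wpDl// nrm_ge0.
have [s1 h1] := fS _ e2; exists s1 => s us ss.
rewrite -mulr_sumr -mulrBr nrmM.
have c1 : 0 < nrm c + 1 by rewrite ltr_wpDl// nrm_ge0.
have := h1 s us ss; rewrite ltr_pdivlMr// => h.
apply: le_lt_trans h; rewrite mulrC ler_wpM2l ?nrm_ge0//; lra.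
Qed.

Lemma eq_hs (T : eqType) (f g : T -> C) S : f =1 g -> hs f S -> hs g S.
Proof.
by move=> fg fS e /fS[s0 h]; exists s0 => s us /(h s us); rewrite (eq_bigr _ (fun i _ => fg i)).
Qed.

Lemma hsN (T : eqType) (f : T -> C) S : hs f S -> hs (fun i => - f i) (- S).
Proof. by move=> /(hsZ (-1)); rewrite mulN1r; apply: eq_hs => i; rewrite mulN1r. Qed.

Lemma hs0 (T : eqType) : hs (fun _ : T => 0) 0.
Proof. by move=> e e0; exists [::] => s _ _; rewrite big1// subrr nrm0. Qed.

Lemma hs_finite (T : eqType) (f : T -> C) s0 : uniq s0 -> (forall i, i \notin s0 -> f i = 0) ->
  hs f (\sum_(i <- s0) f i).
Proof.
move=> us0 f0 e e0; exists s0 => s us s0s.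
have pe : perm_eq s (s0 ++ [seq x <- s | x \notin s0]).
  apply: uniq_perm => //.
    rewrite cat_uniq us0 filter_uniq// andbT/=; apply/hasPn => x.
    by rewrite mem_filter => /andP[].
  move=> x; rewrite mem_cat mem_filter; case: (boolP (x \in s0)) => //= xs.
  by rewrite s0s.
have z : \sum_(i <- [seq x <- s | x \notin s0]) f i = 0.
  by rewrite big_seq big1// => i; rewrite mem_filter => /andP[/f0].
by rewrite (perm_big _ pe) big_cat/= z addr0 subrr nrm0.
Qed.

Lemma hs_real (T : eqType) (g : T -> R) : (forall i, 0 <= g i) -> bsum g ->
  exists S, hs (fun i => toC (g i)) S.
Proof.
move=> g0 /(bsum_real g0)[S hS]; exists (toC S) => e /hS[s0 h]; exists s0 => s us ss.
by rewrite -toC_sum -toCN -toCD nrm_toC h.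
Qed.

(** A signed family is the difference of the nonnegative families |g| + g and |g|. *)
Lemma hs_sreal (T : eqType) (g : T -> R) (f : T -> C) :
  (forall i, `|g i| <= nrm (f i)) -> summ f -> exists S, hs (fun i => toC (g i)) S.
Proof.
move=> gf sf.
have [S1 h1] : exists S, hs (fun i => toC (`|g i| + g i)) S.
  apply: hs_real.
    by move=> i; have := ler_norm (- g i); rewrite normrN; lra.
  apply: (@bsum_le _ _ _ (fun i => 2 * nrm (f i))); last exact: bsumZ.
  by move=> i; have := ler_norm (g i); have := gf i; lra.
have [S2 h2] : exists S, hs (fun i => toC `|g i|) S.
  by apply: hs_real => //; exact: bsum_le sf.
exists (S1 - S2); apply: eq_hs (hsD h1 (hsN h2)) => i.
by rewrite toCD; ring.
Qed.

Lemma hs_tot (T : eqType) (f : T -> C) : summ f -> hs f (tot f).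
Proof.
move=> sf; suff [S fS] : exists S, hs f S by rewrite (hsE fS).
have [S1 h1] := hs_sreal (fun i => Re_nrm (f i)) sf.
have [S2 h2] := hs_sreal (fun i => Im_nrm (f i)) sf.
exists (S1 + cplx 0 1 * S2); apply: eq_hs (hsD h1 (hsZ _ h2)) => i.
by rewrite [RHS]CplxE.
Qed.

Lemma summ_le (T : eqType) (f : T -> C) (g : T -> R) :
  (forall i, nrm (f i) <= g i) -> bsum g -> summ f.
Proof. exact: bsum_le. Qed.

Lemma eq_summ (T : eqType) (f g : T -> C) : f =1 g -> summ f -> summ g.
Proof. by move=> fg; apply: bsum_le => i; rewrite fg. Qed.

Lemma summD (T : eqType) (f g : T -> C) : summ f -> summ g -> summ (fun i => f i + g i).
Proof. by move=> sf sg; apply: summ_le (bsumD sf sg) => i; exact: nrmD. Qed.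

Lemma summZ (T : eqType) (f : T -> C) c : summ f -> summ (fun i => c * f i).
Proof. by move=> sf; apply: summ_le (bsumZ (nrm_ge0 c) sf) => i; rewrite nrmM. Qed.

Lemma summ_prod (T U : eqType) (f : T -> C) (g : U -> C) : summ f -> summ g ->
  summ (fun p : T * U => f p.1 * g p.2).
Proof.
move=> sf sg; apply: summ_le (bsum_prod _ _ sf sg) => [[i j]|i|i] /=; rewrite ?nrm_ge0//.
by rewrite nrmM.
Qed.

Lemma summ_inj (T U : eqType) (f : T -> C) (phi : U -> T) : injective phi ->
  summ f -> summ (f \o phi).
Proof. by move=> ip; exact: (bsum_inj ip). Qed.

Lemma eq_tot (T : eqType) (f g : T -> C) : f =1 g -> tot f = tot g.
Proof. by move=> /funext ->. Qed.

Lemma totD (T : eqType) (f g : T -> C) : summ f -> summ g ->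
  tot (fun i => f i + g i) = tot f + tot g.
Proof. by move=> sf sg; apply: hsE; apply: hsD; exact: hs_tot. Qed.

Lemma totZ (T : eqType) (f : T -> C) c : summ f -> tot (fun i => c * f i) = c * tot f.
Proof. by move=> sf; apply: hsE; apply: hsZ; exact: hs_tot. Qed.

Lemma hs_reindex (T U : eqType) (f : T -> C) (phi : U -> T) (psi : T -> U) S :
  cancel phi psi -> cancel psi phi -> hs f S -> hs (f \o phi) S.
Proof.
move=> K1 K2 fS e /fS[s0 h]; exists (map psi s0) => s us ss.
have := h (map phi s); rewrite big_map map_inj_uniq ?us; last exact: can_inj K1.
apply=> // x xs; apply/mapP; exists (psi x); last by rewrite K2.
by apply/ss/map_f.
Qed.

Lemma tot_reindex (T U : eqType) (f : T -> C) (phi : U -> T) (psi : T -> U) :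
  cancel phi psi -> cancel psi phi -> summ f -> tot (f \o phi) = tot f.
Proof. by move=> K1 K2 sf; apply: hsE; apply: hs_reindex (K1) (K2) _; exact: hs_tot. Qed.

Lemma hs_le (T : eqType) (f : T -> C) S (B : R) :
  (forall s, uniq s -> nrm (\sum_(i <- s) f i) <= B) -> hs f S -> nrm S <= B.
Proof.
move=> fB fS; apply/ler_addgt0Pr => e e0; have [s0 h] := fS e e0.
have := h (undup s0) (undup_uniq _) (fun x xs => etrans (mem_undup s0 x) xs).
have := fB _ (undup_uniq s0); set a := \sum_(i <- _) _ => h1 h2.
by rewrite -(subrK a S) (le_trans (nrmD _ _))// addrC; lra.
Qed.

Lemma hs_tail (T : eqType) (f : T -> C) S (s0 : seq T) (e : R) : uniq s0 ->
  (forall s, uniq s -> (forall i, i \in s -> i \notin s0) -> \sum_(i <- s) nrm (f i) < e) ->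
  hs f S -> nrm (S - \sum_(i <- s0) f i) <= e.
Proof.
move=> us0 h fS; apply/ler_addgt0Pr => d d0; have [s1 h1] := fS d d0.
pose s := undup (s0 ++ s1).
have us : uniq s by exact: undup_uniq.
have /h1-/(_ us) g1 : {subset s1 <= s}.
  by move=> x xs; rewrite mem_undup mem_cat xs orbT.
have E : \sum_(i <- s) f i = \sum_(i <- s0) f i + \sum_(i <- s | i \notin s0) f i.
  rewrite (bigID (mem s0))/=; congr (_ + _).
  rewrite -big_filter; apply: perm_big; apply: uniq_perm => //; first exact: filter_uniq.
  by move=> x; rewrite mem_filter mem_undup mem_cat; case: (x \in s0).
have := h [seq i <- s | i \notin s0] (filter_uniq _ us).
rewrite big_filter => g2.
have {}g2 : \sum_(i <- s | i \notin s0) nrm (f i) < e.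
  by apply: g2 => i; rewrite mem_filter => /andP[].
rewrite [X in nrm X](_ : _ = (S - \sum_(i <- s) f i) + \sum_(i <- s | i \notin s0) f i); last first.
  by rewrite E; ring.
apply: le_trans (nrmD _ _) _.
have := nrm_sum s (fun i => i \notin s0) f; lra.
Qed.

(** Finitely many row sums are approximated on one common finite set of columns. The resulting
    finite rectangles are controlled by the absolute bound for summability, and by [hs_tail] for the
    value of the total. *)
Lemma fubini (T U : eqType) (f : T * U -> C) : summ f ->
  summ (fun i => tot (fun j => f (i, j))) /\ hs (fun i => tot (fun j => f (i, j))) (tot f).
Proof.
move=> sf.
have row i : hs (fun j => f (i, j)) (tot (fun j => f (i, j))).
  by apply: hs_tot; apply: (@summ_inj _ _ f (pair i)) sf => ? ? [].
split.
- have [B fB] := sf; exists B => s us.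
  apply/ler_addgt0Pr => e e0.
  (* The error e is shared equally among the rows; the successor keeps the denominator positive. *)
  pose d := e / (size s).+1%:R; have d0 : 0 < d by rewrite divr_gt0.
  have /choice[b hb] i : exists b : seq U, forall s, uniq s -> {subset b <= s} ->
      nrm (tot (fun j => f (i, j)) - \sum_(j <- s) f (i, j)) < d by exact: row.
  pose t := undup (flatten [seq b i | i <- s]).
  have bt i : i \in s -> {subset b i <= t}.
    by move=> si x xb; rewrite mem_undup; apply/flattenP; exists (b i) => //; exact: map_f.
  apply: (@le_trans _ _ (\sum_(i <- s) (\sum_(j <- t) nrm (f (i, j)) + d))).
    rewrite big_seq [leRHS]big_seq; apply: ler_sum => i si.
    have := hb i t (undup_uniq _) (bt i si).
    have := nrm_sum t xpredT (fun j => f (i, j)).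
    set a := tot _; set c := \sum_(j <- t) f _ => h1 h2.
    by rewrite -(subrK c a) (le_trans (nrmD _ _))// addrC; lra.
  rewrite big_split/= lerD//.
    have := fB [seq (i, j) | i <- s, j <- t]; rewrite big_allpairs_dep; apply.
    by rewrite allpairs_uniq ?undup_uniq// => -[? ?] [? ?].
  have -> : \sum_(i <- s) d = d * (size s)%:R.
    by rewrite big_const_seq count_predT iter_addr_0 mulr_natr.
  by rewrite /d mulrAC ler_pdivrMr// ler_wpM2l ?(ltW e0)// ler_nat.
- move=> e e0; have e2 : 0 < e / 2 by lra.
  have [s0 us0 h0] := bsum_tail (fun i => nrm_ge0 (f i)) sf e2.
  exists (undup (unzip1 s0)) => s us ss.
  pose d := e / 2 / (size s).+1%:R; have d0 : 0 < d by rewrite !divr_gt0.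
  have /choice[b hb] i : exists b : seq U, forall s, uniq s -> {subset b <= s} ->
      nrm (tot (fun j => f (i, j)) - \sum_(j <- s) f (i, j)) < d by exact: row.
  pose t := undup (unzip2 s0 ++ flatten [seq b i | i <- s]).
  have bt i : i \in s -> {subset b i <= t}.
    move=> si x xb; rewrite mem_undup mem_cat; apply/orP; right.
    by apply/flattenP; exists (b i) => //; exact: map_f.
  have ust : uniq [seq (i, j) | i <- s, j <- t].
    by rewrite allpairs_uniq ?undup_uniq// => -[? ?] [? ?].
  have g1 : nrm (tot f - \sum_(p <- [seq (i, j) | i <- s, j <- t]) f p) <= e / 2.
    apply: (hs_tail ust _ (hs_tot sf)) => s' us' dis; apply: h0 => // p ps'.
    apply: contra (dis _ ps'); case: p {ps'} => x y xy.
    apply/allpairsP; exists (x, y); split => //=.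
      by apply: ss; rewrite mem_undup; apply/mapP; exists (x, y).
    by rewrite mem_undup mem_cat; apply/orP; left; apply/mapP; exists (x, y).
  rewrite big_allpairs_dep/= in g1.
  set a := tot f in g1 *; set c := \sum_(i <- s) \sum_(j <- t) f (i, j) in g1.
  rewrite -(subrK c a) -addrA (le_lt_trans (nrmD _ _))//.
  have g2 : nrm (c - \sum_(i <- s) tot (fun j => f (i, j))) < e / 2.
    rewrite -sumrB (le_lt_trans (nrm_sum _ _ _))//.
    apply: (@le_lt_trans _ _ (\sum_(i <- s) d)).
      rewrite big_seq [leRHS]big_seq; apply: ler_sum => i si; rewrite nrm_dist ltW//.
      exact: hb (undup_uniq _) (bt i si).
    have -> : \sum_(i <- s) d = d * (size s)%:R.
      by rewrite big_const_seq count_predT iter_addr_0 mulr_natr.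
    by rewrite /d mulrAC ltr_pdivrMr// ltr_pM2l// ltr_nat.
  lra.
Qed.

Lemma tot_fubini (T U : eqType) (f : T * U -> C) : summ f ->
  tot (fun i => tot (fun j => f (i, j))) = tot f.
Proof. by move=> /fubini[_ /hsE]. Qed.

Lemma summ_swap (T U : eqType) (f : T * U -> C) : summ f -> summ (fun p => f (p.2, p.1)).
Proof. by apply: (@summ_inj _ _ f (fun p => (p.2, p.1))) => -[? ?] [? ?] [-> ->]. Qed.

Lemma fubini_swap (T U : eqType) (f : T * U -> C) : summ f ->
  summ (fun j => tot (fun i => f (i, j))) /\ hs (fun j => tot (fun i => f (i, j))) (tot f).
Proof.
move=> sf; have [h1 h2] := fubini (summ_swap sf); split => //.
rewrite -(tot_reindex (phi := fun p => (p.2, p.1)) (psi := fun p => (p.2, p.1)) _ _ sf) //.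
  by move=> -[].
by move=> -[].
Qed.

Lemma hs1 (T : eqType) (f : T -> C) a : (forall i, i != a -> f i = 0) -> hs f (f a).
Proof.
move=> f0; rewrite -[X in hs _ X](big_seq1 +%R a f); apply: hs_finite => // i.
by rewrite inE; exact: f0.
Qed.

(** Fubini for the family on T * U supported on the graph of [phi]: the total can be grouped by the
    values of [phi]. *)
Lemma tot_fiber (T U : eqType) (f : T -> C) (phi : T -> U) : summ f ->
  summ (fun u => tot (fun t => (phi t == u)%:R * f t)) /\
  hs (fun u => tot (fun t => (phi t == u)%:R * f t)) (tot f).
Proof.
move=> sf; pose g (p : T * U) := (phi p.1 == p.2)%:R * f p.1.
have sg : summ g.
  have [B fB] := sf; exists B => s us.
  rewrite (bigID (fun p => phi p.1 == p.2))/= [X in _ + X]big1 ?addr0; last first.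
    by move=> i /negPf h; rewrite /g h mul0r nrm0.
  rewrite (eq_bigr (fun p => nrm (f p.1))); last first.
    by move=> i h; rewrite /g h mul1r.
  rewrite -big_filter -(big_map fst xpredT (fun i => nrm (f i))); apply: fB.
  rewrite map_inj_in_uniq ?filter_uniq// => -[a b] [c d].
  by rewrite !mem_filter/= => /andP[/eqP <- _] /andP[/eqP <- _] ->.
have [h1 h2] := fubini_swap sg; split => //.
suff <- : tot g = tot f by [].
rewrite -(tot_fubini sg); apply: eq_tot => i.
rewrite /g/=; have h : hs (fun j => (phi i == j)%:R * f i) ((phi i == phi i)%:R * f i).
  by apply: (hs1 (a := phi i)) => j /negPf; rewrite eq_sym => ->; rewrite mul0r.
by rewrite (hsE h) eqxx mul1r.
Qed.

Lemma hs_series (f : nat -> C) S : hs f S -> series f @ \oo --> S.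
Proof.
move=> fS; apply/cvgC_P => e /fS[s0 h].
exists (\max_(i <- s0) i).+1 => // n /= n0.
rewrite /series/= /index_iota subn0; apply: h; first exact: iota_uniq.
move=> i si; rewrite mem_iota/= add0n; apply: leq_trans n0.
by rewrite ltnS; exact: (leq_bigmax_seq i (P := xpredT) (F := id)).
Qed.

(** Dominated convergence for sums. Outside a finite set the dominating family contributes less than
    e / 4 to either sum, and on that set the convergence is termwise. *)
Lemma tannery (T : eqType) (I : Type) (F : set_system I) {FF : Filter F}
    (f : I -> T -> C) (f0 : T -> C) (g : T -> R) :
  (forall t, 0 <= g t) -> bsum g ->
  (\forall n \near F, forall t, nrm (f n t) <= g t) ->
  (forall t, nrm (f0 t) <= g t) ->
  (forall t, f n t @[n --> F] --> f0 t) ->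
  tot (f n) @[n --> F] --> tot f0.
Proof.
move=> g0 bg fg f0g ff; apply/cvgC_P => e e0; have e4 : 0 < e / 4 by lra.
have [s0 us0 h0] := bsum_tail g0 bg e4.
have tail h : (forall t, nrm (h t) <= g t) -> nrm (tot h - \sum_(i <- s0) h i) <= e / 4.
  move=> hg; apply: (hs_tail us0 _ (hs_tot (summ_le hg bg))) => s us dis.
  by apply: le_lt_trans (h0 s us dis); apply: ler_sum.
have : \sum_(t <- s0) f n t @[n --> F] --> \sum_(t <- s0) f0 t.
  exact: cvgC_sum.
move=> /cvgC_P h; have := h _ e4; apply: filterS2 fg => n fg g1.
have g2 := tail _ fg; have g3 := tail _ f0g.
rewrite [X in nrm X](_ : _ = (tot f0 - \sum_(i <- s0) f0 i) +
    (\sum_(i <- s0) f0 i - \sum_(t <- s0) f n t) - (tot (f n) - \sum_(i <- s0) f n i)); last by ring.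
apply: le_lt_trans (nrmB _ _) _; have := nrmD (tot f0 - \sum_(i <- s0) f0 i) (\sum_(i <- s0) f0 i - \sum_(t <- s0) f n t).
lra.
Qed.

(** The two one-sided limits in [zsum] are the sums over the fibres of the sign, so [tot_fiber]
    applies. *)
Lemma zsum_tot (u : int -> C) : summ u -> zsum u = tot u.
Proof.
move=> su.
have s1 : summ (fun n : nat => u n%:Z) by apply: (@summ_inj _ _ u (fun n : nat => n%:Z)) su => ? ? [].
have s2 : summ (fun n : nat => u (Negz n)) by apply: (@summ_inj _ _ u Negz) su => ? ? [].
rewrite /zsum (lim_C (hs_series (hs_tot s1))) (lim_C (hs_series (hs_tot s2))).
have [_ h] := tot_fiber (fun n : int => if n is Posz _ then true else false) su.
rewrite -(hsE h) (hsE (hs_finite (s0 := [:: true; false]) _ _))//; last by case.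
rewrite !big_cons big_nil addr0.
congr (_ + _); symmetry; apply: hsE => e e0.
- have [s0 h0] := hs_tot s1 e0.
  exists [seq n%:Z | n <- s0] => s us ss.
  rewrite (bigID (fun n : int => if n is Posz _ then true else false))/= [X in _ - (_ + X)]big1 ?addr0; last first.
    by case=> // n _; rewrite mul0r.
  have -> : \sum_(i <- s | if i is Posz _ then true else false)
      ((if i is Posz _ then true else false) == true)%:R * u i =
      \sum_(n <- [seq `|i|%N | i <- [seq i <- s | if i is Posz _ then true else false]]) u n%:Z.
    by rewrite big_map big_filter; apply: eq_bigr => -[] // n _; rewrite mul1r.
  apply: h0.
    rewrite map_inj_in_uniq ?filter_uniq// => -[n|n] [m|m]; rewrite !mem_filter//=.
    by move=> _ _ ->.
  move=> n ns; apply/mapP; exists n%:Z => //; rewrite mem_filter/=.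
  by apply: ss; exact: map_f.
- have [s0 h0] := hs_tot s2 e0.
  exists [seq Negz n | n <- s0] => s us ss.
  rewrite (bigID (fun n : int => if n is Posz _ then false else true))/= [X in _ - (_ + X)]big1 ?addr0; last first.
    by case=> // n _; rewrite mul0r.
  have -> : \sum_(i <- s | if i is Posz _ then false else true)
      ((if i is Posz _ then true else false) == false)%:R * u i =
      \sum_(n <- [seq `|i|%N.-1 | i <- [seq i <- s | if i is Posz _ then false else true]]) u (Negz n).
    by rewrite big_map big_filter; apply: eq_bigr => -[] // n _; rewrite mul1r.
  apply: h0.
    rewrite map_inj_in_uniq ?filter_uniq// => -[n|n] [m|m]; rewrite !mem_filter//=.
    by move=> _ _ ->.
  move=> n ns; apply/mapP; exists (Negz n) => //; rewrite mem_filter/=.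
  by apply: ss; exact: map_f.
Qed.

End Sums.

(** * Power series *)

Section PowerSeries.
Context {R : realType}.
Local Notation C := (Cplx R).
Implicit Types (c d : nat -> C) (f g : C -> C) (r : R).

Definition psum c r := summ (fun k : nat => c k * toC r ^+ k).
Definition ps c (z : C) : C := tot (fun k : nat => c k * z ^+ k).
(** Unlike [has_expansion], this has absolute convergence on a disc built in; [has_expansion_ps]
    recovers it from pointwise convergence. *)
Definition has_ps f c :=
  exists2 r, 0 < r & psum c r /\ forall z, z != 0 -> nrm z < r -> f z = ps c z.
Definition cauchy c d : nat -> C := fun k => \sum_(i < k.+1) c i * d (k - i)%N.

Lemma summ_ps c r z : psum c r -> nrm z <= r -> summ (fun k : nat => c k * z ^+ k).
Proof.
move=> sc zr; apply: summ_le sc => k.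
have r0 : 0 <= r by apply: le_trans zr; exact: nrm_ge0.
rewrite !nrmM !nrmX nrm_toC (ger0_norm r0) ler_wpM2l ?nrm_ge0//.
by rewrite lerXn2r// nnegrE ?nrm_ge0.
Qed.

Lemma psum_le c r r' : psum c r -> 0 <= r' <= r -> psum c r'.
Proof. by move=> sc /andP[r0 rr]; apply: summ_ps sc _; rewrite nrm_toC ger0_norm. Qed.

Lemma psum_bound c r : 0 < r -> psum c r -> exists2 B, 0 < B & forall k, nrm (c k) <= B / r ^+ k.
Proof.
move=> r0 [B cB]; exists (`|B| + 1); first by rewrite ltr_wpDl.
move=> k; rewrite ler_pdivlMr ?exprn_gt0//.
have := cB [:: k] isT; rewrite big_seq1 nrmM nrmX nrm_toC gtr0_norm// => h.
by rewrite (le_trans h)// (le_trans (ler_norm _))// lerDl.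
Qed.

Lemma bound_psum c r r' (B : R) : 0 < r -> (forall k, nrm (c k) <= B / r ^+ k) ->
  0 <= r' < r -> psum c r'.
Proof.
move=> r0 cB /andP[r'0 r'r].
have h : bsum (fun k : nat => B * (r' / r) ^+ k).
  apply: bsumZ; last by apply: bsum_geo; rewrite divr_ge0 ?(ltW r0)//= ltr_pdivrMr// mul1r.
  by have := le_trans (nrm_ge0 _) (cB 0); rewrite expr0 divr1.
apply: summ_le h => k.
rewrite nrmM nrmX nrm_toC ger0_norm// expr_div_n.
by rewrite mulrCA mulrC; apply: ler_wpM2l; rewrite ?exprn_ge0.
Qed.

(** Write t = s^2. Since k s^k is at most the sum of the s^i with i < k, it is bounded by 1/(1 - s),
    which trades one factor k for one power s^k. *)
Lemma bsum_poly m (t : R) : 0 <= t < 1 -> bsum (fun k : nat => k%:R ^+ m * t ^+ k).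
Proof.
elim: m t => [|m IH] t /andP[t0 t1].
  by apply: bsum_le (bsum_geo (_ : 0 <= t < 1)) => [k|]; rewrite ?expr0 ?mul1r// t0.
have [s [s0 s1 st]] : exists s : R, [/\ 0 <= s, s < 1 & t = s * s].
  exists (Num.sqrt t); split; first exact: sqrtr_ge0.
    by rewrite -sqrtr1 ltr_sqrt.
  by rewrite -expr2 sqr_sqrtr.
have ks (k : nat) : k%:R * s ^+ k <= (1 - s)^-1.
  rewrite -(ler_pM2l (_ : 0 < 1 - s)) ?subr_gt0// divff; last by rewrite subr_eq0 gt_eqF.
  have h : (1 - s) * \sum_(i < k) s ^+ i = 1 - s ^+ k.
    by rewrite -opprB mulNr -subrX1 opprB.
  apply: (@le_trans _ _ (1 - s ^+ k)); last by rewrite gerBl exprn_ge0.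
  rewrite -h ler_wpM2l ?subr_ge0 ?(ltW s1)//.
  rewrite mulr_natl -[X in _ *+ X]card_ord -sumr_const; apply: ler_sum => i _.
  by rewrite ler_wiXn2l// ?(ltW s1)// ltnW.
have s1' : 0 <= (1 - s)^-1 by rewrite invr_ge0 subr_ge0 ltW.
apply: (bsum_le _ (bsumZ s1' (IH s _))); last by rewrite s0.
move=> k; rewrite st exprMn exprS.
have p0 (n : nat) : 0 <= s ^+ n by apply: exprn_ge0.
have k0 : 0 <= (k%:R : R) by [].
have km0 : 0 <= (k%:R : R) ^+ m by apply: exprn_ge0.
rewrite [leLHS](_ : _ = k%:R * s ^+ k * (k%:R ^+ m * s ^+ k)); last by ring.
by apply: (ler_pM _ _ (ks k) (lexx _)); apply: mulr_ge0.
Qed.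

Lemma near0P (P : C -> Prop) :
  (\forall z \near (0 : C)^', P z) <-> exists2 r : R, 0 < r & forall z, z != 0 -> nrm z < r -> P z.
Proof.
split.
- move=> /nbhs_ballP[e /= e0 h].
  have eE : e = toC (ReC e) by apply: CplxP => //; move: e0; rewrite ltcE => /andP[/eqP].
  have r0 : 0 < ReC e by rewrite -lt_toC -eE.
  exists (ReC e) => // z z0 zr; apply: h => //=.
  by rewrite -ball_normE/= sub0r normE nrmN eE lt_toC.
- move=> [r r0 h]; apply/nbhs_ballP; exists (toC r); first by rewrite /= lt_toC.
  move=> z; rewrite -ball_normE/= sub0r normE nrmN lt_toC => zr z0; exact: h.
Qed.

Lemma nearC_P (a : C) (P : C -> Prop) :
  (\forall z \near a, P z) <-> exists2 r : R, 0 < r & forall z, nrm (z - a) < r -> P z.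
Proof.
split.
- move=> /nbhs_ballP[e /= e0 h].
  have eE : e = toC (ReC e) by apply: CplxP => //; move: e0; rewrite ltcE => /andP[/eqP].
  have r0 : 0 < ReC e by rewrite -lt_toC -eE.
  exists (ReC e) => // z zr; apply: h => //=.
  by rewrite -ball_normE/= normE nrm_dist eE lt_toC.
- move=> [r r0 h]; apply/nbhs_ballP; exists (toC r); first by rewrite /= lt_toC.
  by move=> z; rewrite -ball_normE/= normE nrm_dist lt_toC => /h.
Qed.

Lemma has_ps_expansion f c : has_ps f c -> has_expansion f c.
Proof.
move=> [r r0 [sc fc]]; apply/near0P; exists r => // z z0 zr.
rewrite (fc z z0 zr); apply: hs_series; apply: hs_tot.
exact: summ_ps sc (ltW zr).
Qed.

Lemma cvg_bounded (u : nat -> C) (l : C) : u @ \oo --> l -> exists B, forall n, nrm (u n) <= B.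
Proof.
move=> /cvgC_P/(_ _ ltr01)[N _ h].
exists (nrm l + 1 + \sum_(i < N) nrm (u i)) => n.
have [nN|Nn] := ltnP n N.
  rewrite (bigD1 (Ordinal nN))//= addrCA lerDl.
  by rewrite !addr_ge0 ?nrm_ge0// sumr_ge0// => *; rewrite nrm_ge0.
rewrite ler_wpDr//; first by rewrite sumr_ge0// => *; rewrite nrm_ge0.
have := h n Nn => /= h1.
rewrite -[u n](subKr l) (le_trans (nrmB _ _))// lerD2l ltW//.
Qed.

(** Convergence at radius r/2 bounds the partial sums there, hence the terms, and a comparison with
    a geometric series gives absolute convergence at r/4. *)
Lemma has_expansion_ps f c : has_expansion f c -> has_ps f c.
Proof.
move=> /near0P[r r0 h]; have r20 : 0 < r / 2 by lra.
have [||B hB] := cvg_bounded (h (toC (r / 2)) _ _).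
- by rewrite -nrm_gt0 nrm_toC gtr0_norm.
- by rewrite nrm_toC gtr0_norm; lra.
have cB k : nrm (c k) <= (B + B) / (r / 2) ^+ k.
  rewrite ler_pdivlMr ?exprn_gt0//.
  have := hB k.+1; have := hB k; rewrite /series/= big_nat_recr//=.
  set S := \sum_(0 <= i < k) _ => h1 h2.
  have -> : nrm (c k) * (r / 2) ^+ k = nrm ((S + c k * toC (r / 2) ^+ k) - S).
    by rewrite addrAC subrr add0r nrmM nrmX nrm_toC gtr0_norm.
  by rewrite (le_trans (nrmB _ _))// lerD.
have sc : psum c (r / 4) by apply: bound_psum cB _ => //; lra.
exists (r / 4); first lra; split => // z z0 zr.
apply: cvgC_uniq (h z z0 _) (hs_series (hs_tot _)); first lra.
by apply: summ_ps sc _; rewrite ltW.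
Qed.

Lemma ps_recl c r z : psum c r -> 0 < r -> nrm z <= r ->
  psum (fun k => c k.+1) r /\ ps c z = c 0%N + z * ps (fun k => c k.+1) z.
Proof.
move=> sc r0 zr; have sc' : psum (fun k => c k.+1) r.
  have r'0 : toC r != 0 :> C by rewrite -nrm_gt0 nrm_toC gtr0_norm.
  have := summZ (toC r)^-1 (summ_inj succn_inj sc); apply: eq_summ => k /=.
  by rewrite exprS; field.
split => //.
have h1 := hs_series (hs_tot (summ_ps sc zr)).
have h2 := hs_series (hs_tot (summ_ps sc' zr)).
have {}h1 : series (fun k : nat => c k * z ^+ k) n.+1 @[n --> \oo] --> ps c z.
  by apply/cvgC_P => e e0; have /cvgC_P/(_ e e0)[N _ hN] := h1; exists N => // n /= Nn; apply: hN => /=; exact: leqW.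
apply: cvgC_uniq h1 _.
rewrite (_ : (fun n => _) = (fun n => c 0%N + z * series (fun k : nat => c k.+1 * z ^+ k) n)).
  by apply: cvgCD; [exact: cvg_cst|exact: cvgCZ].
apply/funext => n; rewrite /series/= big_nat_recl//= expr0 mulr1; congr (_ + _).
by rewrite mulr_sumr; apply: eq_bigr => i _; rewrite exprS mulrCA.
Qed.

Lemma ps_bounded c r : psum c r -> exists B, forall z, nrm z <= r -> nrm (ps c z) <= B.
Proof.
move=> sc; have [B cB] := sc; exists B => z zr.
apply: hs_le (hs_tot (summ_ps sc zr)) => s us.
rewrite (le_trans (nrm_sum _ _ _))// (le_trans _ (cB s us))//; apply: ler_sum => k _.
have r0 : 0 <= r by apply: le_trans zr; exact: nrm_ge0.
rewrite !nrmM !nrmX nrm_toC (ger0_norm r0) ler_wpM2l ?nrm_ge0//.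
by rewrite lerXn2r// nnegrE ?nrm_ge0.
Qed.

(** The constant coefficient equals -z times a bounded function of z, and z may be taken arbitrarily
    small. *)
Lemma ps0_coef0 c r : 0 < r -> psum c r ->
  (forall z, z != 0 -> nrm z < r -> ps c z = 0) -> c 0%N = 0.
Proof.
move=> r0 sc h0.
have [|sc' _] := @ps_recl c r 0 sc r0; first by rewrite nrm0 ltW.
have [B hB] := ps_bounded sc'.
apply: nrm_small => e e0.
pose t := Num.min (r / 2) (e / (2 * (`|B| + 1))).
have B1 : 0 < `|B| + 1 by rewrite ltr_wpDl.
have t0 : 0 < t by rewrite lt_min; apply/andP; split; [lra|rewrite divr_gt0//; lra].
have tr : t < r by rewrite gt_min; apply/orP; left; lra.
have nt : nrm (toC t : C) = t by rewrite nrm_toC gtr0_norm.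
have := h0 (toC t); rewrite -nrm_gt0 nt => /(_ t0 tr).
have [|_ ->] := @ps_recl c r (toC t) sc r0; first by rewrite nt ltW.
move=> /eqP; rewrite addr_eq0 => /eqP ->; rewrite nrmN nrmM nt.
have h1 : nrm (ps (fun k => c k.+1) (toC t)) <= `|B| + 1.
  apply: le_trans (hB _ _) _; first by rewrite nt ltW.
  by rewrite (le_trans (ler_norm _))// lerDl.
have h2 : t <= e / (2 * (`|B| + 1)) by rewrite ge_min lexx orbT.
apply: (@le_lt_trans _ _ (e / (2 * (`|B| + 1)) * (`|B| + 1))).
  by apply: ler_pM => //; rewrite ?nrm_ge0// ltW.
have -> : e / (2 * (`|B| + 1)) * (`|B| + 1) = e / 2 by field; lra.
lra.
Qed.

Lemma ps0_uniq c r : 0 < r -> psum c r ->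
  (forall z, z != 0 -> nrm z < r -> ps c z = 0) -> forall k, c k = 0.
Proof.
move=> r0 sc h0 k; elim: k c sc h0 => [|k IH] c sc h0; first exact: ps0_coef0 h0.
have [|sc' _] := @ps_recl c r 0 sc r0; first by rewrite nrm0 ltW.
apply: (IH (fun k => c k.+1)) => // z z0 zr.
have [_ h] := ps_recl sc r0 (ltW zr).
move: h; rewrite h0// (ps0_coef0 r0 sc h0) add0r => /esym/eqP.
by rewrite mulf_eq0 (negPf z0) => /eqP.
Qed.

Lemma has_ps2 f g c d : has_ps f c -> has_ps g d -> exists2 r, 0 < r &
  [/\ psum c r, psum d r & forall z, z != 0 -> nrm z < r -> f z = ps c z /\ g z = ps d z].
Proof.
move=> [r r0 [sc fc]] [r' r'0 [sd gd]].
exists (Num.min r r'); first by rewrite lt_min r0.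
have h0 : 0 <= Num.min r r' by rewrite le_min !ltW.
split.
- by apply: psum_le sc _; rewrite h0 ge_min lexx.
- by apply: psum_le sd _; rewrite h0 ge_min lexx orbT.
- by move=> z z0; rewrite lt_min => /andP[zr zr']; rewrite fc// gd.
Qed.

Lemma has_ps_eq f g c : has_ps f c -> (\forall z \near (0 : C)^', f z = g z) -> has_ps g c.
Proof.
move=> [r r0 [sc fc]] /near0P[r' r'0 fg].
exists (Num.min r r'); first by rewrite lt_min r0.
split.
- by apply: psum_le sc _; rewrite ge_min lexx le_min (ltW r0) (ltW r'0).
- by move=> z z0; rewrite lt_min => /andP[zr zr']; rewrite -fg// fc.
Qed.

Lemma eq_has_ps f c d : has_ps f c -> c =1 d -> has_ps f d.
Proof. by move=> h /funext <-. Qed.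

Lemma has_psD f g c d : has_ps f c -> has_ps g d ->
  has_ps (fun z => f z + g z) (fun k => c k + d k).
Proof.
move=> fc gd; have [r r0 [sc sd h]] := has_ps2 fc gd.
exists r => //; split => [|z z0 zr].
  by apply: eq_summ (summD sc sd) => k; rewrite mulrDl.
have [-> ->] := h z z0 zr; rewrite /ps -totD; last 2 first.
- exact: summ_ps sc (ltW zr).
- exact: summ_ps sd (ltW zr).
by apply: eq_tot => k; rewrite mulrDl.
Qed.

Lemma has_psZ f c a : has_ps f c -> has_ps (fun z => a * f z) (fun k => a * c k).
Proof.
move=> [r r0 [sc fc]]; exists r => //; split => [|z z0 zr].
  by apply: eq_summ (summZ a sc) => k; rewrite mulrA.
rewrite fc// /ps -totZ; last exact: summ_ps sc (ltW zr).
by apply: eq_tot => k; rewrite mulrA.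
Qed.

Lemma has_psB f g c d : has_ps f c -> has_ps g d ->
  has_ps (fun z => f z - g z) (fun k => c k - d k).
Proof.
move=> fc /(has_psZ (-1)) gd.
have := has_psD fc gd; rewrite (_ : (fun z => f z + _) = (fun z => f z - g z)).
  by move=> /eq_has_ps; apply => k; rewrite mulN1r.
by apply/funext => z; rewrite mulN1r.
Qed.

Lemma has_ps_uniq f c d : has_ps f c -> has_ps f d -> c = d.
Proof.
move=> fc fd; apply/funext => k; apply/subr0_eq.
have [r r0 [sc h]] := has_psB fc fd.
apply: (ps0_uniq (c := fun k => c k - d k) r0 sc) => z z0 zr.
by rewrite -h// subrr.
Qed.

(** This makes the choice in [expansion] computable: by uniqueness of coefficients, any power series
    that represents f is the chosen one. *)
Lemma expansionE f c : has_ps f c -> expansion f = c.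
Proof.
move=> fc; apply: xget_unique => [|d /has_expansion_ps fd]; first exact: has_ps_expansion.
exact: has_ps_uniq fd fc.
Qed.

(** The product family over pairs (i, j) is summed in two ways: by rows, and grouped by i + j. *)
Lemma psM c d r z : psum c r -> psum d r -> nrm z <= r ->
  summ (fun k => cauchy c d k * z ^+ k) /\ ps (cauchy c d) z = ps c z * ps d z.
Proof.
move=> sc sd zr.
have s1 := summ_ps sc zr; have s2 := summ_ps sd zr.
have sp := summ_prod s1 s2.
have [h1 h2] := tot_fiber (fun p : nat * nat => (p.1 + p.2)%N) sp.
have E k : tot (fun p : nat * nat => ((p.1 + p.2)%N == k)%:R * (c p.1 * z ^+ p.1 * (d p.2 * z ^+ p.2)))
    = cauchy c d k * z ^+ k.
  apply: hsE.
  have := @hs_finite R _ (fun p : nat * nat => ((p.1 + p.2)%N == k)%:R * (c p.1 * z ^+ p.1 * (d p.2 * z ^+ p.2)))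
    [seq (i, (k - i)%N) | i <- iota 0 k.+1].
  rewrite big_map map_inj_in_uniq ?iota_uniq; last by move=> i j _ _ [].
  rewrite -[iota 0 k.+1]/(index_iota 0 k.+1) big_mkord (eq_bigr (fun i : 'I_k.+1 => c i * d (k - i)%N * z ^+ k)); last first.
    move=> i _ /=; rewrite subnKC ?eqxx ?mul1r -1?ltnS//.
    have -> : z ^+ k = z ^+ i * z ^+ (k - i) by rewrite -exprD subnKC// -ltnS.
    by ring.
  rewrite -mulr_suml; apply => // -[i j] /mapP h /=.
  case: eqP => [ijk|]; last by rewrite mul0r.
  exfalso; apply: h; exists i; last by rewrite -ijk addKn.
  by rewrite mem_iota add0n ltnS -ijk leq_addr.
split; first by apply: eq_summ h1.
transitivity (tot (fun p : nat * nat => c p.1 * z ^+ p.1 * (d p.2 * z ^+ p.2))).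
  by rewrite -(hsE h2); apply: eq_tot => k; rewrite E.
rewrite -(tot_fubini sp)/=.
rewrite (eq_tot (g := fun i => ps d z * (c i * z ^+ i))); last first.
  by move=> i; rewrite totZ// mulrC.
by rewrite totZ// mulrC.
Qed.

Lemma has_psM f g c d : has_ps f c -> has_ps g d ->
  has_ps (fun z => f z * g z) (cauchy c d).
Proof.
move=> fc gd; have [r r0 [sc sd h]] := has_ps2 fc gd.
exists r => //; split => [|z z0 zr].
  by have [|] := @psM c d r (toC r) sc sd; first by rewrite nrm_toC gtr0_norm.
have [-> ->] := h z z0 zr.
by have [|_ ->] := @psM c d r z sc sd; first exact: ltW.
Qed.

Definition cst_coef (a : C) : nat -> C := fun k => if k is 0%N then a else 0.

Lemma ps_cst a z : ps (cst_coef a) z = a.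
Proof.
apply: hsE; have := @hs1 R _ (fun k : nat => cst_coef a k * z ^+ k) 0%N.
by rewrite /= expr0 mulr1; apply => -[|k]//; rewrite mul0r.
Qed.

Lemma psum_cst a r : psum (cst_coef a) r.
Proof.
apply: bsum_nat => [i|]; first exact: nrm_ge0.
exists (nrm a) => -[|n]; first by rewrite big_ord0 nrm_ge0.
rewrite big_ord_recl/= expr0 mulr1 big1 ?addr0// => i _.
by rewrite mul0r nrm0.
Qed.

Lemma has_ps_cst a : has_ps (fun _ => a) (cst_coef a).
Proof.
by exists 1 => //; split => [|z _ _]; [exact: psum_cst|rewrite ps_cst].
Qed.

Definition shift_coef c : nat -> C := fun k => if k is k'.+1 then c k' else 0.

Lemma has_ps_shift f c : has_ps f c -> has_ps (fun z => z * f z) (shift_coef c).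
Proof.
move=> [r r0 [sc fc]].
have sc' : psum (shift_coef c) r.
  have [B hB] := summZ (toC r) sc; apply: bsum_nat => [i|]; first exact: nrm_ge0.
  have B0 : 0 <= B by have := hB [::] isT; rewrite big_nil.
  exists B => -[|n]; first by rewrite big_ord0.
  rewrite big_ord_recl [shift_coef c _]/= mul0r (@nrm0 R) add0r.
  rewrite (le_trans _ (hB (iota 0 n) (iota_uniq _ _)))//.
  rewrite -[n in iota 0 n]subn0 -/(index_iota 0 n) big_mkord.
  by apply: ler_sum => i _; rewrite exprS mulrCA.
exists r => //; split => // z z0 zr; rewrite fc//.
have [_ ->] := ps_recl sc' r0 (ltW zr).
by rewrite add0r.
Qed.

Lemma has_ps_unshift f c : has_ps f c -> c 0%N = 0 ->
  has_ps (fun z => f z / z) (fun k => c k.+1).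
Proof.
move=> [r r0 [sc fc]] c0; have [|sc' _] := @ps_recl c r 0 sc r0; first by rewrite nrm0 ltW.
exists r => //; split => // z z0 zr; rewrite fc//.
have [_ ->] := ps_recl sc r0 (ltW zr).
by rewrite c0 add0r mulrC mulKf.
Qed.

Lemma has_ps_id : has_ps (fun z => z) (shift_coef (cst_coef 1)).
Proof.
have := has_ps_shift (has_ps_cst 1); congr has_ps.
by apply/funext => z; rewrite mulr1.
Qed.

Lemma has_ps_scale f c a : has_ps f c -> a != 0 -> has_ps (fun z => f (a * z)) (fun k => c k * a ^+ k).
Proof.
move=> [r r0 [sc fc]] a0; have na : 0 < nrm a by rewrite nrm_gt0.
exists (r / nrm a); first by rewrite divr_gt0.
have E k z : c k * a ^+ k * z ^+ k = c k * (a * z) ^+ k by rewrite exprMn mulrA.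
split => [|z z0 zr].
  apply: (@eq_summ _ _ (fun k : nat => c k * (a * toC (r / nrm a)) ^+ k)) => [k|]; first by rewrite E.
  apply: summ_ps sc _; rewrite nrmM nrm_toC ger0_norm; last by rewrite divr_ge0 ?ltW.
  by rewrite mulrC divfK ?gt_eqF.
rewrite fc; first last.
- by move: zr; rewrite ltr_pdivlMr// nrmM mulrC.
- exact: mulf_neq0.
by apply: eq_tot => k; rewrite E.
Qed.

(* The recursion for the coefficients of the reciprocal, as the list of its
   first [n] values in reverse order. *)
Fixpoint inv_seq c n : seq C :=
  if n is n'.+1 then
    let s := inv_seq c n' in
    (if n' is 0%N then (c 0%N)^-1 else
       - (c 0%N)^-1 * \sum_(i < n') c i.+1 * nth 0 s i) :: s
  else [::].
Definition inv_coef c n : C := head 0 (inv_seq c n.+1).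

Lemma nth_inv_seq c n i : (i < n)%N -> nth 0 (inv_seq c n) i = inv_coef c (n - i.+1).
Proof.
elim: n i => // n IH [|i] ; first by rewrite subn1.
by rewrite ltnS => /IH <-.
Qed.

Lemma inv_coefS c n : inv_coef c n.+1 = - (c 0%N)^-1 * \sum_(i < n.+1) c i.+1 * inv_coef c (n - i)%N.
Proof.
have -> : inv_coef c n.+1 = - (c 0%N)^-1 * \sum_(i < n.+1) c i.+1 * nth 0 (inv_seq c n.+1) i by [].
congr (_ * _); apply: eq_bigr => i _; congr (_ * _).
by rewrite nth_inv_seq// subSS.
Qed.

Lemma cauchy_inv c : c 0%N != 0 -> cauchy c (inv_coef c) = cst_coef 1.
Proof.
move=> c0; apply/funext => -[|n].
  by rewrite /cauchy big_ord_recl big_ord0 addr0 /= mulfV.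
rewrite /cauchy big_ord_recl subn0 inv_coefS mulrA mulrN mulfV// mulN1r.
by rewrite addrC; apply/eqP; rewrite subr_eq0; apply/eqP; apply: eq_bigr => i _.
Qed.

Lemma psum_inv c r : 0 < r -> psum c r -> c 0%N != 0 -> exists2 r', 0 < r' & psum (inv_coef c) r'.
Proof.
move=> r0 sc c0; have [B B0 hB] := psum_bound r0 sc.
have [D DE] : exists D, D = (nrm (c 0%N))^-1 by exists (nrm (c 0%N))^-1.
have D0 : 0 < D by rewrite DE invr_gt0 nrm_gt0.
have [b bE] : exists b, b = D * B by exists (D * B).
have b0 : 0 < b by rewrite bE mulr_gt0.
(* With M r = 1 + b the recursion closes: the sum of b (1 + b)^-(i+1) over all i >= 0 is exactly
   1. *)
have [M ME] : exists M, M = (1 + b) / r by exists ((1 + b) / r).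
have M0 : 0 < M by rewrite ME divr_gt0// addr_gt0.
have bnd n : nrm (inv_coef c n) <= D * M ^+ n.
  elim/ltn_ind: n => -[_|n IH]; first by rewrite expr0 mulr1 /= nrmV DE.
  rewrite inv_coefS nrmM nrmN nrmV -DE ler_pM2l//.
  apply: le_trans (nrm_sum _ _ _) _.
  apply: (@le_trans _ _ (\sum_(i < n.+1) b / (1 + b) * (M ^+ n.+1 * (1 + b)^-1 ^+ i))).
    apply: ler_sum => i _; rewrite nrmM.
    apply: (@le_trans _ _ (B / r ^+ i.+1 * (D * M ^+ (n - i)))).
      by apply: ler_pM; rewrite ?nrm_ge0 ?hB ?IH// ltnS leq_subr.
    have -> : M ^+ n.+1 = M ^+ (n - i) * M ^+ i.+1 by rewrite -exprD addnS subnK// -ltnS.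
    rewrite le_eqVlt; apply/orP; left; apply/eqP.
    have -> : M ^+ i.+1 = (1 + b) ^+ i.+1 / r ^+ i.+1 by rewrite ME expr_div_n.
    rewrite exprVn !exprS.
    have h4 : (1 + b) ^+ i != 0 by rewrite expf_neq0// gt_eqF// addr_gt0.
    have h3 : 1 + b != 0 by rewrite gt_eqF// addr_gt0.
    have h2 : r ^+ i != 0 by rewrite expf_neq0// gt_eqF.
    have h1 : r != 0 by rewrite gt_eqF.
    move: (r ^+ i) ((1 + b) ^+ i) (M ^+ _) h2 h4 => p q m h2 h4.
    transitivity (b * m / (r * p)); first by rewrite bE; field; rewrite h1 h2.
    by field; rewrite h1 h2 h3 h4.
  rewrite -mulr_sumr -mulr_sumr mulrCA -[leRHS]mulr1.
  apply: ler_wpM2l; first by rewrite exprn_ge0// ltW.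
  have b1 : 1 + b != 0 by rewrite gt_eqF// addr_gt0.
  have h : (1 - (1 + b)^-1) * \sum_(i < n.+1) (1 + b)^-1 ^+ i = 1 - (1 + b)^-1 ^+ n.+1.
    by rewrite -[in RHS]opprB subrX1 -mulNr opprB.
  have -> : b / (1 + b) = 1 - (1 + b)^-1 by field.
  by rewrite h gerBl exprn_ge0// invr_ge0 addr_ge0// ltW.
exists (M^-1 / 2); first by rewrite divr_gt0// invr_gt0.
apply: (@bound_psum _ M^-1 _ D); first by rewrite invr_gt0.
  by move=> k; rewrite exprVn invrK.
have : 0 < M^-1 by rewrite invr_gt0.
lra.
Qed.

Lemma has_psV f c : has_ps f c -> c 0%N != 0 -> has_ps (fun z => (f z)^-1) (inv_coef c).
Proof.
move=> [r r0 [sc fc]] c0; have [r' r'0 sd] := psum_inv r0 sc c0.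
have m0 : 0 < Num.min r r' by rewrite lt_min r0.
exists (Num.min r r'); first by [].
have sd' : psum (inv_coef c) (Num.min r r').
  by apply: psum_le sd _; rewrite (ltW m0) ge_min lexx orbT.
have sc' : psum c (Num.min r r').
  by apply: psum_le sc _; rewrite (ltW m0) ge_min lexx.
split => // z z0 zr.
have [_] := psM sc' sd' (ltW zr); rewrite cauchy_inv// ps_cst => h.
rewrite fc//; last by rewrite (lt_le_trans zr)// ge_min lexx.
have p0 : ps c z != 0 by apply: contra_eq_neq h => ->; rewrite mul0r oner_eq0.
by apply: (mulfI p0); rewrite -h mulfV.
Qed.

Definition deriv_coef c : nat -> C := fun k => k.+1%:R * c k.+1.

(** Tannery's theorem for the difference quotients. For |z| < rho < r they are dominated termwise by
    k rho^(k-1) B / r^k, which is summable by [bsum_poly]. *)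
Lemma ps_derive c r z : psum c r -> nrm z < r ->
  is_derive z (1 : C) (ps c : C -> C) (ps (deriv_coef c) z : C).
Proof.
move=> sc zr; have r0 : 0 < r by apply: le_lt_trans zr; exact: nrm_ge0.
have [rho [zrho rhor]] : exists rho, nrm z < rho /\ rho < r by exists ((nrm z + r) / 2); lra.
have rho0 : 0 < rho by apply: le_lt_trans zrho; exact: nrm_ge0.
have [B B0 hB] := psum_bound r0 sc.
have [t tE] : exists t, t = rho / r by exists (rho / r).
have t01 : 0 <= t < 1 by rewrite tE divr_ge0 ?ltW//= ltr_pdivrMr// mul1r.
have bg : bsum (fun k : nat => B / rho * (k%:R ^+ 1 * t ^+ k)).
  by apply: bsumZ; [rewrite divr_ge0// ltW|exact: bsum_poly].
have gE (k : nat) : B / r ^+ k * (k%:R * rho ^+ k.-1) <= B / rho * (k%:R ^+ 1 * t ^+ k).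
  rewrite le_eqVlt; apply/orP; left; apply/eqP; case: k => [|k]; first by rewrite /=; ring.
  rewrite tE expr_div_n expr1 /= !exprS.
  have : r ^+ k != 0 by rewrite expf_neq0// gt_eqF.
  have : r != 0 by rewrite gt_eqF.
  have : rho != 0 by rewrite gt_eqF.
  move: (r ^+ k) => p h1 h2 h3; field; rewrite h1 h2 h3 //.
pose D h (k : nat) : C := c k * (\sum_(i < k) (h + z) ^+ (k.-1 - i) * z ^+ i).
have Dbound h : nrm (h + z) <= rho -> forall k, nrm (D h k) <= B / rho * (k%:R ^+ 1 * t ^+ k).
  move=> hr k; apply: le_trans (gE k).
  rewrite nrmM; apply: ler_pM => //; rewrite ?nrm_ge0//.
  apply: le_trans (nrm_sum _ _ _) _.
  rewrite mulr_natl -[X in _ *+ X]card_ord -sumr_const; apply: ler_sum => i _.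
  rewrite nrmM !nrmX; case: k i => [[]//|k i] /=.
  rewrite -[in leRHS](subnK (_ : i <= k)%N) -1?ltnS// exprD.
  by apply: ler_pM; rewrite ?exprn_ge0 ?nrm_ge0// lerXn2r// ?nnegrE ?nrm_ge0 ?ltW.
have lim : h^-1 *: (ps c (h *: (1 : C) + z) - ps c z) @[h --> (0 : C)^'] --> (ps (deriv_coef c) z : C).
  have T : tot (D h) @[h --> (0 : C)^'] --> tot (D 0).
    apply: (tannery (g := fun k : nat => B / rho * (k%:R ^+ 1 * t ^+ k))) => //.
    - move=> k; have [t0 _] := andP t01.
      by apply: mulr_ge0; [apply: divr_ge0; apply: ltW|apply: mulr_ge0; apply: exprn_ge0].
    - apply/near0P; exists (rho - nrm z); first by rewrite subr_gt0.
      move=> h h0 hr; apply: Dbound; rewrite (le_trans (nrmD _ _))//; lra.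
    - by apply: Dbound; rewrite add0r ltW.
    - move=> k; apply: cvg_within_filter.
      apply: (@cvgCZ _ _ _ _ (fun h => \sum_(i < k) (h + z) ^+ (k.-1 - i) * z ^+ i)).
      apply: (@cvgC_sum R C (nbhs (0:C)) _ 'I_k (index_enum 'I_k) (fun (i : 'I_k) (h : C) => (h + z) ^+ (k.-1 - i) * z ^+ i) (fun i => (0 + z) ^+ (k.-1 - i) * z ^+ i)) => i.
      apply: cvgCM; last exact: cvg_cst.
      by apply: cvgCX; apply: cvgCD; [exact: cvg_id|exact: cvg_cst].
  have -> : ps (deriv_coef c) z = tot (D 0).
    have h := summ_le (Dbound 0 _); rewrite add0r in h.
    have {}h := h (ltW zrho) bg.
    have h1 := hs_series (hs_tot h).
    have D0E k : D 0 k = c k * (k%:R * z ^+ k.-1).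
      rewrite /D add0r; congr (_ * _); rewrite mulr_natl -[X in _ *+ X]card_ord -sumr_const.
      apply: eq_bigr => i _; rewrite -exprD subnK//.
      by case: k i => [[]//|k i]; rewrite -ltnS.
    symmetry; apply: cvgC_uniq (hs_series (hs_tot _)).
      have {}h1 : series (D 0) n.+1 @[n --> \oo] --> tot (D 0).
        by apply/cvgC_P => e e0; have /cvgC_P/(_ e e0)[N _ hN] := h1; exists N => // n /= Nn; apply: hN => /=; exact: leqW.
      suff -> : series (fun k : nat => deriv_coef c k * z ^+ k) = (fun n => series (D 0) n.+1) by [].
      apply/funext => n.
      rewrite /series/= big_nat_recl//= D0E mul0r mulr0 add0r.
      by apply: eq_bigr => k _; rewrite D0E /deriv_coef mulrCA mulrA.
    apply: eq_summ (summ_inj succn_inj h) => k /=.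
    by rewrite D0E /deriv_coef mulrCA mulrA.
  move: T; apply: cvg_trans; apply: near_eq_cvg.
  apply/near0P; exists (rho - nrm z); first by rewrite subr_gt0.
  move=> h h0 hr.
  have hz : nrm (h + z) <= rho by rewrite (le_trans (nrmD _ _))//; lra.
  have sz := summ_ps sc (ltW zr).
  have shz : summ (fun k : nat => c k * (h + z) ^+ k).
    by apply: summ_ps sc _; rewrite (le_trans hz)// ltW.
  rewrite [h *: _]mulr1 [_ *: _]/GRing.scale/=.
  rewrite /ps -mulN1r -(totZ _ sz) -totD//; last exact: summZ.
  rewrite -totZ; last by apply: summD => //; exact: summZ.
  apply: eq_tot => k; rewrite mulN1r -mulrBr /D.
  have -> : (h + z) ^+ k - z ^+ k = h * \sum_(i < k) (h + z) ^+ (k.-1 - i) * z ^+ i.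
    by rewrite subrXX addrK.
  by field.
apply: DeriveDef; first by apply/cvg_ex; eexists; exact: lim.
exact: cvg_lim lim.
Qed.

Lemma psum_deriv c r r' : psum c r -> 0 <= r' < r -> psum (deriv_coef c) r'.
Proof.
move=> sc /andP[r'0 r'r]; have r0 : 0 < r by apply: le_lt_trans r'r.
have [B B0 hB] := psum_bound r0 sc.
have t01 : 0 <= r' / r < 1.
  by rewrite ltr_pdivrMr// mul1r r'r andbT divr_ge0// ltW.
have bg := bsumZ (_ : 0 <= B / r) (bsumD (bsum_poly 1 t01) (bsum_poly 0 t01)).
apply: (summ_le _ (bg _)); last by rewrite divr_ge0 ?ltW.
move=> k; rewrite /deriv_coef !nrmM nrm_nat nrmX nrm_toC ger0_norm// expr1 expr0 mul1r.
apply: (@le_trans _ _ (k.+1%:R * (B / r ^+ k.+1) * r' ^+ k)).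
  apply: ler_wpM2r; first exact: exprn_ge0.
  by apply: ler_wpM2l.
rewrite le_eqVlt; apply/orP; left; apply/eqP.
have rn : r != 0 by rewrite gt_eqF.
have : r ^+ k != 0 by rewrite expf_neq0.
rewrite expr_div_n exprS -natr1; move: (r ^+ k) => p p0.
by field; rewrite rn p0.
Qed.

Lemma near_neq (z : C) (P : C -> Prop) r : z != 0 -> nrm z < r ->
  (forall y, y != 0 -> nrm y < r -> P y) -> \forall y \near z, P y.
Proof.
move=> z0 zr h; apply/nearC_P; exists (Num.min (nrm z) (r - nrm z)).
  by rewrite lt_min nrm_gt0 z0 subr_gt0.
move=> y; rewrite lt_min => /andP[y1 y2]; apply: h.
  by apply: contraTneq y1 => ->; rewrite sub0r nrmN ltxx.
rewrite -(subrK z y) (le_lt_trans (nrmD _ _))//; lra.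
Qed.

Lemma has_ps_derive1 f c : has_ps f c -> has_ps (derive1 f : C -> C) (deriv_coef c).
Proof.
move=> [r r0 [sc fc]]; exists (r / 2); first lra.
split; first by apply: psum_deriv sc _; lra.
move=> z z0 zr2; have zr : nrm z < r by lra.
have /@derive_val <- := ps_derive sc zr.
rewrite derive1E; apply: near_eq_derive.
exact: (near_neq z0 zr).
Qed.

Lemma has_ps_is_derive f f' c : has_ps f c ->
  (\forall z \near (0 : C)^', is_derive z (1 : C) (f : C -> C) (f' z : C)) ->
  has_ps f' (deriv_coef c).
Proof.
move=> /has_ps_derive1 h; move/near0P => [r r0 hr]; apply: has_ps_eq h _.
apply/near0P; exists r => // z z0 zr; have /@derive_val <- := hr z z0 zr.
by rewrite derive1E.
Qed.

End PowerSeries.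

(** * The complex exponential *)

Section ComplexExp.
Context {R : realType}.
Local Notation C := (Cplx R).
Implicit Types z w : C.

Definition expc (k : nat) : C := (k`!%:R)^-1.

Lemma fact_neq0 k : k`!%:R != 0 :> C.
Proof. by rewrite pnatr_eq0 -lt0n fact_gt0. Qed.

Lemma psum_expc r : 0 <= r -> psum expc r.
Proof.
move=> r0; apply: bsum_nat => [i|]; first exact: nrm_ge0.
exists (expR r) => n.
have -> : \sum_(i < n) nrm (expc i * toC r ^+ i) = series (exp_coeff r) n.
  rewrite /series/= big_mkord; apply: eq_bigr => i _.
  by rewrite nrmM nrmV nrm_nat nrmX nrm_toC ger0_norm// /exp_coeff mulrC.
apply: nondecreasing_cvgn_le; last exact: is_cvg_series_exp_coeff.
apply: nondecreasing_series => k _ _; exact: exp_coeff_ge0.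
Qed.

(** The Cauchy product, evaluated at 1, of the series with coefficients z^k/k! and w^k/k!; the
    binomial theorem identifies its terms. *)
Lemma ps_expcD z w : ps expc (z + w) = ps expc z * ps expc w.
Proof.
have s x : psum (fun k => expc k * x ^+ k) (1 : R).
  apply: eq_summ (summ_ps (psum_expc (nrm_ge0 x)) (lexx _)) => k.
  by rewrite toC1 expr1n mulr1.
have E x : ps (fun k => expc k * x ^+ k) 1 = ps expc x.
  by apply: eq_tot => k; rewrite expr1n mulr1.
have [|_] := @psM R _ _ 1 1 (s z) (s w); first by rewrite nrm1.
rewrite !E => <-; apply: eq_tot => k; rewrite expr1n mulr1 /cauchy exprDn mulr_sumr.
rewrite (reindex_inj rev_ord_inj); apply: eq_bigr => i _ /=.
have ik : (i <= k)%N by rewrite -ltnS.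
rewrite subSS /expc -mulr_natr subnA//  subnn add0n -(bin_fact (leq_subr i k)) subKn// bin_sub// !natrM.
have h0 : 'C(k, i)%:R != 0 :> C by rewrite pnatr_eq0 -lt0n bin_gt0.
have := fact_neq0 i; have := fact_neq0 (k - i); move: (_%:R) (_%:R) => a b a0 b0.
rewrite -mulr_natr; field; by rewrite ?a0 ?b0 ?h0.
Qed.

Lemma toC_cvg (u : nat -> R) (l : R) : u @ \oo --> l -> (toC (u n) : C) @[n --> \oo] --> toC l.
Proof.
move=> /cvgrPdist_lt h; apply/cvgC_P => e /h[N _ hN]; exists N => // n Nn.
by rewrite -toCN -toCD nrm_toC; exact: hN.
Qed.

Lemma ps_expc_real (x : R) : ps expc (toC x) = toC (expR x).
Proof.
apply: cvgC_uniq (hs_series (hs_tot _)) _.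
  by apply: summ_ps (psum_expc (normr_ge0 x)) _; rewrite nrm_toC.
have := toC_cvg (@is_cvg_series_exp_coeff R x); rewrite -/(expR x).
suff -> : series (fun k : nat => expc k * toC x ^+ k) = (fun n => toC (series (exp_coeff x) n)) by [].
apply/funext => n; rewrite /series/= toC_sum; apply: eq_bigr => k _.
by rewrite /exp_coeff/= toCM toCX toCV toC_nat mulrC.
Qed.

Lemma ii2 : cplx 0 1 * cplx 0 1 = -1 :> C.
Proof. by apply: CplxP => /=; ring. Qed.

Lemma iiX n : cplx 0 1 ^+ n = toC ((~~ odd n)%:R * (-1) ^+ n./2) + cplx 0 1 * toC ((odd n)%:R * (-1) ^+ n.-1./2) :> C.
Proof.
have h m : cplx 0 1 ^+ m.*2 = toC ((-1) ^+ m) :> C.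
  by rewrite -mul2n exprM expr2 ii2 toCX toCN toC1.
rewrite -{1}(odd_double_half n); case: (boolP (odd n)) => on /=.
  rewrite add1n exprS h mul0r toC0 add0r mul1r.
  by rewrite -[in RHS](odd_double_half n) on add1n/= doubleK.
by rewrite add0n h mul1r mul0r toC0 mulr0 addr0.
Qed.

Lemma ps_expc_imag (y : R) : ps expc (cplx 0 1 * toC y) = cplx (cos y) (sin y).
Proof.
apply: cvgC_uniq (hs_series (hs_tot _)) _.
  by apply: summ_ps (psum_expc (nrm_ge0 _)) (lexx _).
have -> : cplx (cos y) (sin y) = toC (cos y) + cplx 0 1 * toC (sin y) :> C.
  by apply: CplxP; rewrite ?ReCD ?ImCD ?ReCM ?ImCM/=; ring.
have h1 : (toC (series (cos_coeff y) n) : C) @[n --> \oo] --> toC (cos y).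
  by apply: toC_cvg; rewrite unlock; exact: is_cvg_series_cos_coeff.
have h2 : (toC (series (sin_coeff y) n) : C) @[n --> \oo] --> toC (sin y).
  by apply: toC_cvg; rewrite unlock; exact: is_cvg_series_sin_coeff.
suff -> : series (fun k : nat => expc k * (cplx 0 1 * toC y) ^+ k) =
    (fun n => toC (series (cos_coeff y) n) + cplx 0 1 * toC (series (sin_coeff y) n)).
  exact: cvgCD h1 (cvgCZ (c := cplx 0 1) h2).
apply/funext => n; rewrite /series/= !toC_sum mulr_sumr -big_split.
apply: eq_bigr => k _ /=.
rewrite exprMn iiX /cos_coeff /sin_coeff /expc /= !toCM !toCV !toCX !toCN !toC1 !toC_nat.
ring.
Qed.

(** Ties the definition by real and imaginary parts to the power series, from which the functional
    equation and the derivative follow. *)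
Lemma Cexp_ps z : Cexp z = ps expc z.
Proof.
rewrite {2}(CplxE z) ps_expcD ps_expc_real ps_expc_imag.
by case: z => x y; apply: CplxP; rewrite ?ReCM ?ImCM/=; ring.
Qed.

Lemma CexpD z w : Cexp (z + w) = Cexp z * Cexp w.
Proof. by rewrite !Cexp_ps ps_expcD. Qed.

Lemma Cexp0 : Cexp 0 = 1 :> C.
Proof. by apply: CplxP; rewrite /= expR0 ?cos0 ?sin0; ring. Qed.

Lemma CexpN z : Cexp (- z) = (Cexp z)^-1.
Proof.
have h : Cexp z * Cexp (- z) = 1 by rewrite -CexpD subrr Cexp0.
have h0 : Cexp z != 0 by apply: contra_eq_neq h => ->; rewrite mul0r eq_sym oner_neq0.
by apply: (mulfI h0); rewrite h mulfV.
Qed.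

Lemma Cexp_neq0 z : Cexp z != 0.
Proof.
have h : Cexp z * Cexp (- z) = 1 by rewrite -CexpD subrr Cexp0.
by apply: contra_eq_neq h => ->; rewrite mul0r eq_sym oner_neq0.
Qed.

Lemma CexpB z w : Cexp (z - w) = Cexp z / Cexp w.
Proof. by rewrite CexpD CexpN. Qed.

Lemma CexpMn z n : Cexp (n%:R * z) = Cexp z ^+ n.
Proof.
elim: n => [|n IH]; first by rewrite mul0r Cexp0 expr0.
by rewrite -natr1 mulrDl mul1r CexpD IH exprSr.
Qed.

Lemma nrm_Cexp z : nrm (Cexp z) = expR (ReC z).
Proof.
apply/eqP; rewrite -(@eqrXn2 _ 2)// ?nrm_ge0 ?expR_ge0// nrm2E; case: z => x y /=.
apply/eqP; rewrite [LHS](_ : _ = expR x ^+ 2 * (cos y ^+ 2 + sin y ^+ 2)); last by ring.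
by rewrite cos2Dsin2 mulr1.
Qed.

Lemma has_ps_Cexp : has_ps (Cexp : C -> C) expc.
Proof. by exists 1 => //; split => [|z _ _]; [exact: psum_expc|exact: Cexp_ps]. Qed.

Lemma deriv_expc : deriv_coef expc = expc.
Proof.
apply/funext => k; rewrite /deriv_coef /expc factS natrM invfM mulrA mulfV ?mul1r//.
Qed.

Lemma Cexp_derive z : is_derive z (1 : C) (Cexp : C -> C) (Cexp z : C).
Proof.
have r0 : 0 <= nrm z + 1 by rewrite addr_ge0// nrm_ge0.
have := ps_derive (psum_expc r0) (_ : nrm z < nrm z + 1).
rewrite deriv_expc -Cexp_ps ltrDl ltr01 => /(_ isT).
by rewrite (_ : ps expc = Cexp)//; apply/funext => w; rewrite Cexp_ps.
Qed.

Lemma twopii_neq0 : twopii R != 0.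
Proof.
rewrite -nrm_eq0 /twopii; apply/negP => /eqP h.
have := Im_nrm (twopii R); rewrite h normr_le0/= mulf_eq0 pnatr_eq0/= => /eqP pi0.
by have := pi_gt0 R; rewrite pi0 ltxx.
Qed.

Lemma ceD z w : ce (z + w) = ce z * ce w.
Proof. by rewrite /ce mulrDr CexpD. Qed.
Lemma ce0 : ce 0 = 1 :> C.
Proof. by rewrite /ce mulr0 Cexp0. Qed.
Lemma ceN z : ce (- z) = (ce z)^-1.
Proof. by rewrite /ce mulrN CexpN. Qed.
Lemma ceB z w : ce (z - w) = ce z / ce w.
Proof. by rewrite ceD ceN. Qed.
Lemma ce_neq0 z : ce z != 0.
Proof. exact: Cexp_neq0. Qed.
Lemma ceMn z n : ce (n%:R * z) = ce z ^+ n.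
Proof. by rewrite /ce mulrCA CexpMn. Qed.
Lemma nrm_ce z : nrm (ce z) = expR (- (2 * pi * ImC z)).
Proof. by rewrite /ce nrm_Cexp ReCM/= mul0r add0r. Qed.

Lemma ce1 : ce 1 = 1 :> C.
Proof.
rewrite /ce mulr1 /twopii; have h : 2 * pi = pi *+ 2 :> R by rewrite mulr_natl.
by apply: CplxP; rewrite /= h expR0 mul1r ?cos2pi ?sin2pi.
Qed.

Lemma ce_nat n : ce n%:R = 1 :> C.
Proof. by rewrite -[n%:R]mulr1 ceMn ce1 expr1n. Qed.

Lemma ce_int (n : int) : ce n%:~R = 1 :> C.
Proof. by case: n => n; [exact: ce_nat|rewrite NegzE mulrNz ceN ce_nat invr1]. Qed.

Lemma ceMz z (n : int) : ce (n%:~R * z) = ce z ^ n.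
Proof. by case: n => n; [exact: ceMn|rewrite NegzE mulrNz mulNr ceN ceMn]. Qed.

Lemma ce_half : ce (2^-1) = -1 :> C.
Proof.
have h : 2 * pi / 2 = pi :> R by field.
have -> : ce (2^-1) = Cexp (cplx 0 pi) :> C.
  rewrite /ce /twopii; congr Cexp; rewrite -[2]/(2%:R) -toC_nat -toCV.
  by apply: CplxP; rewrite ?ReCM ?ImCM /=; field.
by apply: CplxP; rewrite /= ?cospi ?sinpi expR0; ring.
Qed.

(** The modulus forces Im z = 0. The fractional part t of Re z then satisfies cos(2 pi t) = 1, hence
    sin(pi t) = 0, which is impossible for 0 < t < 1. *)
Lemma ce_eq1 z : ce z = 1 -> exists n : int, z = n%:~R.
Proof.
move=> h; have := nrm_ce z; rewrite h nrm1 => h1.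
have Im0 : ImC z = 0.
  have /eqP : expR (- (2 * pi * ImC z)) = expR 0 by rewrite -h1 expR0.
  rewrite (inj_eq (@expR_inj R)) oppr_eq0 !mulf_eq0 pnatr_eq0/= => /orP[/eqP p0|/eqP//].
  by have := pi_gt0 R; rewrite p0 ltxx.
pose x := ReC z; pose n := Num.floor x; pose t := x - n%:~R.
exists n.
have t0 : 0 <= t by rewrite subr_ge0 floor_le_tmp.
have t1 : t < 1 by rewrite ltrBlDl; have := floorD1_gt x; rewrite intrD.
have ht : ce (toC t) = 1.
  rewrite /t toCD toCN toC_int ceB ce_int divr1 -[RHS]h; congr ce.
  by apply: CplxP.
have ct : cos (2 * pi * t) = 1.
  by have := congr1 ReC ht; rewrite /ce /twopii /= !mul0r !mulr0 subrr expR0 mul1r add0r.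
suff t00 : t = 0.
  by apply: CplxP; rewrite -?toC_int//=; move/eqP: t00; rewrite subr_eq0 => /eqP.
apply/eqP; apply: contraT => tn0.
have tp : 0 < t by rewrite lt_neqAle eq_sym tn0.
have : 0 < sin (pi * t).
  apply: sin_gt0_pi; rewrite mulr_gt0 ?pi_gt0//=.
  by rewrite gtr_pMr// pi_gt0.
move: ct; rewrite (_ : 2 * pi * t = (pi * t) *+ 2); last by rewrite -mulr_natl; ring.
rewrite cos_mulr2n cos2sin2 -mulr_natl => h2 s0.
have : sin (pi * t) ^+ 2 = 0 by lra.
by move/eqP; rewrite sqrf_eq0 => /eqP s00; rewrite s00 ltxx in s0.
Qed.

End ComplexExp.

(** * The theta series and its product *)

Section Theta.
Context {R : realType}.
Local Notation C := (Cplx R).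
Implicit Types x z tau : C.

Lemma bsum_rows (T U : eqType) (F : T * U -> R) (g : T -> R) :
  (forall p, 0 <= F p) -> (forall i s, uniq s -> \sum_(j <- s) F (i, j) <= g i) ->
  bsum g -> bsum F.
Proof.
move=> F0 Fg [B gB]; exists B => s us.
set s1 := undup (unzip1 s); set s2 := undup (unzip2 s).
have u12 : uniq (allpairs pair s1 s2).
  by rewrite allpairs_uniq ?undup_uniq// => -[? ?] [? ?].
apply: le_trans (sum_subseq F0 us u12 _) _.
  move=> [x y] xs; apply/allpairsP; exists (x, y); split => //=.
    by rewrite mem_undup; apply/mapP; exists (x, y).
  by rewrite mem_undup; apply/mapP; exists (x, y).
rewrite big_allpairs_dep/= (le_trans _ (gB s1 (undup_uniq _)))//.
by apply: ler_sum => i _; apply: Fg; exact: undup_uniq.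
Qed.

Lemma sum_expR_le (t : R) (s : seq nat) : 0 <= t -> uniq s ->
  \sum_(k <- s) t ^+ k / k`!%:R <= expR t.
Proof.
move=> t0 us; set N := (\max_(i <- s) i).+1.
apply: (@le_trans _ _ (\sum_(k <- iota 0 N) t ^+ k / k`!%:R)).
  apply: sum_subseq => //; first by move=> i; rewrite divr_ge0// exprn_ge0.
    exact: iota_uniq.
  move=> i si; rewrite mem_iota/= add0n ltnS.
  exact: (leq_bigmax_seq i (P := xpredT) (F := id)).
rewrite -[N in iota 0 N]subn0 -/(index_iota 0 N).
apply: (@nondecreasing_cvgn_le R (series (exp_coeff t))); last exact: is_cvg_series_exp_coeff.
apply: nondecreasing_series => k _ _; exact: exp_coeff_ge0.
Qed.

Definition nuR (n : int) : R := n%:~R + 2^-1.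
Definition nuC (n : int) : C := n%:~R + 2^-1.

Lemma nuCE n : nuC n = toC (nuR n).
Proof. by rewrite /nuC /nuR toCD toC_int toCV toC_nat. Qed.

Lemma bsum_theta (a M : R) : 0 < a ->
  bsum (fun n : int => expR (- a * nuR n ^+ 2 + M * `|nuR n|)).
Proof.
(* Completing the square gives -a t^2 + (M + 1) t <= (M + 1)^2/(4a); the spare unit in the linear
   term is left as geometric decay. *)
move=> a0; pose K := expR ((M + 1) ^+ 2 / (4 * a)).
have h n : expR (- a * nuR n ^+ 2 + M * `|nuR n|) <= K * expR (- `|nuR n|).
  rewrite /K -expRD ler_expR; set t := `|_|.
  have -> : nuR n ^+ 2 = t ^+ 2 by rewrite real_normK// num_real.
  rewrite -subr_ge0 [leRHS](_ : _ = (2 * a * t - (M + 1)) ^+ 2 / (4 * a)).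
    by rewrite divr_ge0 ?sqr_ge0// mulr_ge0// ltW.
  by field; lra.
apply: bsum_le h _; apply: bsumZ; first exact: expR_ge0.
have e1 : 0 <= (expR (-1) : R) < 1 by rewrite expR_ge0 expR_lt1 ltrN10.
have E (n : nat) : expR (- n%:R) = expR (-1) ^+ n :> R.
  by rewrite -mulrN1 expRM_natl.
apply: bsum_int => [i||]; first exact: expR_ge0.
- apply: bsum_le (bsum_geo e1) => n.
  rewrite -E ler_expR lerN2 /nuR.
  apply: le_trans (ler_norm _); by rewrite lerDl invr_ge0.
- apply: bsum_le (bsumZ (expR_ge0 1) (bsum_geo e1)) => n.
  rewrite -E -expRD ler_expR /nuR mulrNz -lerN2 opprK opprD opprK.
  apply: le_trans (_ : n%:R - 2^-1 <= _).
    rewrite addrC lerD2l; lra.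
  by rewrite -normrN opprD opprK ler_norm.
Qed.

Definition thc tau (n : int) : C := (-1) ^ n * ce (2^-1 * nuC n ^+ 2 * tau).
(** The argument is rescaled so that the quasi-periods form the lattice Z + Z tau. *)
Definition Th tau z : C := theta (twopii R * z) tau.
Definition thterm tau z (n : int) : C := thc tau n * ce (nuC n * z).

Lemma nrmN1X (n : int) : nrm ((-1 : C) ^ n) = 1.
Proof.
by case: n => n; rewrite ?NegzE -?exprnN ?nrmV -?exprnP ?nrmX nrmN nrm1 expr1n ?invr1.
Qed.

Lemma nrm_thterm tau z n :
  nrm (thterm tau z n) = expR (- (pi * ImC tau) * nuR n ^+ 2 - 2 * pi * ImC z * nuR n).
Proof.
rewrite /thterm /thc !nrmM nrmN1X mul1r !nrm_ce -expRD; congr expR.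
have -> : 2^-1 = toC 2^-1 :> C by rewrite toCV toC_nat.
by rewrite nuCE -toCX -toCM !ImCM/=; field.
Qed.

Lemma thterm_bound tau z (M : R) n : 2 * pi * `|ImC z| <= M ->
  nrm (thterm tau z n) <= expR (- (pi * ImC tau) * nuR n ^+ 2 + M * `|nuR n|).
Proof.
move=> zM; rewrite nrm_thterm ler_expR lerD2l.
apply: le_trans (ler_norm _) _; rewrite normrN normrM; apply: ler_wpM2r => //.
by rewrite !normrM (ger0_norm (pi_ge0 R)) (ger0_norm (ler0n _ 2)).
Qed.

Lemma N1z_neq0 (n : int) : (-1 : C) ^ n != 0.
Proof. by rewrite expfz_neq0// oppr_eq0 oner_neq0. Qed.

Lemma N1zM (n : int) : (-1 : C) ^ n * (-1) ^ n = 1.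
Proof. by rewrite -expfzMl mulrNN mulr1 exp1rz. Qed.

Lemma N1zN (n : int) : (-1 : C) ^ (- n) = (-1) ^ n.
Proof.
by apply: (mulIf (N1z_neq0 n)); rewrite N1zM -expfzDr ?oppr_eq0 ?oner_neq0// addNr expr0z.
Qed.

Section FixTau.
Variable tau : C.
Hypothesis tau_uhp : uhp tau.

Let pitau : 0 < pi * ImC tau.
Proof. by rewrite mulr_gt0 ?pi_gt0//; exact: tau_uhp. Qed.

Lemma summ_thterm z : summ (thterm tau z).
Proof. by apply: summ_le (bsum_theta (2 * pi * `|ImC z|) pitau) => n; exact: thterm_bound. Qed.

Lemma Th_tot z : Th tau z = tot (thterm tau z).
Proof.
rewrite /Th /theta zsum_tot.
  by apply: eq_tot => n; rewrite /thterm /thc /ce /nuC; congr (_ * Cexp _); rewrite mulrCA.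
apply: eq_summ (summ_thterm z) => n; rewrite /thterm /thc /ce /nuC.
by congr (_ * Cexp _); rewrite mulrCA.
Qed.

(** Shifting the summation index by m absorbs m tau by completing the square; the translation by n
    contributes e(n/2) = (-1)^n because the frequencies are half-integers. *)
Lemma Th_period z (m n : int) :
  Th tau (z + m%:~R * tau + n%:~R) =
  (-1) ^ m * (-1) ^ n * ce (- (m%:~R ^+ 2 * tau / 2) - m%:~R * z) * Th tau z.
Proof.
rewrite !Th_tot -totZ; last exact: summ_thterm.
rewrite -(@tot_reindex _ int int (fun k => _ * thterm tau z k) (fun k => k + m) (fun k => k - m)).
- apply: eq_tot => k /=; rewrite /thterm /thc.
  have -> : nuC (k + m) = nuC k + m%:~R by rewrite /nuC intrD; ring.
  have -> : (-1 : C) ^ k = (-1) ^ (k + m) * (-1) ^ m.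
    have h : (-1 : C) != 0 by rewrite oppr_eq0 oner_neq0.
    rewrite expfzDr// -mulrA; have -> : (-1 : C) ^ m * (-1) ^ m = 1; last by rewrite mulr1.
    by rewrite -expfzMl mulrNN mulr1 exp1rz.
  have -> : ce (nuC k * (z + m%:~R * tau + n%:~R)) = ce (nuC k * (z + m%:~R * tau)) * (-1) ^ n.
    rewrite mulrDr ceD; congr (_ * _); rewrite /nuC mulrDl ceD -intrM ce_int mul1r.
    by rewrite mulrC ceMz ce_half.
  have h : ce (2^-1 * nuC k ^+ 2 * tau) * ce (nuC k * (z + m%:~R * tau)) =
      ce (- (m%:~R ^+ 2 * tau / 2) - m%:~R * z) * (ce (2^-1 * (nuC k + m%:~R) ^+ 2 * tau) *
      ce ((nuC k + m%:~R) * z)).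
    by rewrite -!ceD; congr ce; field.
  move: h; set a := ce _; set b := ce _; set c := ce _; set d := ce _; set e := ce _ => h.
  transitivity ((-1) ^ (k + m) * (-1) ^ m * (-1) ^ n * (a * b)); first by ring.
  by rewrite h; ring.
- by move=> k; rewrite addrK.
- by move=> k; rewrite subrK.
- by apply: summZ; exact: summ_thterm.
Qed.

(* The Taylor coefficients of [Th tau] at x. *)
Definition tc x (k : nat) : C := tot (fun n => thterm tau x n * ((twopii R * nuC n) ^+ k / k`!%:R)).

Lemma summ_Taylor x z :
  summ (fun p : int * nat => thterm tau x p.1 * ((twopii R * nuC p.1) ^+ p.2 / p.2`!%:R) * z ^+ p.2).
Proof.
pose M := 2 * pi * `|ImC x| + nrm (twopii R) * nrm z.
apply: (@bsum_rows _ _ _ (fun n : int => expR (- (pi * ImC tau) * nuR n ^+ 2 + M * `|nuR n|))).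
- by move=> p; exact: nrm_ge0.
- move=> n s us /=.
  have t0 : 0 <= nrm (twopii R) * `|nuR n| * nrm z by rewrite !mulr_ge0 ?nrm_ge0.
  apply: (@le_trans _ _ (nrm (thterm tau x n) * \sum_(k <- s) (nrm (twopii R) * `|nuR n| * nrm z) ^+ k / k`!%:R)).
    rewrite mulr_sumr; apply: ler_sum => k _.
    rewrite !nrmM !nrmX !nrmM nrmV nrm_nat nuCE nrm_toC !exprMn le_eqVlt.
    by apply/orP; left; apply/eqP; ring.
  apply: (@le_trans _ _ (expR (- (pi * ImC tau) * nuR n ^+ 2 + 2 * pi * `|ImC x| * `|nuR n|) * expR (nrm (twopii R) * `|nuR n| * nrm z))).
    by apply: ler_pM; rewrite ?nrm_ge0 ?thterm_bound ?sum_expR_le// sumr_ge0// => k _; rewrite divr_ge0 ?exprn_ge0.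
  rewrite -expRD ler_expR /M le_eqVlt; apply/orP; left; apply/eqP; ring.
- exact: bsum_theta.
Qed.

Lemma summ_tc_row x k : summ (fun n => thterm tau x n * ((twopii R * nuC n) ^+ k / k`!%:R)).
Proof.
have h : injective (fun n : int => (n, k)) by move=> ? ? [].
apply: eq_summ (summ_inj h (summ_Taylor x 1)) => n /=.
by rewrite expr1n mulr1.
Qed.

(** Each exponential of the theta series is expanded at x and the two summations are exchanged. The
    Gaussian decay beats the exponential growth for every z, so all radii are allowed. *)
Lemma Th_Taylor x : (forall r, psum (tc x) r) /\ (forall z, Th tau (x + z) = ps (tc x) z).
Proof.
have h z : summ (fun k => tc x k * z ^+ k) /\ hs (fun k => tc x k * z ^+ k) (Th tau (x + z)).
  have [h1 h2] := fubini_swap (summ_Taylor x z).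
  have E k : tot (fun n => thterm tau x n * ((twopii R * nuC n) ^+ k / k`!%:R) * z ^+ k) = tc x k * z ^+ k.
    by rewrite mulrC -totZ; [apply: eq_tot => n; rewrite mulrC|exact: summ_tc_row].
  split; first by apply: eq_summ h1.
  have : hs (fun k => tc x k * z ^+ k) _ := eq_hs E h2; congr hs.
  rewrite -(tot_fubini (summ_Taylor x z)) Th_tot; apply: eq_tot => n /=.
  rewrite (eq_tot (g := fun k => thterm tau x n * (expc k * (twopii R * nuC n * z) ^+ k))); last first.
    by move=> k; rewrite /expc !exprMn; ring.
  rewrite totZ; last exact: summ_ps (psum_expc (nrm_ge0 (twopii R * nuC n * z))) (lexx _).
  by rewrite -[tot _]/(ps _ _) -Cexp_ps /thterm -mulrA -mulrA -[Cexp _]/(ce _) -ceD mulrDr.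
split=> [r|z]; first by have [] := h (toC r).
by have [_ /hsE] := h z.
Qed.

Lemma tc0E x : tc x 0 = Th tau x.
Proof.
by rewrite Th_tot; apply: eq_tot => n; rewrite expr0 fact0 divr1 mulr1.
Qed.

Lemma ps_at0 (c : nat -> C) : (exists2 r : R, 0 < r & psum c r) -> ps c 0 = c 0%N.
Proof.
move=> [r r0 sc]; have [|_ ->] := @ps_recl R c r 0 sc r0; first by rewrite nrm0 ltW.
by rewrite mul0r addr0.
Qed.

(** Both sides are the derivative of [Th tau] at z, read off from the Taylor series at 0 and from
    the one at z. *)
Lemma deriv_tc z : ps (deriv_coef (tc 0)) z = tc z 1.
Proof.
have [s0 h0] := Th_Taylor 0; have [sz hz] := Th_Taylor z.
have d1 : is_derive z (1 : C) (Th tau : C -> C) (ps (deriv_coef (tc 0)) z : C).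
  have := ps_derive (s0 (nrm z + 1)) (_ : nrm z < nrm z + 1).
  rewrite ltrDl ltr01 => /(_ isT).
  by rewrite (_ : ps (tc 0) = Th tau)//; apply/funext => w; rewrite -h0 add0r.
have d2 : is_derive (0 : C) (1 : C) (fun h => Th tau (z + h) : C) (tc z 1 : C).
  have := ps_derive (sz 1) (_ : nrm 0 < 1).
  rewrite nrm0 ltr01 => /(_ isT).
  rewrite ps_at0; last by exists 1 => //; apply: psum_deriv (sz 2) _; rewrite ler01 ltr1n.
  rewrite /deriv_coef mul1r (_ : ps (tc z) = fun h => Th tau (z + h))//.
  by apply/funext => w; rewrite hz.
have [_ <-] := d1; have [_ <-] := d2.
rewrite /derive; congr (lim _); apply: (congr1 (fun u : C -> C => u @ (0 : C)^')); apply/funext => h /=.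
by rewrite !addr0 [z + _]addrC.
Qed.

Lemma derive1_theta0 : twopii R * derive1 (fun u : C => theta u tau : C) (0 : C) = tc 0 1.
Proof.
have [s0 h0] := Th_Taylor 0.
have I0 : (twopii R)^-1 != 0 by rewrite invr_neq0// twopii_neq0.
pose c k := tc 0 k * (twopii R)^-1 ^+ k.
have E z : theta z tau = ps c z.
  transitivity (ps (tc 0) ((twopii R)^-1 * z)).
    by rewrite -h0 add0r /Th mulVKf// twopii_neq0.
  by apply: eq_tot => k; rewrite /c exprMn mulrA.
have sc r : 0 <= r -> psum c r.
  move=> r0; apply: (@eq_summ _ _ (fun k : nat => tc 0 k * ((twopii R)^-1 * toC r) ^+ k)).
    by move=> k; rewrite /c exprMn mulrA.
  exact: summ_ps (s0 (nrm ((twopii R)^-1 * toC r))) (lexx _).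
have := ps_derive (sc 1 ler01) (_ : nrm 0 < 1).
rewrite nrm0 ltr01 => /(_ isT) d.
have -> : (fun u => theta u tau) = ps c by apply/funext => u; rewrite E.
rewrite derive1E; have [_ ->] := d.
rewrite ps_at0; last by exists 1 => //; apply: psum_deriv (sc 2 _) _; rewrite ?ler01 ?ltr1n.
by rewrite /deriv_coef mul1r /c expr1 mulrCA mulfV ?mulr1// twopii_neq0.
Qed.

End FixTau.
End Theta.

(** * The q-binomial theorem and its logarithmic derivative *)

Section QBinomial.
Variable A : comNzRingType.
Implicit Types q y : A.

(** Gaussian binomial coefficients, by a Pascal rule that requires no division in A; [qbin_fact] is
    the quotient formula. *)
Fixpoint qbin q (M k : nat) : A :=
  match M, k with
  | _, 0 => 1
  | 0, _.+1 => 0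
  | M'.+1, k'.+1 => qbin q M' k' + q ^+ k'.+1 * qbin q M' k'.+1
  end.

Lemma qbin_small q M k : (M < k)%N -> qbin q M k = 0.
Proof.
elim: M k => [|M IH] [|k]//= Mk.
by rewrite !IH ?mulr0 ?addr0// ltnW.
Qed.

Lemma qbin0 q M : qbin q M 0 = 1. Proof. by case: M. Qed.

Lemma qbinomial q y M :
  \prod_(k < M) (1 + y * q ^+ k) = \sum_(k < M.+1) q ^+ 'C(k, 2) * qbin q M k * y ^+ k.
Proof.
elim: M y => [|M IH] y; first by rewrite big_ord0 big_ord_recl big_ord0/= !mulr1 addr0.
rewrite big_ord_recl expr0 mulr1.
(* Without the factor k = 0 the product is the one for y q, where the induction hypothesis is
   used. *)
rewrite (eq_bigr (fun i : 'I_M => 1 + (y * q) * q ^+ i)); last first.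
  by move=> i _; rewrite exprS mulrA.
rewrite IH mulrDl mul1r {1}big_ord_recl [RHS]big_ord_recl !qbin0 !expr0 !mulr1 -addrA; congr (_ + _).
rewrite [in RHS](eq_bigr (fun i : 'I_M.+1 => q ^+ 'C(i.+1, 2) * (q ^+ i.+1 * qbin q M i.+1) * y ^+ i.+1
   + q ^+ 'C(i.+1, 2) * qbin q M i * y ^+ i.+1)); last first.
  by move=> i _; rewrite lift0 /=; ring.
rewrite big_split/= [in RHS]big_ord_recr/= (qbin_small _ (ltnSn M)) !(mulr0, mul0r) addr0; congr (_ + _).
  by apply: eq_bigr => i _; rewrite /bump leq0n add1n exprMn; ring.
rewrite mulr_sumr; apply: eq_bigr => i _.
rewrite binS bin1 exprD exprMn exprS; ring.
Qed.

Definition qfact q n : A := \prod_(i < n) (1 - q ^+ i.+1).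

Lemma qfactS q n : qfact q n.+1 = qfact q n * (1 - q ^+ n.+1).
Proof. by rewrite /qfact big_ord_recr. Qed.

Lemma qbin_fact q M k : (k <= M)%N -> qbin q M k * (qfact q k * qfact q (M - k)) = qfact q M.
Proof.
have f0 : qfact q 0 = 1 by rewrite /qfact big_ord0.
elim: M k => [|M IH] [|k]//= kM; rewrite ?f0 ?mulr1 ?mul1r ?subn0//.
rewrite subSS; have h1 := IH k kM; move: kM; rewrite ltnS leq_eqVlt => /orP[/eqP kM|kM].
  subst k; rewrite subnn f0 mulr1 in h1 *.
  by rewrite (qbin_small q (ltnSn M)) mulr0 addr0 mulr1 !qfactS mulrA h1.
have h2 := IH k.+1 kM.
have -> : (M - k = (M - k.+1).+1)%N by rewrite subnSK.
have e : (M - k = (M - k.+1).+1)%N by rewrite subnSK.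
rewrite e in h1.
transitivity (qbin q M k * (qfact q k * qfact q (M - k.+1).+1) * (1 - q ^+ k.+1) +
   q ^+ k.+1 * (1 - q ^+ (M - k.+1).+1) * (qbin q M k.+1 * (qfact q k.+1 * qfact q (M - k.+1)))).
  by rewrite !qfactS; ring.
rewrite h1 h2 qfactS -e (_ : M.+1 = k.+1 + (M - k))%N; last by rewrite addSn subnKC// ltnW.
by rewrite exprD; ring.
Qed.

End QBinomial.

Section PolyDeriv.
Variable F : fieldType.

Lemma qbin_polyC (q : F) M k : qbin q%:P M k = (qbin q M k)%:P.
Proof. by elim: M k => [|M IH] [|k]//=; rewrite !IH polyCD polyCM -polyC_exp. Qed.

Lemma prod_logderiv (a : nat -> F) (y : F) M : (forall k, 1 + y * a k != 0) ->
  (\prod_(k < M) (1 + 'X * (a k)%:P))^`().[y] = (\prod_(k < M) (1 + y * a k)) * \sum_(k < M) a k / (1 + y * a k).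
Proof.
move=> h; have E n : (\prod_(k < n) (1 + 'X * (a k)%:P)).[y] = \prod_(k < n) (1 + y * a k).
  by rewrite horner_prod; apply: eq_bigr => i _; rewrite !hornerE.
elim: M => [|M IH]; first by rewrite !big_ord0 derivC hornerC mulr0.
rewrite !big_ord_recr/= derivM hornerD !hornerM IH E derivD derivC derivM derivX derivC mulr0 addr0 mul1r add0r !hornerE/=.
by have := h M; set b := _ + _ => b0; field.
Qed.

(** The operator y d/dy applied to both sides of [qbinomial], with y replaced by a polynomial
    variable and the result evaluated at y. *)
Lemma qbinomial_deriv (q y : F) M : (forall k, 1 + y * q ^+ k != 0) ->
  \sum_(k < M.+1) k%:R * (q ^+ 'C(k, 2) * qbin q M k * y ^+ k) =
  (\prod_(k < M) (1 + y * q ^+ k)) * \sum_(k < M) y * q ^+ k / (1 + y * q ^+ k).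
Proof.
move=> h; have := prod_logderiv M h.
rewrite (eq_bigr (fun k : 'I_M => 1 + 'X * q%:P ^+ k)); last by move=> k _; rewrite polyC_exp.
rewrite qbinomial => E.
rewrite [X in _ * X](eq_bigr (fun k : 'I_M => y * (q ^+ k / (1 + y * q ^+ k)))); last by move=> k _; rewrite mulrA.
rewrite -mulr_sumr mulrCA -E.
rewrite linear_sum horner_sum mulr_sumr; apply: eq_bigr => k _.
rewrite qbin_polyC -polyC_exp -polyCM mul_polyC /= derivZ derivXn hornerZ hornerMn hornerXn.
 case: (nat_of_ord k) => [|j]; first by rewrite !(mul0r, mulr0n, mulr0).
by rewrite /= exprS -mulr_natl; ring.
Qed.

End PolyDeriv.

(** * Infinite products and the triple product *)

Section InfiniteProduct.
Context {R : realType}.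
Local Notation C := (Cplx R).

Lemma bsum_small (g : nat -> R) e : (forall i, 0 <= g i) -> bsum g -> 0 < e ->
  exists N, forall n, (N <= n)%N -> g n < e.
Proof.
move=> g0 bg e0; have [s us h] := bsum_tail g0 bg e0.
exists (\max_(i <- s) i).+1 => n Nn.
have := h [:: n] isT; rewrite big_seq1; apply => i; rewrite inE => /eqP ->.
apply/negP => /(leq_bigmax_seq n (P := xpredT) (F := id))/(_ isT)/(leq_trans Nn).
by rewrite ltnn.
Qed.

(** The partial products p_n are bounded by exp B, and p_(n+1) - p_n = -p_n a_n, so they telescope
    into an absolutely convergent series. *)
Lemma prod_cvg (a : nat -> C) : summ a ->
  exists l : C, \prod_(i < n) (1 - a i) @[n --> \oo] --> l.
Proof.
move=> [B aB]; pose p n := \prod_(i < n) (1 - a i).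
have pB n : nrm (p n) <= expR B.
  apply: (@le_trans _ _ (\prod_(i < n) expR (nrm (a i)))).
    rewrite /p; elim: n => [|n IH]; first by rewrite !big_ord0 nrm1.
    rewrite !big_ord_recr/= nrmM; apply: ler_pM; rewrite ?nrm_ge0//.
    rewrite (le_trans (nrmB _ _))// nrm1; exact: expR_ge1Dx.
  rewrite -expR_sum ler_expR.
  have := aB (iota 0 n) (iota_uniq _ _).
  by rewrite -[n in iota 0 n]subn0 -/(index_iota 0 n) big_mkord.
have st : summ (fun n => - (p n * a n)).
  apply: (summ_le (g := fun n => expR B * nrm (a n))).
    by move=> n; rewrite nrmN nrmM; apply: ler_wpM2r; rewrite ?nrm_ge0.
  by apply: bsumZ; [exact: expR_ge0|exists B].
exists (1 + tot (fun n => - (p n * a n))).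
have h := cvgCD (cvg_cst (1 : C)) (hs_series (hs_tot st)).
suff -> : (fun n => \prod_(i < n) (1 - a i)) = (fun n => 1 + series (fun n => - (p n * a n)) n) by exact: h.
apply/funext => n; elim: n => [|n IH]; first by rewrite big_ord0 /series/= big_nil addr0.
by rewrite big_ord_recr/= IH /series/= big_nat_recr//= -[p n]/(\prod_(i < n) (1 - a i)) IH /series/=; ring.
Qed.

Lemma summ_frac (a : nat -> C) : summ a -> (forall i, 1 - a i != 0) ->
  summ (fun i => a i / (1 - a i)).
Proof.
move=> sa a1; have e0 : 0 < 2^-1 :> R by rewrite invr_gt0.
have [N hN] := bsum_small (fun i => nrm_ge0 (a i)) sa e0.
(* The constant 2 serves the tail, where |1 - a_i| >= 1/2; the finite sum serves the remaining
   indices. *)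
pose K := 2 + \sum_(i < N) (nrm (1 - a i))^-1.
apply: (summ_le (g := fun i => K * nrm (a i))) => [i|]; last first.
  by apply: bsumZ => //; rewrite addr_ge0// sumr_ge0// => i _; rewrite invr_ge0 nrm_ge0.
rewrite nrmM nrmV mulrC; apply: ler_wpM2r; first exact: nrm_ge0.
have [iN|Ni] := ltnP i N.
  rewrite /K (bigD1 (Ordinal iN))//= addrCA lerDl addr_ge0// sumr_ge0// => j _.
  by rewrite invr_ge0 nrm_ge0.
apply: (@le_trans _ _ 2); last first.
  by rewrite lerDl sumr_ge0// => j _; rewrite invr_ge0 nrm_ge0.
have h1 : 2^-1 <= nrm (1 - a i).
  have := nrm_lb 1 (a i); rewrite nrm1; have := hN i Ni; lra.
by rewrite -[leRHS]invrK lef_pV2// posrE (lt_le_trans e0).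
Qed.

(** The reciprocal factors 1 + a_i/(1 - a_i) also have a convergent product, and the two limits
    multiply to 1. *)
Lemma prod_cvg_neq0 (a : nat -> C) : summ a -> (forall i, 1 - a i != 0) ->
  exists2 l : C, l != 0 & \prod_(i < n) (1 - a i) @[n --> \oo] --> l.
Proof.
move=> sa a1; have [l hl] := prod_cvg sa.
pose b i := - (a i / (1 - a i)).
have sb : summ b.
  apply: summ_le (summ_frac sa a1) => i; by rewrite nrmN.
have [l' hl'] := prod_cvg sb.
have ll' : l * l' = 1.
  have h : (\prod_(i < n) (1 - a i) * \prod_(i < n) (1 - b i)) @[n --> \oo] --> l * l' by exact: (@cvgCM R nat \oo _ (fun n => \prod_(i < n) (1 - a i)) (fun n => \prod_(i < n) (1 - b i)) l l' hl hl').
  apply: cvgC_uniq h _.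
  suff -> : (fun n => \prod_(i < n) (1 - a i) * \prod_(i < n) (1 - b i)) = (fun=> 1) by exact: cvg_cst.
  apply/funext => n; rewrite -big_split big1// => i _ /=.
  by rewrite /b; field.
by exists l => //; apply: contra_eq_neq ll' => ->; rewrite mul0r eq_sym oner_neq0.
Qed.

End InfiniteProduct.

Section TripleProduct.
Context {R : realType}.
Local Notation C := (Cplx R).
Variable tau : C.
Hypothesis tau_uhp : uhp tau.
Local Notation q := (ce tau).

Lemma nrm_q : 0 <= nrm q < 1.
Proof.
rewrite nrm_ge0 nrm_ce expR_lt1 oppr_lt0 !mulr_gt0 ?pi_gt0//; exact: tau_uhp.
Qed.

Lemma ce_tauX n : q ^+ n = ce (n%:R * tau).
Proof. by rewrite ceMn. Qed.

Lemma bin2C k : 'C(k, 2)%:R = k%:R * (k%:R - 1) / 2 :> C.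
Proof.
elim: k => [|k IH]; first by rewrite !mul0r.
by rewrite binS bin1 natrD IH -natr1; field.
Qed.

(** With w = e(z), the triple product has the factors 1 - w q^(i+1) and 1 - w^-1 q^i; the zero at z
    = 0 comes from [fm] with i = 0. *)
Definition fp (z : C) i := ce (z + i.+1%:R * tau).
Definition fm (z : C) i := ce (i%:R * tau - z).

Lemma fpE z i : fp z i = ce z * q ^+ i.+1. Proof. by rewrite /fp ceD ce_tauX. Qed.
Lemma fmE z i : fm z i = ce (- z) * q ^+ i. Proof. by rewrite /fm ceD ce_tauX mulrC. Qed.

Lemma summ_fp z : summ (fp z).
Proof.
apply: (summ_le (g := fun i => nrm (ce z) * nrm q ^+ i)).
  move=> i; rewrite fpE nrmM nrmX; apply: ler_wpM2l; first exact: nrm_ge0.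
  have /andP[q0 q1] := nrm_q.
  by rewrite exprS ler_piMl ?exprn_ge0// ltW.
by apply: bsumZ; [exact: nrm_ge0|exact: bsum_geo nrm_q].
Qed.

Lemma summ_fm z : summ (fm z).
Proof.
apply: (summ_le (g := fun i => nrm (ce (- z)) * nrm q ^+ i)).
  by move=> i; rewrite fmE nrmM nrmX.
by apply: bsumZ; [exact: nrm_ge0|exact: bsum_geo nrm_q].
Qed.

(* The finite triple product [AN N] equals the finite theta sum [BN N], up to a
   factor, by the q-binomial theorem for 2N factors. *)
Definition AN N z := (\prod_(i < N) (1 - fp z i)) * (\prod_(i < N) (1 - fm z i)).
(** The logarithmic derivative of [AN N] in z, divided by 2 pi i. *)
Definition SN N z := \sum_(i < N) (- (fp z i / (1 - fp z i)) + fm z i / (1 - fm z i)).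
Definition shiftN N (k : nat) : int := k%:Z - N%:Z.
Definition BN N z := \sum_(k < (N + N).+1) thterm tau z (shiftN N k) * qbin q (N + N) k.
(** The product of the N factors that [lo_factor] extracts from the lower half of the product, cf.
    [KN_prod]. *)
Definition KN N z : C := (-1) ^+ N * ce (N%:R * z - N%:R * (N%:R - 1) / 2 * tau).
(** For this y the exponents of q in the 2N factors 1 + y q^k run from 1 - N to N, so the finite
    product is centred. *)
Definition yN N (z : C) : C := - ce (z + (1 - N%:R) * tau).

Lemma qbin_term N z k :
  q ^+ 'C(k, 2) * qbin q (N + N) k * yN N z ^+ k =
  KN N z * ce (- (tau / 8 + z / 2)) * (thterm tau z (shiftN N k) * qbin q (N + N) k).
Proof.
rewrite /thterm /thc /shiftN.
have -> : (-1 : C) ^ (k%:Z - N%:Z) = (-1) ^+ k * (-1) ^+ N.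
  by rewrite expfzDr ?oppr_eq0 ?oner_neq0// N1zN.
have -> : nuC (k%:Z - N%:Z) = k%:R - N%:R + 2^-1 :> C.
  by rewrite /nuC intrB.
rewrite /yN [(- ce _) ^+ k]exprNn -!ceMn bin2C /KN.
have h : ce (k%:R * (k%:R - 1) / 2 * tau) * ce (k%:R * (z + (1 - N%:R) * tau)) =
    ce (N%:R * z - N%:R * (N%:R - 1) / 2 * tau) * ce (- (tau / 8 + z / 2)) *
    ce (2^-1 * (k%:R - N%:R + 2^-1) ^+ 2 * tau) * ce ((k%:R - N%:R + 2^-1) * z).
  by rewrite -!ceD; congr ce; field.
have n2 : (-1 : C) ^+ N * (-1) ^+ N = 1 by rewrite -exprMn mulrNN mulr1 expr1n.
move: h; move: (ce (k%:R * _)) (ce (k%:R * _ / _ * _)) (ce (N%:R * z - _)) (ce (- _)) (ce (2^-1 * _ * _)) (ce ((_ + _) * z)) => e1 e2 e3 e4 e5 e6 h.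
transitivity (((-1) ^+ N * (-1) ^+ N) * (e2 * e1) * (-1) ^+ k * qbin q (N + N) k).
  by rewrite n2; ring.
by rewrite h; ring.
Qed.

Lemma yN_lo N z (i : 'I_N) : yN N z * q ^+ (N - i.+1) = - ce (z - i%:R * tau).
Proof.
rewrite /yN ce_tauX mulNr -ceD natrB//; congr (- ce _).
by rewrite -natr1; ring.
Qed.

Lemma yN_hi N z i : yN N z * q ^+ (N + i) = - fp z i.
Proof.
rewrite /yN ce_tauX mulNr -ceD natrD; congr (- ce _).
by rewrite -natr1; ring.
Qed.

Lemma lo_factor z i : 1 - ce (z - i%:R * tau) = - ce (z - i%:R * tau) * (1 - fm z i).
Proof.
have h : ce (z - i%:R * tau) * fm z i = 1.
  by rewrite /fm -ceD (_ : z - _ + _ = 0) ?ce0//; ring.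
by rewrite mulrBr mulNr mulNr h; ring.
Qed.

Lemma KN_prod N z : \prod_(i < N) (- ce (z - i%:R * tau)) = KN N z.
Proof.
elim: N => [|N IH]; first by rewrite big_ord0 /KN expr0 mul1r !mul0r subrr ce0.
rewrite big_ord_recr/= IH /KN exprS mulrN.
rewrite [LHS](_ : _ = -1 * (-1) ^+ N * (ce (N%:R * z - N%:R * (N%:R - 1) / 2 * tau) * ce (z - N%:R * tau))); last by ring.
by rewrite -ceD; congr (_ * ce _); rewrite -natr1; field.
Qed.

Lemma prod_lohi (T : Type) (idx : T) (op : Monoid.com_law idx) N (f : nat -> T) :
  \big[op/idx]_(k < N + N) f k = op (\big[op/idx]_(i < N) f (N - i.+1)%N) (\big[op/idx]_(i < N) f (N + i)%N).
Proof.
rewrite big_split_ord/=; congr (op _ _).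
by rewrite (reindex_inj rev_ord_inj).
Qed.

Lemma yN_prod N z : \prod_(k < N + N) (1 + yN N z * q ^+ k) = KN N z * AN N z.
Proof.
rewrite (prod_lohi _ N (fun k => 1 + yN N z * q ^+ k)) /AN /=.
rewrite [X in X * _ = _](eq_bigr (fun i : 'I_N => - ce (z - i%:R * tau) * (1 - fm z i))); last first.
  by move=> i _; rewrite yN_lo lo_factor.
rewrite [X in _ * X = _](eq_bigr (fun i : 'I_N => 1 - fp z i)); last first.
  by move=> i _; rewrite yN_hi.
by rewrite big_split/= KN_prod; ring.
Qed.

Lemma KN_neq0 N z : KN N z != 0.
Proof. by rewrite mulf_neq0 ?ce_neq0// expf_neq0// oppr_eq0 oner_neq0. Qed.

Lemma triple_finite N z : BN N z = ce (tau / 8 + z / 2) * AN N z.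
Proof.
have := qbinomial q (yN N z) (N + N); rewrite yN_prod.
rewrite (eq_bigr _ (fun (k : 'I_(N + N).+1) _ => qbin_term N z k)) -mulr_sumr -/(BN N z) -mulrA => /(mulfI (KN_neq0 N z)) ->.
by rewrite mulrA -ceD subrr ce0 mul1r.
Qed.

(** The derivative is taken at the finite level, where it is algebraic; only values then have to
    pass to the limit. *)
Lemma triple_finite_D N z : (forall i, 1 - fp z i != 0) -> (forall i, 1 - fm z i != 0) ->
  \sum_(k < (N + N).+1) thterm tau z (shiftN N k) * qbin q (N + N) k * nuC (shiftN N k) =
  BN N z * (2^-1 + SN N z).
Proof.
move=> hp hm.
have y0 k : 1 + yN N z * q ^+ k != 0.
  have [kN|Nk] := ltnP k N.
    have -> : k = (N - (N - k.+1).+1)%N by lia.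
    have h : (N - k.+1 < N)%N by lia.
    rewrite (yN_lo z (Ordinal h)) lo_factor.
    by rewrite mulf_neq0// oppr_eq0 ce_neq0.
  by rewrite -(subnKC Nk) yN_hi.
have := qbinomial_deriv (N + N) y0; rewrite yN_prod.
rewrite (prod_lohi _ N (fun k => yN N z * q ^+ k / (1 + yN N z * q ^+ k))) /=.
rewrite [X in _ * (X + _)](eq_bigr (fun i : 'I_N => 1 + fm z i / (1 - fm z i))); last first.
  move=> i _; rewrite yN_lo lo_factor; have := hm i; have := ce_neq0 (z - i%:R * tau).
  by move: (ce _) (fm z i) => a b a0 b0; field; rewrite a0 b0.
rewrite [X in _ * (_ + X)](eq_bigr (fun i : 'I_N => - (fp z i / (1 - fp z i)))); last first.
  by move=> i _; rewrite yN_hi mulNr.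
rewrite big_split/= sumr_const card_ord -addrA -big_split/=.
rewrite (eq_bigr (fun i : 'I_N => - (fp z i / (1 - fp z i)) + fm z i / (1 - fm z i))); last first.
  by move=> i _; rewrite addrC.
rewrite -/(SN N z) (eq_bigr (fun k : 'I_(N + N).+1 => KN N z * ce (- (tau / 8 + z / 2)) * (k%:R * (thterm tau z (shiftN N k) * qbin q (N + N) k)))); last first.
  by move=> k _; rewrite qbin_term mulrCA.
move=> h0; have h : ce (- (tau / 8 + z / 2)) * (\sum_(k < (N + N).+1) k%:R * (thterm tau z (shiftN N k) * qbin q (N + N) k)) = AN N z * (N%:R + SN N z).
  by apply: (mulfI (KN_neq0 N z)); rewrite [LHS]mulrA [LHS]mulr_sumr h0 -mulrA.
have {}h : \sum_(k < (N + N).+1) k%:R * (thterm tau z (shiftN N k) * qbin q (N + N) k) = BN N z * (N%:R + SN N z).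
  rewrite triple_finite -mulrA -h mulrA -ceD subrr ce0 mul1r//.
(* Since k = [nuC (shiftN N k)] + N - 1/2, a multiple of [BN N z] converts the weight k into
   [nuC]. *)
rewrite (eq_bigr (fun k : 'I_(N + N).+1 => k%:R * (thterm tau z (shiftN N k) * qbin q (N + N) k) + (2^-1 - N%:R) * (thterm tau z (shiftN N k) * qbin q (N + N) k))).
  by rewrite big_split/= h -mulr_sumr -/(BN N z); ring.
move=> k _; rewrite /shiftN /nuC intrB; set t := thterm _ _ _; set b := qbin _ _ _.
by rewrite -[k%:~R]/(k%:R) -[N%:~R]/(N%:R); ring.
Qed.

Lemma qX_neq1 n : 1 - q ^+ n.+1 != 0.
Proof.
have /andP[q0 q1] := nrm_q; rewrite subr_eq0 eq_sym; apply/eqP => h.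
have : nrm (q ^+ n.+1) < 1 by rewrite nrmX exprn_ilt1.
by rewrite h nrm1 ltxx.
Qed.

Lemma qfact_neq0 n : qfact q n != 0.
Proof. by rewrite /qfact; apply/prodf_neq0 => i _; exact: qX_neq1. Qed.

Lemma qfact_cvg : exists2 l : C, l != 0 & qfact q n @[n --> \oo] --> l.
Proof.
apply: (@prod_cvg_neq0 R (fun i => q ^+ i.+1)); last exact: qX_neq1.
have := summ_fp 0; apply: eq_summ => i.
by rewrite fpE ce0 mul1r.
Qed.

Lemma qbin_eq M k : (k <= M)%N -> qbin q M k = qfact q M / (qfact q k * qfact q (M - k)).
Proof.
move=> kM; rewrite -(qbin_fact q kM) mulfK// mulf_neq0 ?qfact_neq0//.
Qed.

Lemma cvgC_inv (u : nat -> C) (l : C) : l != 0 -> u @ \oo --> l -> (u n)^-1 @[n --> \oo] --> l^-1.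
Proof. by move=> l0; exact: cvgV. Qed.

Lemma qbin_bounded : exists B, forall M k, nrm (qbin q M k) <= B.
Proof.
have [l l0 hl] := qfact_cvg.
have [B1 hB1] := cvg_bounded hl; have [B2 hB2] := cvg_bounded (cvgC_inv l0 hl).
have B10 : 0 <= B1 by apply: le_trans (hB1 0); exact: nrm_ge0.
have B20 : 0 <= B2 by apply: le_trans (hB2 0); exact: nrm_ge0.
exists (B1 * (B2 * B2)) => M k; have [kM|Mk] := leqP k M; last first.
  by rewrite qbin_small// nrm0 !mulr_ge0.
rewrite qbin_eq// nrmM invfM nrmM.
by apply: ler_pM; rewrite ?mulr_ge0 ?nrm_ge0//; apply: ler_pM; rewrite ?nrm_ge0.
Qed.

(** The central Gaussian binomials, extended by zero to all integers: Tannery's theorem requires an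
    index type independent of N. *)
Definition gb N (m : int) : C :=
  if (- N%:Z <= m) && (m <= N%:Z) then qbin q (N + N) (absz (m + N%:Z)%R) else 0.

(** The quotient of one q-factorial by two, all with indices tending to infinity, tends to l/l^2
    with l the infinite product of the 1 - q^i. The limit is the same for every m. *)
Lemma gb_cvg : exists2 l : C, l != 0 & forall m, gb N m @[N --> \oo] --> l.
Proof.
have [l l0 hl] := qfact_cvg; exists l^-1; first by rewrite invr_eq0.
move=> m.
have sh (f : nat -> nat) : (forall N, N <= f (N + `|m|))%N -> qfact q (f N) @[N --> \oo] --> l.
  move=> hf; apply/cvgC_P => e e0; have /cvgC_P/(_ e e0)[M _ hM] := hl.
  exists (M + `|m|)%N => // N /= MN; apply: hM => /=.
  by have := hf (N - absz m)%N; rewrite subnK; lia.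
have h1 := sh (fun N => N + N)%N; have h2 := sh (fun N => (absz (m + N%:Z)%R)).
have h3 := sh (fun N => (N + N - absz (m + N%:Z)%R)%N).
have {}h1 : qfact q (N + N) @[N --> \oo] --> l by apply: h1 => N; lia.
have {}h2 : qfact q (absz (m + N%:Z)%R) @[N --> \oo] --> l by apply: h2 => N; lia.
have {}h3 : qfact q (N + N - absz (m + N%:Z)%R)%N @[N --> \oo] --> l by apply: h3 => N; lia.
have h4 : qfact q (N + N) * (qfact q (absz (m + N%:Z)%R) * qfact q (N + N - absz (m + N%:Z)%R)%N)^-1 @[N --> \oo] --> l * (l * l)^-1.
  have h5 : qfact q (absz (m + N%:Z)%R) * qfact q (N + N - absz (m + N%:Z)%R)%N @[N --> \oo] --> l * l.
    exact: (@cvgCM R nat \oo _ (fun N => qfact q (absz (m + N%:Z)%R)) (fun N => qfact q (N + N - absz (m + N%:Z)%R)%N) _ _ h2 h3).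
  have ll : l * l != 0 by rewrite mulf_neq0.
  exact: (@cvgCM R nat \oo _ (fun N => qfact q (N + N)) (fun N => (qfact q (absz (m + N%:Z)%R) * qfact q (N + N - absz (m + N%:Z)%R)%N)^-1) _ _ h1 (cvgC_inv ll h5)).
have -> : l^-1 = l * (l * l)^-1 by field.
move: h4; apply: cvg_trans; apply: near_eq_cvg; exists `|m|%N => // N /= mN.
rewrite /gb ifT; last by lia.
by rewrite qbin_eq//; lia.
Qed.

Lemma BN_tot N (f : int -> C) :
  \sum_(k < (N + N).+1) f (shiftN N k) * qbin q (N + N) k = tot (fun m => f m * gb N m).
Proof.
symmetry; apply: hsE.
have := @hs_finite R _ (fun m => f m * gb N m) [seq shiftN N k | k <- iota 0 (N + N).+1].
rewrite big_map map_inj_uniq ?iota_uniq; last by move=> i j; rewrite /shiftN; lia.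
rewrite -[iota 0 (N + N).+1]/(index_iota 0 (N + N).+1) big_mkord.
rewrite (eq_bigr (fun k : 'I_(N + N).+1 => f (shiftN N k) * qbin q (N + N) k)); last first.
  move=> k _; rewrite /gb /shiftN ifT; last by have := ltn_ord k; lia.
  by congr (_ * qbin _ _ _); lia.
apply => // m /mapP h; rewrite /gb ifF ?mulr0//; apply/negP => /andP[h1 h2].
apply: h; exists (absz (m + N%:Z)%R); last by rewrite /shiftN; lia.
by rewrite mem_iota; lia.
Qed.

(** Tannery's theorem, with the uniform bound on Gaussian binomials as the dominating constant. The
    limit l is common to all terms and leaves the sum. *)
Lemma BN_cvg (f : int -> C) (l : C) : summ f -> (forall m, gb N m @[N --> \oo] --> l) ->
  (\sum_(k < (N + N).+1) f (shiftN N k) * qbin q (N + N) k) @[N --> \oo] --> l * tot f.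
Proof.
move=> sf hl; have [B hB] := qbin_bounded.
have B0 : 0 <= B by apply: le_trans (hB 0 0)%N; exact: nrm_ge0.
have gB N m : nrm (gb N m) <= B by rewrite /gb; case: ifP => _; rewrite ?nrm0.
have lB : nrm l <= B.
  apply/ler_addgt0Pr => e e0; have /cvgC_P/(_ e e0)[M _ hM] := hl 0.
  have := hM M (leqnn M); have := gB M 0; have := nrm_lb l (gb M 0) => /=; lra.
have T : tot (fun m => f m * gb N m) @[N --> \oo] --> tot (fun m => f m * l).
  apply: (tannery (g := fun m => B * nrm (f m))).
  - by move=> m; rewrite mulr_ge0 ?nrm_ge0.
  - exact: bsumZ.
  - by apply: nearW => N m; rewrite nrmM mulrC; apply: ler_wpM2r; rewrite ?nrm_ge0.
  - by move=> m; rewrite nrmM mulrC; apply: ler_wpM2r; rewrite ?nrm_ge0.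
  - by move=> m; apply: cvgCZ; exact: hl.
have -> : l * tot f = tot (fun m => f m * l).
  by rewrite -(totZ l sf); apply: eq_tot => m; rewrite mulrC.
move: T; suff -> : (fun N => \sum_(k < (N + N).+1) f (shiftN N k) * qbin q (N + N) k) = (fun N => tot (fun m => f m * gb N m)) by [].
by apply/funext => N; rewrite BN_tot.
Qed.

Definition off_lattice (z : C) := forall m n : int, z != m%:~R + n%:~R * tau.

Lemma off_fp z i : off_lattice z -> 1 - fp z i != 0.
Proof.
move=> oz; rewrite subr_eq0 eq_sym; apply/eqP => /ce_eq1[n hn].
have := oz n (- i.+1%:Z); rewrite mulrNz -hn => /eqP; apply.
by rewrite -[i.+1%:~R]/(i.+1%:R); ring.
Qed.

Lemma off_fm z i : off_lattice z -> 1 - fm z i != 0.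
Proof.
move=> oz; rewrite subr_eq0 eq_sym; apply/eqP => /ce_eq1[n hn].
have := oz (- n) i%:Z; rewrite mulrNz -hn => /eqP; apply.
by rewrite -[i%:~R]/(i%:R); ring.
Qed.

(** In the limit of [triple_finite], a multiple of [Th tau z] becomes an exponential times two
    infinite products without zero factors. *)
Lemma Th_neq0 z : off_lattice z -> Th tau z != 0.
Proof.
move=> oz; have [l l0 hl] := gb_cvg.
have [a a0 ha] := prod_cvg_neq0 (summ_fp z) (fun i => off_fp i oz).
have [b b0 hb] := prod_cvg_neq0 (summ_fm z) (fun i => off_fm i oz).
have h1 := BN_cvg (summ_thterm tau_uhp z) hl.
have h2 : ce (tau / 8 + z / 2) * AN N z @[N --> \oo] --> ce (tau / 8 + z / 2) * (a * b).
  have h : AN N z @[N --> \oo] --> a * b.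
    exact: (@cvgCM R nat \oo _ (fun N => \prod_(i < N) (1 - fp z i)) (fun N => \prod_(i < N) (1 - fm z i)) a b ha hb).
  exact: (@cvgCZ R nat \oo _ (fun N => AN N z) _ _ h).
have E : l * Th tau z = ce (tau / 8 + z / 2) * (a * b).
  rewrite (Th_tot tau_uhp); apply: cvgC_uniq h1 _; move: h2.
  suff -> : (fun N => ce (tau / 8 + z / 2) * AN N z) = (fun N => BN N z) by [].
  by apply/funext => N; rewrite triple_finite.
apply: contraNneq (_ : l * Th tau z != 0) => [->|]; first by rewrite mulr0.
by rewrite E !mulf_neq0// ce_neq0.
Qed.

Definition Sz z := tot (fun i => - (fp z i / (1 - fp z i)) + fm z i / (1 - fm z i)).

(** The limit of [triple_finite_D]: both sides acquire the same nonzero factor l, which cancels. *)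
Lemma Th_logderiv z : (forall i, 1 - fp z i != 0) -> (forall i, 1 - fm z i != 0) ->
  tc tau z 1 = twopii R * Th tau z * (2^-1 + Sz z).
Proof.
move=> hp hm; have [l l0 hl] := gb_cvg.
have s1 : summ (fun n => thterm tau z n * nuC n).
  have := summZ (twopii R)^-1 (summ_tc_row tau_uhp z 1); apply: eq_summ => n.
  by rewrite expr1 divr1; field; exact: twopii_neq0.
have E1 : tc tau z 1 = twopii R * tot (fun n => thterm tau z n * nuC n).
  by rewrite -totZ//; apply: eq_tot => n; rewrite expr1 divr1; ring.
have h1 := BN_cvg s1 hl.
have h2 := BN_cvg (summ_thterm tau_uhp z) hl; rewrite -Th_tot// in h2.
have sS : summ (fun i => - (fp z i / (1 - fp z i)) + fm z i / (1 - fm z i)).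
  apply: summD; last exact: summ_frac (summ_fm z) hm.
  by apply: summ_le (summ_frac (summ_fp z) hp) => i; rewrite nrmN.
have h3 : SN N z @[N --> \oo] --> Sz z.
  have := hs_series (hs_tot sS); rewrite -/(Sz z).
  suff -> : series (fun i => - (fp z i / (1 - fp z i)) + fm z i / (1 - fm z i)) = fun N => SN N z by [].
  by apply/funext => N; rewrite /series/= big_mkord.
have h4 : BN N z * (2^-1 + SN N z) @[N --> \oo] --> (l * Th tau z) * (2^-1 + Sz z).
  have h : 2^-1 + SN N z @[N --> \oo] --> 2^-1 + Sz z.
    exact: (@cvgCD R nat \oo _ (fun=> 2^-1) (fun N => SN N z) _ _ (cvg_cst _) h3).
  exact: (@cvgCM R nat \oo _ (fun N => BN N z) (fun N => 2^-1 + SN N z) _ _ h2 h).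
have E2 : l * tot (fun n => thterm tau z n * nuC n) = (l * Th tau z) * (2^-1 + Sz z).
  apply: cvgC_uniq h1 _; move: h4.
  suff -> : (fun N => BN N z * (2^-1 + SN N z)) = (fun N => \sum_(k < (N + N).+1) thterm tau z (shiftN N k) * nuC (shiftN N k) * qbin q (N + N) k) by [].
  by apply/funext => N; rewrite -triple_finite_D//; apply: eq_bigr => k _; rewrite mulrAC.
by rewrite E1 -mulrA; congr (_ * _); apply: (mulfI l0); rewrite E2 mulrA.
Qed.

End TripleProduct.

(** * Bernoulli numbers, Lambert series and the logarithmic derivative of theta *)

Section Bernoulli.
Context {R : realType}.
Local Notation C := (Cplx R).

Lemma tot_recl (f : nat -> C) : summ f -> tot f = f 0%N + tot (fun i => f i.+1).
Proof.
move=> sf; have s1 : psum f (1 : R).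
  by apply: eq_summ sf => k; rewrite toC1 expr1n mulr1.
have [|_] := @ps_recl R f 1 1 s1 ltr01; first by rewrite nrm1.
rewrite mul1r /ps.
rewrite (eq_tot (g := f)); last by move=> k; rewrite expr1n mulr1.
by move=> ->; congr (_ + _); apply: eq_tot => k; rewrite expr1n mulr1.
Qed.

(** This is B_k / k!, obtained by inverting the power series (e^x - 1)/x. *)
Definition bern (k : nat) : C := inv_coef (fun k => (@expc R k.+1)) k.

Lemma has_ps_bern : has_ps (fun x : C => x / (Cexp x - 1)) bern.
Proof.
have h := has_psB (has_ps_Cexp (R := R)) (has_ps_cst (1 : C)).
have h1 := has_ps_unshift h _; rewrite /expc fact0 invr1 subrr in h1.
have h2 := has_psV (h1 erefl) _.
have e1 : (fun k : nat => ((k.+1)`!%:R)^-1 - @cst_coef R 1 k.+1) = (fun k => @expc R k.+1).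
  by apply/funext => k; rewrite subr0.
rewrite e1 /cst_coef subr0 (_ : 1`! = 1)%N// invr1 oner_neq0 in h2.
by apply: has_ps_eq (h2 isT) _; apply: nearW => z; rewrite invf_div.
Qed.

Lemma bernoulliE k : bernoulli R k = k`!%:R * bern k.
Proof. by rewrite /bernoulli (expansionE has_ps_bern). Qed.

Lemma nrm_twopii : nrm (twopii R) = 2 * pi.
Proof.
have h : 0 <= 2 * pi :> R by rewrite mulr_ge0// pi_ge0.
apply/eqP; rewrite -(@eqrXn2 _ 2)// ?nrm_ge0// nrm2E /twopii/= expr0n/= add0r.
by [].
Qed.

Lemma ce_small (z : C) : z != 0 -> nrm z < 1 -> ce z != 1.
Proof.
move=> z0 z1; apply/eqP => /ce_eq1[n zn]; move: z0 z1; rewrite zn nrm_int => n0.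
rewrite -intr_norm -[1]/(1%:~R) ltr_int => n1.
have nn : n = 0 by lia.
by rewrite nn eqxx in n0.
Qed.

Lemma ce_Cexp_near : \forall x \near (0 : C)^', Cexp x != 1.
Proof.
apply/near0P; exists (2 * pi); first by rewrite mulr_gt0// pi_gt0.
move=> x x0 xr; have I0 : twopii R != 0 by exact: twopii_neq0.
have -> : x = twopii R * (x / twopii R) by rewrite mulrCA mulfV// mulr1.
apply: ce_small; first by rewrite mulf_neq0// invr_neq0.
rewrite nrmM nrmV nrm_twopii ltr_pdivrMr ?mul1r//.
by rewrite mulr_gt0// pi_gt0.
Qed.

Lemma bern0 : bern 0 = 1.
Proof. by rewrite /bern /inv_coef/= /expc (_ : 1`! = 1)%N// !invr1. Qed.

(** The function x/(e^x - 1) + x/2 is even. *)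
Lemma bern_odd k : odd k -> bern k + (k == 1)%N%:R / 2 = 0.
Proof.
pose c k := bern k + 2^-1 * @shift_coef R (cst_coef 1) k.
have h1 : has_ps (fun x : C => x / (Cexp x - 1) + 2^-1 * x) c.
  exact: has_psD has_ps_bern (has_psZ 2^-1 (has_ps_id (R := R))).
have n1 : (-1 : C) != 0 by rewrite oppr_eq0 oner_neq0.
have h2 := has_ps_scale h1 n1.
have h3 : c = (fun k => c k * (-1) ^+ k).
  apply: has_ps_uniq h1 (has_ps_eq h2 _).
  move: ce_Cexp_near; apply: filterS => x x1.
  rewrite mulN1r CexpN; have := Cexp_neq0 x; move: x1; set w := Cexp x => w1 w0.
  have w2 : w - 1 != 0 by rewrite subr_eq0.
  have -> : w^-1 - 1 = - ((w - 1) / w) by field.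
  by field; rewrite w0 w2.
move=> ok; have := congr1 (fun c => c k) h3; rewrite /= -signr_odd ok expr1 mulrN1.
move=> /eqP; rewrite -addr_eq0 -mulr2n mulrn_eq0/= => /eqP; rewrite /c.
case: k ok => [|[|k]]//= _; rewrite ?mulr0 ?mulr1 ?mul1r ?mul0r//.
Qed.

End Bernoulli.

Section Lambert.
Context {R : realType}.
Local Notation C := (Cplx R).
Variable tau : C.
Hypothesis tau_uhp : uhp tau.
Local Notation q := (ce tau).

(** Both indices are shifted by one: the family is q^(i n) n^p e(n z) for i, n >= 1. The case p = 0
    gives the logarithmic derivative of theta, and p = 3 the lattice sum with exponent 4. *)
Definition Wterm p (z : C) (x : nat * nat) : C :=
  q ^+ (x.1.+1 * x.2.+1) * (x.2.+1%:R ^+ p * ce (x.2.+1%:R * z)).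
Definition Wf p z := tot (Wterm p z).
Definition Ss s := tot (fun x : nat * nat => q ^+ (x.1.+1 * x.2.+1) * x.2.+1%:R ^+ s).

Lemma summ_W3 p z : nrm q * expR (2 * pi * nrm z) < 1 ->
  summ (fun y : (nat * nat) * nat => q ^+ (y.1.1.+1 * y.1.2.+1) * y.1.2.+1%:R ^+ p *
    ((twopii R * y.1.2.+1%:R * z) ^+ y.2 / y.2`!%:R)).
Proof.
move=> t1; have [t tE] : exists t, t = nrm q * expR (2 * pi * nrm z) by eexists.
rewrite -tE in t1; have /andP[q0 q1] := nrm_q tau_uhp.
have t0 : 0 <= t by rewrite tE mulr_ge0 ?expR_ge0.
apply: (@bsum_rows _ _ _ _ (fun x : nat * nat => nrm q ^+ x.1 * (x.2.+1%:R ^+ p * t ^+ x.2.+1))).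
- by move=> y; exact: nrm_ge0.
- move=> [i n] s us /=.
  have e0 : 0 <= 2 * pi * n.+1%:R * nrm z :> R by rewrite !mulr_ge0 ?nrm_ge0 ?pi_ge0.
  apply: (@le_trans _ _ (nrm q ^+ (i.+1 * n.+1) * n.+1%:R ^+ p * \sum_(k <- s) (2 * pi * n.+1%:R * nrm z) ^+ k / k`!%:R)).
    rewrite mulr_sumr; apply: ler_sum => k _.
    by rewrite !nrmM nrmV !nrmX !nrmM !nrm_nat nrm_twopii.
  apply: (@le_trans _ _ (nrm q ^+ (i + n.+1) * n.+1%:R ^+ p * expR (2 * pi * n.+1%:R * nrm z))).
    apply: ler_pM; rewrite ?mulr_ge0 ?exprn_ge0 ?sum_expR_le//.
      by rewrite sumr_ge0// => k _; rewrite divr_ge0 ?exprn_ge0.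
    apply: ler_wpM2r; first by rewrite exprn_ge0.
    (* The bound (i + 1)(n + 1) >= i + (n + 1) decouples the two indices. *)
    by rewrite ler_wiXn2l// ?(ltW q1)//; lia.
  rewrite le_eqVlt; apply/orP; left; apply/eqP.
  have -> : 2 * pi * n.+1%:R * nrm z = n.+1%:R * (2 * pi * nrm z) by ring.
  by rewrite expRM_natl tE exprMn exprD; ring.
- apply: (bsum_prod (g := fun i => nrm q ^+ i) (h := fun n => n.+1%:R ^+ p * t ^+ n.+1)).
  + by move=> i; rewrite exprn_ge0.
  + by move=> i; rewrite mulr_ge0 ?exprn_ge0.
  + by apply: bsum_geo; rewrite q0.
  + have t01 : 0 <= t < 1 by rewrite t0.
    exact: (bsum_inj succn_inj (bsum_poly p t01)).
Qed.

Lemma Wterm_exp p z x : Wterm p z x =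
  tot (fun k : nat => q ^+ (x.1.+1 * x.2.+1) * x.2.+1%:R ^+ p * ((twopii R * x.2.+1%:R * z) ^+ k / k`!%:R)).
Proof.
rewrite /Wterm mulrA totZ.
  by congr (_ * _); rewrite /ce mulrA Cexp_ps; apply: eq_tot => k; rewrite mulrC.
have := summ_ps (psum_expc (nrm_ge0 (twopii R * x.2.+1%:R * z))) (lexx _).
by apply: eq_summ => k; rewrite mulrC.
Qed.

Lemma W_bound z : nrm z < ImC tau -> nrm q * expR (2 * pi * nrm z) < 1.
Proof.
move=> zt; rewrite nrm_ce -expRD expR_lt1.
by rewrite addrC subr_lt0 ltr_pM2l// mulr_gt0// pi_gt0.
Qed.

Lemma summ_Wterm p z : nrm z < ImC tau -> summ (Wterm p z).
Proof.
move=> zt; have [h _] := fubini (summ_W3 p (W_bound zt)).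
by apply: eq_summ h => x; rewrite Wterm_exp.
Qed.

Lemma summ_Ss s : summ (fun x : nat * nat => q ^+ (x.1.+1 * x.2.+1) * x.2.+1%:R ^+ s).
Proof.
have h : nrm (0 : C) < ImC tau by rewrite nrm0; exact: tau_uhp.
by apply: eq_summ (summ_Wterm s h) => x; rewrite /Wterm mulr0 ce0 mulr1.
Qed.

Lemma W_ps p : has_ps (Wf p) (fun k => twopii R ^+ k / k`!%:R * Ss (k + p)).
Proof.
have y0 : 0 < ImC tau by exact: tau_uhp.
have h z : nrm z < ImC tau -> summ (fun k => twopii R ^+ k / k`!%:R * Ss (k + p) * z ^+ k) /\
    hs (fun k => twopii R ^+ k / k`!%:R * Ss (k + p) * z ^+ k) (Wf p z).
  move=> zt; have s3 := summ_W3 p (W_bound zt); have [h1 h2] := fubini_swap s3.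
  have E k : tot (fun x : nat * nat => q ^+ (x.1.+1 * x.2.+1) * x.2.+1%:R ^+ p * ((twopii R * x.2.+1%:R * z) ^+ k / k`!%:R)) = twopii R ^+ k / k`!%:R * Ss (k + p) * z ^+ k.
    rewrite [RHS]mulrAC /Ss -totZ; last exact: summ_Ss.
    by apply: eq_tot => x; rewrite exprD !exprMn; ring.
  split; first by apply: eq_summ h1.
  have : hs (fun k => twopii R ^+ k / k`!%:R * Ss (k + p) * z ^+ k) _ := eq_hs E h2; congr hs.
  by rewrite -(tot_fubini s3); apply: eq_tot => x; rewrite Wterm_exp.
exists (ImC tau / 2); first lra.
split; last by move=> z z0 zr; have [|_ /hsE <-//] := h z; lra.
have [|] := h (toC (ImC tau / 2)); last by [].
by rewrite nrm_toC gtr0_norm; lra.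
Qed.

(** The pairs of positive integers with product N + 1 are grouped together; they correspond to the
    divisors d of N + 1, with d as the second entry. *)
Lemma Ss_sigma s : Ss s = limn (series (fun n : nat => (sigma_div s n.+1)%:R * q ^+ n.+1 : C)).
Proof.
have [h1 h2] := tot_fiber (fun x : nat * nat => (x.1.+1 * x.2.+1).-1) (summ_Ss s).
symmetry; apply: lim_C; apply: hs_series; apply: eq_hs h2 => N /=.
pose s0 := [seq (((N.+1 %/ d).-1)%N, d.-1) | d <- divisors N.+1].
have dv d : d \in divisors N.+1 -> (0 < d)%N /\ (N.+1 = (N.+1 %/ d) * d)%N.
  rewrite -dvdn_divisors// => dN; split; first by case: d dN.
  by rewrite divnK.
have us0 : uniq s0.
  rewrite map_inj_in_uniq ?divisors_uniq// => a b /dv[a0 _] /dv[b0 _] [_].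
  by case: a b a0 b0 => [|a] [|b]//= _ _ ->.
have := @hs_finite R _ (fun x : nat * nat => ((x.1.+1 * x.2.+1).-1 == N)%:R * (q ^+ (x.1.+1 * x.2.+1) * x.2.+1%:R ^+ s)) s0 us0.
move=> /(_ _)/hsE ->; last first.
  move=> [i n] /mapP h; rewrite -[(i, n).1]/i -[(i, n).2]/n; case: eqP => [iN|]; last by rewrite mul0r.
  exfalso; apply: h; have iN' : (i.+1 * n.+1 = N.+1)%N by rewrite -iN prednK.
  exists n.+1; first by rewrite -dvdn_divisors// -iN' dvdn_mull.
  by rewrite -iN' mulnK.
rewrite big_map /sigma_div natr_sum mulr_suml big_seq [RHS]big_seq; apply: eq_bigr => d /dv[d0 dN].
cbn [fst snd].
have e1 : (d.-1.+1 = d)%N by rewrite prednK.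
have e2 : ((N.+1 %/ d).-1.+1 = N.+1 %/ d)%N.
  by rewrite prednK// divn_gt0// dvdn_leq//; apply/dvdnP; exists (N.+1 %/ d)%N.
by rewrite e1 e2 -dN eqxx mul1r natrX mulrC.
Qed.

Lemma Gseries_Ss k : (0 < k)%N -> Gseries k tau = - (bernoulli R (2 * k) / (4 * k)%:R) + Ss (2 * k - 1).
Proof. by move=> _; rewrite /Gseries Ss_sigma. Qed.

Lemma geo_frac (x : C) : nrm x < 1 -> 1 - x != 0 /\ hs (fun n : nat => x ^+ n.+1) (x / (1 - x)).
Proof.
move=> x1; have x0 : 1 - x != 0.
  by rewrite subr_eq0 eq_sym; apply: contraTneq x1 => ->; rewrite nrm1 ltxx.
have sg : summ (fun n : nat => x ^+ n).
  apply: (summ_le (g := fun n => nrm x ^+ n)); first by move=> n; rewrite nrmX.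
  by apply: bsum_geo; rewrite nrm_ge0.
have sg1 : summ (fun n : nat => x ^+ n.+1) by exact: summ_inj succn_inj sg.
split => //; suff <- : tot (fun n : nat => x ^+ n.+1) = x / (1 - x) by exact: hs_tot.
have h1 := tot_recl sg; rewrite expr0 in h1.
have h2 : tot (fun n : nat => x ^+ n.+1) = x * tot (fun n : nat => x ^+ n).
  by rewrite -totZ//; apply: eq_tot => n; rewrite exprS.
apply: (mulIf x0); rewrite divfK// h2.
set S := tot _ in h1 h2 *.
have h3 : S - x * S = 1 by rewrite {1}h1 h2 addrK.
have -> : x * S * (1 - x) = x * (S - x * S) by ring.
by rewrite h3 mulr1.
Qed.

Lemma W0_row z i : nrm z < ImC tau ->
  1 - q ^+ i.+1 * ce z != 0 /\ tot (fun n => Wterm 0 z (i, n)) = q ^+ i.+1 * ce z / (1 - q ^+ i.+1 * ce z).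
Proof.
move=> zt; have x1 : nrm (q ^+ i.+1 * ce z) < 1.
  have /andP[q0 q1] := nrm_q tau_uhp.
  rewrite nrmM nrmX; apply: le_lt_trans (W_bound zt).
  apply: ler_pM; rewrite ?exprn_ge0 ?nrm_ge0//.
    by rewrite exprS ler_piMr// exprn_ile1// ltW.
  rewrite nrm_ce ler_expR -mulrN; apply: ler_wpM2l; first by rewrite mulr_ge0// pi_ge0.
  by apply: le_trans (Im_nrm z); rewrite -normrN ler_norm.
have [h1 h2] := geo_frac x1; split => //.
rewrite -(hsE h2); apply: eq_tot => n.
by rewrite /Wterm/= expr0 mul1r ceMn exprMn exprM.
Qed.

(** Each fraction x/(1 - x) is a geometric series, except that of [fm] with i = 0: there x = e(-z)
    need not lie in the unit disc, and the term is kept as (e(z) - 1)^-1. *)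
Lemma Sz_W z : z != 0 -> nrm z < ImC tau -> nrm z < 1 ->
  [/\ forall i, 1 - fp tau z i != 0, forall i, 1 - fm tau z i != 0 &
  Sz tau z = (ce z - 1)^-1 + (Wf 0 (- z) - Wf 0 z)].
Proof.
move=> z0 zt z1; have zt' : nrm (- z) < ImC tau by rewrite nrmN.
have hp i : 1 - fp tau z i != 0.
  by rewrite fpE mulrC; have [] := W0_row i zt.
have cz : ce z != 1 by exact: ce_small.
have hm i : 1 - fm tau z i != 0.
  rewrite fmE mulrC; case: i => [|i]; last by have [] := W0_row i zt'.
  by rewrite expr0 mul1r subr_eq0 eq_sym ceN invr_eq1.
split => //.
have sp := summ_frac (summ_fp tau_uhp z) hp; have sm := summ_frac (summ_fm tau_uhp z) hm.
have sm' := summ_inj succn_inj sm.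
have e1 : tot (fun i => - (fp tau z i / (1 - fp tau z i))) = - Wf 0 z.
  rewrite -[RHS]mulN1r /Wf -(tot_fubini (summ_Wterm 0 zt)).
  rewrite (eq_tot (f := fun i => tot (fun j => Wterm 0 z (i, j))) (g := fun i => fp tau z i / (1 - fp tau z i))); last first.
    by move=> i; have [_ ->] := W0_row i zt; rewrite fpE [ce z * _]mulrC.
  by rewrite -totZ//; apply: eq_tot => i; rewrite mulN1r.
have e2 : tot (fun i => fm tau z i / (1 - fm tau z i)) = (ce z - 1)^-1 + Wf 0 (- z).
  rewrite tot_recl//; congr (_ + _).
    rewrite fmE expr0 mulr1 ceN; have := ce_neq0 z; move: (ce z) cz => w w1 w0.
    have w2 : w - 1 != 0 by rewrite subr_eq0.
    have -> : 1 - w^-1 = (w - 1) / w by field.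
    by field; rewrite w0 w2.
  rewrite /Wf -(tot_fubini (summ_Wterm 0 zt')); apply: eq_tot => i.
  by have [_ ->] := W0_row i zt'; rewrite fmE [ce _ * _]mulrC.
rewrite /Sz totD//; last by apply: summ_le sp => i; rewrite nrmN.
by rewrite e1 e2; ring.
Qed.

(* The coefficients of z Th'(z) / Th(z), cf. [Th_ode]. *)
Definition lcoef k : C :=
  twopii R ^+ k * (bern k + (k == 1)%N%:R / 2) +
  (if k is k'.+1 then twopii R ^+ k / k'`!%:R * Ss k' * ((-1) ^+ k' - 1) else 0).

Lemma lcoef_ps : has_ps (fun z => twopii R * z * (2^-1 + ((ce z - 1)^-1 + (Wf 0 (- z) - Wf 0 z)))) lcoef.
Proof.
have I0 : twopii R != 0 by exact: twopii_neq0.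
have n1 : (-1 : C) != 0 by rewrite oppr_eq0 oner_neq0.
have h1 := has_ps_scale (has_ps_bern (R := R)) I0.
have h2 := has_psZ (twopii R / 2) (has_ps_id (R := R)).
have h3 := has_psB (has_ps_scale (W_ps 0) n1) (W_ps 0).
have h4 := has_psZ (twopii R) (has_ps_shift h3).
have h5 := has_psD (has_psD h1 h2) h4.
apply: eq_has_ps (has_ps_eq h5 _) _.
  apply: nearW => z; rewrite mulN1r -/(ce z); ring.
move=> [|k].
  by rewrite /lcoef/= !mulr0 !addr0 expr0 mulr1 mul1r mul0r addr0.
rewrite /lcoef /= addn0 /cst_coef exprS; case: k => [|k]/=.
  by rewrite !mulr1 expr0; ring.
by rewrite !mulr0 !mul0r; ring.
Qed.

Lemma Th_ode k : k%:R * tc tau 0 k = cauchy (tc tau 0) lcoef k.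
Proof.
have [s0 h0] := Th_Taylor tau_uhp 0.
have hT : has_ps (Th tau) (tc tau 0).
  by exists 1 => //; split => // z _ _; rewrite -h0 add0r.
have hD : has_ps (fun z => tc tau z 1) (deriv_coef (tc tau 0)).
  exists 1 => //; split; first by apply: psum_deriv (s0 2) _; rewrite ler01 ltr1n.
  by move=> z _ _; rewrite -deriv_tc.
have hL := has_psM hT lcoef_ps.
have hZ := has_ps_shift hD.
suff E : shift_coef (deriv_coef (tc tau 0)) = cauchy (tc tau 0) lcoef.
  by rewrite -E; case: k => [|k]; rewrite ?mul0r.
apply: has_ps_uniq hZ (has_ps_eq hL _).
apply/near0P; exists (Num.min (ImC tau) 1); first by rewrite lt_min ltr01 andbT; exact: tau_uhp.
move=> z z0; rewrite lt_min => /andP[zt z1].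
have [hp hm hS] := Sz_W z0 zt z1.
by rewrite (Th_logderiv tau_uhp hp hm) hS; ring.
Qed.

Lemma lcoef0 : lcoef 0 = 1.
Proof. by rewrite /lcoef expr0 bern0 mul0r !addr0 mulr1. Qed.

Lemma lcoef_odd k : odd k -> lcoef k = 0.
Proof.
move=> ok; rewrite /lcoef bern_odd// mulr0 add0r; case: k ok => //= k ok.
by rewrite -signr_odd (negPf ok) expr0 subrr mulr0.
Qed.

(** The Bernoulli part supplies the constant term and the Lambert part the divisor sums of a single
    Eisenstein series. Weight 2 is included. *)
Lemma lcoef_even k : (0 < k)%N -> lcoef (2 * k) =
  - 2 * twopii R ^+ (2 * k) / (2 * k - 1)`!%:R * Gseries k tau.
Proof.
move=> k0; rewrite Gseries_Ss// bernoulliE /lcoef.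
have -> : (2 * k == 1)%N = false by lia.
have [m mE] : exists m, (2 * k = m.+1)%N by exists (2 * k).-1; lia.
have om : odd m by have := congr1 odd mE; rewrite mul2n odd_double/=; case: (odd m).
have -> : (4 * k = 2 * m.+1)%N by lia.
rewrite mE subn1/= -signr_odd om expr1 mul0r addr0 factS !natrM.
have f0 : m`!%:R != 0 :> C by exact: fact_neq0.
have m0 : m.+1%:R != 0 :> C by rewrite pnatr_eq0.
move: m0 f0; move: (m.+1%:R) (m`!%:R) => a b a0 b0.
by field; rewrite a0 b0.
Qed.

End Lambert.

(** * The sum of (z + n)^-4 over the integers *)

Section Herglotz.
Context {R : realType}.
Local Notation C := (Cplx R).

(* The sum over n of (z + n)^-4, as a function of w = e(z), cf. [herglotz]. *)
Definition R4 (w : C) : C := twopii R ^+ 4 / 6 * (w * (w ^+ 2 + 4 * w + 1) / (w - 1) ^+ 4).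
Definition R4f (z : C) := R4 (ce z).

(** The relation that the sum of (z + n)^-4 satisfies when n is split by parity, stated for the
    rational function in v = e(z/2). *)
Lemma R4_double (v : C) : v ^+ 2 != 1 -> R4 v + R4 (- v) = 16 * R4 (v ^+ 2).
Proof.
move=> v2; have v1 : v - 1 != 0 by rewrite subr_eq0; apply: contraNneq v2 => ->; rewrite expr1n.
have v1' : - v - 1 != 0.
  by rewrite -opprD oppr_eq0 addr_eq0; apply: contraNneq v2 => ->; rewrite sqrrN expr1n.
have v21 : v ^+ 2 - 1 != 0 by rewrite subr_eq0.
by rewrite /R4; field; rewrite v1 v1' v21.
Qed.

Lemma R4f_double (z : C) : ce z != 1 -> R4f (z / 2) + R4f ((z + 1) / 2) = 16 * R4f z.
Proof.
move=> z1; have e : ce z = ce (z / 2) ^+ 2 by rewrite -ceMn; congr ce; field.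
have e2 : ce ((z + 1) / 2) = - ce (z / 2) by rewrite mulrDl mul1r ceD ce_half mulrN1.
by rewrite /R4f e e2 R4_double// -e.
Qed.

Lemma R4f_iter (z : C) k : ce z != 1 ->
  \sum_(j < 2 ^ k) R4f ((z + j%:R) / 2 ^+ k) = 16 ^+ k * R4f z.
Proof.
move=> z1; elim: k => [|k IH].
  by rewrite expn0 big_ord1 addr0 expr0 divr1 mul1r.
rewrite [16 ^+ _]exprS -mulrA -IH mulr_sumr expnS mul2n -addnn big_split_ord /= -big_split/=.
apply: eq_bigr => j _; rewrite -R4f_double; last first.
  apply/eqP => h; move: z1; have -> : z = 2 ^+ k * ((z + j%:R) / 2 ^+ k) - j%:R.
    by rewrite mulrCA mulfV ?mulr1 ?addrK// expf_neq0// pnatr_eq0.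
  have e : 2 ^+ k = (2 ^ k)%:R :> C by rewrite natrX.
  by rewrite ceB ce_nat divr1 {1}e ceMn h expr1n eqxx.
have p0 : 2 ^+ k != 0 :> C by rewrite expf_neq0// pnatr_eq0.
rewrite exprS; congr (R4f _ + R4f _); first by field; rewrite p0.
rewrite natrD natrX -[2%:R]/(2 : C); field; by rewrite p0.
Qed.

Lemma R4f_period (z : C) (n : int) : R4f (z + n%:~R) = R4f z.
Proof. by rewrite /R4f ceD ce_int mulr1. Qed.

(** The residues modulo 2^(k+1) are represented symmetrically about 0, so that each fixed integer is
    among them for all large k. *)
Lemma R4f_center (z : C) k : ce z != 1 ->
  \sum_(j < 2 ^ k + 2 ^ k) R4f ((z + (j%:R - (2 ^ k)%:R)) / (2 ^ k.+1)%:R) = 16 ^+ k.+1 * R4f z.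
Proof.
move=> z1; rewrite -R4f_iter// expnS mul2n -addnn big_split_ord/= [RHS]big_split_ord/= addrC.
have p0 : 2 ^+ k != 0 :> C by rewrite expf_neq0// pnatr_eq0.
have e : 2 ^+ k.+1 = (2 ^ k + 2 ^ k)%:R :> C by rewrite addnn -mul2n -expnS natrX.
rewrite -e; congr (_ + _); apply: eq_bigr => j _.
  by rewrite natrD addrAC subrr add0r.
rewrite -(R4f_period _ 1); congr R4f; rewrite natrD natrX exprS -[2%:R]/(2 : C).
by rewrite -[1%:~R]/(1 : C); field; rewrite p0.
Qed.

(** The double-angle formula halves the argument to at most 3 pi/8, which stays away from pi/2, so
    that the cosine is bounded below. *)
Lemma sin_lower : exists2 s : R, 0 < s & forall x, `|x| <= 3 / 4 -> s * `|x| <= `|sin (pi * x)|.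
Proof.
have p0 := pi_gt0 R.
pose a : R := 3 / 8 * pi.
have ca : 0 < cos a by apply: cos_gt0_pihalf; rewrite /a; lra.
exists (pi * cos a ^+ 2); first by rewrite mulr_gt0// exprn_gt0.
have h u : 0 <= u <= a -> cos a * u <= sin u /\ cos a <= cos u.
  move=> /andP[u0 ua].
  have cau v : 0 <= v <= a -> cos a <= cos v.
    move=> /andP[v0 va]; rewrite leNgt ltr_cos ?in_itv/= -?leNgt//; rewrite /a in va *; lra.
  split; last by apply: cau; rewrite u0.
  have [|c cin] := MVT_segment u0 (fun x _ => is_derive_sin x).
    by apply: continuous_subspaceT => x; exact: continuous_sin.
  rewrite sin0 !subr0 => ->; apply: ler_wpM2r => //; apply: cau.
  by move: cin; rewrite in_itv/= => /andP[c0 cu]; rewrite c0 (le_trans cu).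
have pos x : 0 <= x <= 3 / 4 -> pi * cos a ^+ 2 * x <= sin (pi * x).
  move=> /andP[x0 x1]; have [|h1 h2] := h (pi * x / 2).
    by rewrite /a divr_ge0 ?mulr_ge0 ?(ltW p0)//=; nra.
  have -> : pi * x = (pi * x / 2) *+ 2 by rewrite -mulr_natr; field.
  rewrite sin_mulr2n -mulr_natl.
  have := ler_pM (ltW ca) _ h2 h1; rewrite mulr_ge0 ?(ltW ca) ?divr_ge0 ?mulr_ge0 ?(ltW p0)// => /(_ isT).
  nra.
move=> x x34; have [x0|x0] := ger0P x.
  by apply: le_trans (ler_norm _); apply: pos; rewrite x0; rewrite ger0_norm in x34.
rewrite -normrN -sinN -mulrN; apply: le_trans (ler_norm _); apply: pos.
by rewrite ltr0_norm in x34 => //; rewrite x34 andbT; lra.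
Qed.

Lemma expR_lower (t : R) : `|t| <= 2 -> expR (- 2) * `|t| <= `|expR t - 1|.
Proof.
move=> t2; have [t0|t0] := ger0P t.
  have h := expR_ge1Dx t; apply: le_trans (ler_norm _).
  apply: (@le_trans _ _ t); last lra.
  by rewrite ler_piMl// expR_le1; lra.
have h := expR_ge1Dx (- t); rewrite distrC; apply: le_trans (ler_norm _).
have e0 := expR_gt0 t.
have -> : 1 - expR t = expR t * (expR (- t) - 1) by rewrite mulrBr -expRD subrr expR0 mulr1.
apply: ler_pM; rewrite ?expR_ge0 ?normr_ge0//; last by lra.
  by rewrite oppr_ge0 ltW.
by rewrite ler_expR; rewrite ltr0_norm in t2 => //; lra.
Qed.

(** For z = x + i y and e = |e(z)|, |e(z) - 1|^2 = (e - 1)^2 + 4 e sin(pi x)^2; the first square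
    controls y and the second one x. *)
Lemma ce_lower : exists2 c : R, 0 < c &
  forall z : C, `|ReC z| <= 3 / 4 -> `|ImC z| <= 1 / 4 -> c * nrm z <= nrm (ce z - 1).
Proof.
have p0 := pi_gt0 R; have p4 : pi < 4 :> R by have := pihalf_lt2 R; lra.
have [s s0 hs] := sin_lower.
pose E : R := expR (- 2); have E0 : 0 < E by exact: expR_gt0.
pose c2 := Num.min (E ^+ 2) (4 * E * s ^+ 2).
have c20 : 0 < c2 by rewrite lt_min !mulr_gt0 ?exprn_gt0.
exists (Num.sqrt c2); first by rewrite sqrtr_gt0.
move=> z xz yz.
rewrite -(@ler_pXn2r _ 2)// ?nnegrE ?mulr_ge0 ?nrm_ge0 ?sqrtr_ge0//.
rewrite exprMn sqr_sqrtr ?(ltW c20)// !nrm2E.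
have [x xE] : exists x, x = ReC z by eexists.
have [y yE] : exists y, y = ImC z by eexists.
rewrite -xE -yE in xz yz *.
pose e := expR (- (2 * pi * y)).
have -> : ReC (ce z - 1) = e * cos (2 * pi * x) - 1.
  by rewrite /e xE yE; case: z {xz yz xE yE} => a b /=; rewrite !mul0r sub0r add0r.
have -> : ImC (ce z - 1) = e * sin (2 * pi * x).
  by rewrite /e xE yE; case: z {xz yz xE yE} => a b /=; rewrite !mul0r sub0r add0r subr0.
have -> : (e * cos (2 * pi * x) - 1) ^+ 2 + (e * sin (2 * pi * x)) ^+ 2 = (e - 1) ^+ 2 + 4 * e * sin (pi * x) ^+ 2.
  have -> : 2 * pi * x = (pi * x) *+ 2 by rewrite -mulr_natl; ring.
  have := cos2Dsin2 (pi * x); rewrite sin_mulr2n cos_mulr2n.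
  move: (cos _) (sin _) => a b ab.
  have -> : a ^+ 2 = 1 - b ^+ 2 by lra.
  have -> : (e * ((a * b) *+ 2)) ^+ 2 = 4 * e ^+ 2 * a ^+ 2 * b ^+ 2 by ring.
  have -> : a ^+ 2 = 1 - b ^+ 2 by lra.
  by ring.
have t2 : `| - (2 * pi * y)| <= 2.
  rewrite normrN !normrM (ger0_norm (ltW p0)) ger0_norm//; nra.
have e2 : E <= e.
  by rewrite ler_expR; have := lerNnormlW t2; lra.
rewrite mulrDr addrC; apply: lerD.
  have h := expR_lower t2; rewrite -/e -/E in h.
  apply: (@le_trans _ _ (E ^+ 2 * y ^+ 2)).
    by apply: ler_wpM2r; rewrite ?sqr_ge0// ge_min lexx.
  rewrite -[y ^+ 2]real_normK ?num_real// -[leRHS]real_normK ?num_real// -exprMn.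
  rewrite lerXn2r ?nnegrE ?mulr_ge0 ?normr_ge0 ?(ltW E0)//.
  apply: le_trans h; apply: ler_wpM2l; first exact: ltW.
  rewrite normrN !normrM (ger0_norm (ltW p0)) (ger0_norm (_ : 0 <= 2))//.
  have := pi_ge2 R; have := normr_ge0 y; nra.
apply: (@le_trans _ _ (4 * E * s ^+ 2 * x ^+ 2)).
  by apply: ler_wpM2r; rewrite ?sqr_ge0// ge_min lexx orbT.
apply: (@le_trans _ _ (4 * E * sin (pi * x) ^+ 2)); last first.
  by apply: ler_wpM2r; rewrite ?sqr_ge0// ler_pM2l.
rewrite -mulrA; apply: ler_wpM2l; first by rewrite mulr_ge0// ltW.
rewrite -[x ^+ 2]real_normK ?num_real// -[leRHS]real_normK ?num_real// -exprMn.
by rewrite lerXn2r ?nnegrE ?mulr_ge0 ?normr_ge0 ?(ltW s0)// hs.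
Qed.

(** The box contains every (z + n)/2^(k+1) with |n| <= 2^k, once 2 |z| <= 2^k. The bound there is
    what dominates the sums in [herglotz]. *)
Lemma R4_bound : exists B : R, forall z : C, `|ReC z| <= 3 / 4 -> `|ImC z| <= 1 / 4 ->
  nrm (z ^+ 4 * R4f z) <= B.
Proof.
have p0 := pi_gt0 R; have p4 : pi < 4 :> R by have := pihalf_lt2 R; lra.
have [c c0 hc] := ce_lower; pose E : R := expR 2.
pose B := nrm (twopii R ^+ 4 / 6) * (E * (E ^+ 2 + 4 * E + 1)) / c ^+ 4.
have E0 : 0 < E by exact: expR_gt0.
have B0 : 0 <= B by rewrite /B !mulr_ge0 ?nrm_ge0 ?invr_ge0 ?exprn_ge0 ?(ltW c0) ?addr_ge0 ?mulr_ge0 ?sqr_ge0 ?(ltW E0).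
exists B => z xz yz; have [->|z0] := eqVneq z 0; first by rewrite exprS !mul0r nrm0.
have nz : 0 < nrm z by rewrite nrm_gt0.
have h := hc z xz yz; have w10 : 0 < nrm (ce z - 1) by apply: lt_le_trans h; rewrite mulr_gt0.
have wE : nrm (ce z) <= E.
  rewrite nrm_ce ler_expR; apply: le_trans (ler_norm _) _.
  rewrite normrN !normrM (ger0_norm (ltW p0)) ger0_norm//; nra.
have -> : z ^+ 4 * R4f z = twopii R ^+ 4 / 6 * ((ce z * (ce z ^+ 2 + 4 * ce z + 1)) * (z ^+ 4 / (ce z - 1) ^+ 4)).
  by rewrite /R4f /R4; ring.
rewrite nrmM /B -[leRHS]mulrA; apply: ler_wpM2l; first exact: nrm_ge0.
rewrite nrmM; apply: ler_pM; rewrite ?nrm_ge0//.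
  rewrite nrmM; apply: ler_pM; rewrite ?nrm_ge0//.
  apply: le_trans (nrmD _ _) _; rewrite nrm1 lerD2r; apply: le_trans (nrmD _ _) _.
  rewrite nrmX nrmM nrm_nat; apply: lerD; first by rewrite lerXn2r ?nnegrE ?nrm_ge0 ?(ltW E0).
  by apply: ler_wpM2l.
rewrite nrmM nrmV !nrmX.
rewrite -exprVn -exprMn -exprVn lerXn2r ?nnegrE ?mulr_ge0 ?invr_ge0 ?nrm_ge0 ?(ltW c0)//.
by rewrite ler_pdivrMr// ler_pdivlMl.
Qed.

End Herglotz.

Section CotExpansion.
Context {R : realType}.
Local Notation C := (Cplx R).
Implicit Types (f g : C -> C) (x : C).

Lemma dC_add f g x a b : is_derive x (1 : C) f a -> is_derive x (1 : C) g b ->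
  is_derive x (1 : C) (fun y => f y + g y : C) (a + b : C).
Proof. by move=> fa gb; exact: is_deriveD. Qed.

Lemma dC_mul f g x a b : is_derive x (1 : C) f a -> is_derive x (1 : C) g b ->
  is_derive x (1 : C) (fun y => f y * g y : C) (a * g x + f x * b : C).
Proof.
move=> fa gb; have h := @is_deriveM C C f g x 1 a b fa gb.
by apply: is_derive_eq h _; rewrite /GRing.scale/=; ring.
Qed.

Lemma dC_cst x a : is_derive x (1 : C) (fun _ : C => a : C) (0 : C).
Proof. exact: is_derive_cst. Qed.

Lemma dC_id x : is_derive x (1 : C) (fun y : C => y : C) (1 : C).
Proof. exact: is_derive_id. Qed.

Lemma dC_inv f x a : is_derive x (1 : C) f a -> f x != 0 ->
  is_derive x (1 : C) (fun y => (f y)^-1 : C) (- a * (f x)^-1 * (f x)^-1 : C).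
Proof.
move=> [da <-] f0; apply: DeriveDef; first exact: derivableV.
by rewrite deriveV// /GRing.scale/= expr2 invfM; ring.
Qed.

(** It satisfies u' = -(u + u^2), so all its derivatives are polynomials in u. *)
Definition uu (x : C) : C := (Cexp x - 1)^-1.

Lemma duu x : Cexp x != 1 -> is_derive x (1 : C) uu (- (uu x + uu x * uu x)).
Proof.
move=> x1; have x1' : Cexp x - 1 != 0 by rewrite subr_eq0.
have h := dC_inv (dC_add (Cexp_derive x) (dC_cst x (-1))) x1'.
apply: is_derive_eq h _; rewrite addr0 /uu.
by move: (Cexp x) x1' => w w1; field.
Qed.

Lemma dvv x : x != 0 -> is_derive x (1 : C) (fun y => y^-1 : C) (- (x^-1 * x^-1)).
Proof.
move=> x0; apply: is_derive_eq (dC_inv (dC_id x) x0) _; ring.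
Qed.

Lemma has_ps_u : has_ps (fun x : C => uu x - x^-1) (fun k => @bern R k.+1).
Proof.
have h := has_psB (has_ps_bern (R := R)) (has_ps_cst (1 : C)).
have h1 := has_ps_unshift h _; rewrite bern0 subrr in h1.
apply: eq_has_ps (has_ps_eq (h1 erefl) _) _; last by move=> k; rewrite subr0.
move: (ce_Cexp_near (R := R)) => /near0P[r r0 hr].
apply/near0P; exists r => // x x0 xr; have := hr x x0 xr; rewrite -subr_eq0 /uu => w0.
by field; rewrite x0 w0.
Qed.

Definition u1 x := - (uu x + uu x * uu x) + x^-1 * x^-1.
Definition u2 x := (1 + 2 * uu x) * (uu x + uu x * uu x) - 2 * (x^-1 * (x^-1 * x^-1)).
Definition u3 x := - (uu x + uu x * uu x) * (1 + 6 * uu x + 6 * (uu x * uu x)) + 6 * (x^-1) ^+ 4.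

Lemma du x : x != 0 -> Cexp x != 1 ->
  [/\ is_derive x (1 : C) (fun x : C => uu x - x^-1) (u1 x),
      is_derive x (1 : C) u1 (u2 x) & is_derive x (1 : C) u2 (u3 x)].
Proof.
move=> x0 x1; have U := duu x1; have V := dvv x0; have c a := dC_cst x a.
have UU := dC_add U (dC_mul U U).
split.
- have h := dC_add U (dC_mul (c (-1)) V).
  rewrite (_ : (fun x => _) = (fun y => uu y + -1 * y^-1)); last by apply/funext => y; rewrite mulN1r.
  by apply: is_derive_eq h _; rewrite /u1; ring.
- have h := dC_add (dC_mul (c (-1)) UU) (dC_mul V V).
  rewrite (_ : u1 = (fun y => -1 * (uu y + uu y * uu y) + y^-1 * y^-1)); last by apply/funext => y; rewrite mulN1r.
  by apply: is_derive_eq h _; rewrite /u2; ring.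
- have h := dC_add (dC_mul (dC_add (c 1) (dC_mul (c 2) U)) UU) (dC_mul (c (-2)) (dC_mul V (dC_mul V V))).
  rewrite (_ : u2 = (fun y => (1 + 2 * uu y) * (uu y + uu y * uu y) + -2 * (y^-1 * (y^-1 * y^-1)))); last by apply/funext => y; rewrite mulNr.
  by apply: is_derive_eq h _; rewrite /u3; ring.
Qed.

Lemma has_ps_u3 : has_ps u3 (fun k => k.+1%:R * (k.+2%:R * (k.+3%:R * @bern R k.+4))).
Proof.
move: (ce_Cexp_near (R := R)) => /near0P[r r0 hr].
have h1 : has_ps u1 (deriv_coef (fun k => @bern R k.+1)).
  apply: (has_ps_is_derive has_ps_u); apply/near0P; exists r; first exact: r0.
  by move=> x x0 xr; have [] := du x0 (hr x x0 xr).
have h2 : has_ps u2 (deriv_coef (deriv_coef (fun k => @bern R k.+1))).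
  apply: (has_ps_is_derive h1); apply/near0P; exists r; first exact: r0.
  by move=> x x0 xr; have [] := du x0 (hr x x0 xr).
have h3 : has_ps u3 (deriv_coef (deriv_coef (deriv_coef (fun k => @bern R k.+1)))).
  apply: (has_ps_is_derive h2); apply/near0P; exists r; first exact: r0.
  by move=> x x0 xr; have [] := du x0 (hr x x0 xr).
by apply: eq_has_ps h3 _ => k; rewrite /deriv_coef.
Qed.

Definition rcoef k : C := cst_coef 1 k - 6^-1 * twopii R ^+ k *
  shift_coef (shift_coef (shift_coef (shift_coef (fun k => k.+1%:R * (k.+2%:R * (k.+3%:R * @bern R k.+4)))))) k.

(** At x = 2 pi i z, [R4f] is -(2 pi i)^4/6 times the third derivative of u. In [u3] the pole -6/x^4
    of that derivative is removed, and after multiplication by z^4 it becomes the constant 1. *)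
Lemma has_ps_R4f : has_ps (fun z : C => z ^+ 4 * R4f z) rcoef.
Proof.
have I0 : twopii R != 0 by exact: twopii_neq0.
have h1 := has_ps_scale (has_ps_shift (has_ps_shift (has_ps_shift (has_ps_shift has_ps_u3)))) I0.
have h2 := has_psB (has_ps_cst (1 : C)) (has_psZ 6^-1 h1).
apply: eq_has_ps (has_ps_eq h2 _) _; last first.
  by move=> k; rewrite /rcoef -!mulrA; congr (_ - _ * _); rewrite mulrC.
apply/near0P; exists 1 => // z z0 z1.
have := ce_small z0 z1; rewrite -subr_eq0 /u3 /uu /R4f /R4 -[Cexp (twopii R * z)]/(ce z).
move: (ce z) => w w0; have x0 : twopii R * z != 0 by rewrite mulf_neq0.
have -> : z ^+ 4 * (twopii R ^+ 4 / 6 * (w * (w ^+ 2 + 4 * w + 1) / (w - 1) ^+ 4)) =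
  (twopii R * z) ^+ 4 / 6 * (w * (w ^+ 2 + 4 * w + 1) / (w - 1) ^+ 4) by ring.
by move: (twopii R * z) x0 => x x0; field; rewrite x0 w0.
Qed.

Lemma has_ps_cvg f c : has_ps f c -> forall e : R, 0 < e ->
  exists2 r : R, 0 < r & forall z, z != 0 -> nrm z < r -> nrm (c 0%N - f z) < e.
Proof.
move=> [r r0 [sc fc]] e e0.
have [|sc' _] := @ps_recl R c r 0 sc r0; first by rewrite nrm0 ltW.
have [B hB] := ps_bounded sc'.
have B1 : 0 < `|B| + 1 by rewrite ltr_wpDl.
exists (Num.min r (e / (`|B| + 1))); first by rewrite lt_min r0 divr_gt0.
move=> z z0; rewrite lt_min => /andP[zr ze]; rewrite fc//.
have [_ ->] := ps_recl sc r0 (ltW zr).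
rewrite opprD addrA subrr sub0r nrmN nrmM.
apply: (@le_lt_trans _ _ (nrm z * (`|B| + 1))).
  apply: ler_wpM2l; first exact: nrm_ge0.
  by apply: le_trans (hB z (ltW zr)) _; apply: le_trans (ler_norm _) _; rewrite lerDl.
by rewrite -ltr_pdivlMr.
Qed.

End CotExpansion.

Section HerglotzSum.
Context {R : realType}.
Local Notation C := (Cplx R).

Lemma pow2_ge (x : R) : exists N, forall k, (N <= k)%N -> x <= (2 ^ k)%:R.
Proof.
pose N := `|Num.ceil x|%N; exists N => k Nk.
apply: (@le_trans _ _ N%:R); last first.
  by rewrite ler_nat (leq_trans Nk)// ltnW// ltn_expl.
apply: le_trans (ceil_ge x) _; rewrite /N -[leRHS]/((`|Num.ceil x|%N : int)%:~R) ler_int.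
by move: (Num.ceil x) => c; lia.
Qed.

(* Iterating [R4_double] writes [R4f z] as 16^-k times the sum of the
   R4f ((z + n) / 2^k) over n modulo 2^k; its terms tend to (z + n)^-4. *)
Lemma herglotz (z : C) : ce z != 1 -> summ (fun n : int => ((z + n%:~R) ^+ 4)^-1) ->
  tot (fun n : int => ((z + n%:~R) ^+ 4)^-1) = R4f z.
Proof.
move=> z1 sz; have [B hB] := R4_bound (R := R).
have zn (n : int) : z + n%:~R != 0.
  apply: contraNneq z1 => /eqP; rewrite addr_eq0 => /eqP ->.
  by rewrite ceN ce_int invr1.
pose W k : C := (2 ^ k.+1)%:R.
have W0 k : W k != 0 by rewrite pnatr_eq0 expn_eq0.
have nW k : nrm (W k) = (2 ^ k.+1)%:R by rewrite nrm_nat.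
pose zeta k (n : int) := (z + n%:~R) / W k.
pose h k (n : int) : C := if (- (2 ^ k)%:Z <= n) && (n < (2 ^ k)%:Z)
  then (W k ^+ 4)^-1 * R4f (zeta k n) else 0.
have hE k n : (W k ^+ 4)^-1 * R4f (zeta k n) = ((z + n%:~R) ^+ 4)^-1 * (zeta k n ^+ 4 * R4f (zeta k n)).
  rewrite /zeta; move: (R4f _) => rr; have := zn n; move: (z + _) => y y0.
  by field; rewrite y0 W0.
have toth k : tot (h k) = R4f z.
  apply: hsE.
  have := @hs_finite R _ (h k) [seq j%:Z - (2 ^ k)%:Z | j <- iota 0 (2 ^ k + 2 ^ k)].
  rewrite big_map map_inj_uniq ?iota_uniq; last by move=> i j; lia.
  rewrite -[(2 ^ k + 2 ^ k)%N]subn0 -/(index_iota 0 (2 ^ k + 2 ^ k)) big_mkord.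
  rewrite (eq_bigr (fun j : 'I_(2 ^ k + 2 ^ k) => (W k ^+ 4)^-1 * R4f ((z + (j%:R - (2 ^ k)%:R)) / (2 ^ k.+1)%:R))); last first.
    move=> j _; rewrite /h ifT; last by have := ltn_ord j; lia.
    by rewrite /zeta intrB.
  rewrite -mulr_sumr R4f_center//.
  have -> : (W k ^+ 4)^-1 * (16 ^+ k.+1 * R4f z) = R4f z.
    have -> : W k ^+ 4 = 16 ^+ k.+1.
      rewrite /W natrX exprAC; congr (_ ^+ _); rewrite -[2%:R]/(2 : C); ring.
    by rewrite mulKf// expf_neq0// pnatr_eq0.
  apply => // n /mapP hn; rewrite /h ifF//; apply/negP => /andP[h1 h2].
  apply: hn; exists (absz (n + (2 ^ k)%:Z)%R); last lia.
  by rewrite mem_index_iota; lia.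
have T : tot (h k) @[k --> \oo] --> tot (fun n : int => ((z + n%:~R) ^+ 4)^-1).
  apply: (tannery (g := fun n => (`|B| + 1) * nrm ((z + n%:~R) ^+ 4)^-1)).
  - by move=> n; rewrite mulr_ge0 ?nrm_ge0// addr_ge0.
  - by apply: bsumZ => //; rewrite addr_ge0.
  - have [N hN] := pow2_ge (2 * nrm z).
    exists N => // k /= Nk n; rewrite /h; case: ifP => [/andP[n1 n2]|_]; last first.
      by rewrite nrm0 mulr_ge0 ?nrm_ge0// addr_ge0.
    rewrite hE nrmM mulrC; apply: ler_wpM2r; first exact: nrm_ge0.
    apply: (@le_trans _ _ B); last by rewrite (le_trans (ler_norm _))// lerDl.
    have w0 : 0 < (2 ^ k.+1)%:R :> R by rewrite ltr0n expn_gt0.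
    have wE : (2 ^ k.+1)%:R = 2 * (2 ^ k)%:R :> R by rewrite expnS natrM.
    have zE : zeta k n = (z + toC n%:~R) * toC ((2 ^ k.+1)%:R)^-1.
      by rewrite /zeta /W toC_int toCV toC_nat.
    have n3 : `|n%:~R| <= (2 ^ k)%:R :> R.
      rewrite -intr_norm -[leRHS]/(((2 ^ k)%N : int)%:~R) ler_int; lia.
    have zk := hN k Nk.
    apply: hB; rewrite zE ?ReCM ?ImCM ?ReCD ?ImCD /= ?mulr0 ?subr0 ?add0r ?addr0.
      rewrite normrM normfV (ger0_norm (ltW w0)) ler_pdivrMr//.
      apply: le_trans (ler_normD _ _) _; have := Re_nrm z; rewrite /ReC wE; lra.
    rewrite normrM normfV (ger0_norm (ltW w0)) ler_pdivrMr//.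
    have := Im_nrm z; rewrite /ImC wE; lra.
  - move=> n; rewrite ler_peMl ?nrm_ge0// lerDr; exact: normr_ge0.
  - move=> n.
    have L : zeta k n ^+ 4 * R4f (zeta k n) @[k --> \oo] --> (1 : C).
      apply/cvgC_P => e e0; have [s s0 hs] := has_ps_cvg (has_ps_R4f (R := R)) e0.
      have [N hN] := pow2_ge (nrm (z + n%:~R) / s).
      exists N => // k /= Nk.
      have z0 : zeta k n != 0 by rewrite mulf_neq0 ?invr_neq0.
      have := hs _ z0; rewrite /rcoef/= mulr0 subr0; apply.
      rewrite /zeta nrmM nrmV nW ltr_pdivrMr ?ltr0n ?expn_gt0// mulrC -ltr_pdivrMr//.
      by apply: le_lt_trans (hN k Nk) _; rewrite ltr_nat ltn_exp2l.
    have L2 : ((z + n%:~R) ^+ 4)^-1 * (zeta k n ^+ 4 * R4f (zeta k n)) @[k --> \oo] --> ((z + n%:~R) ^+ 4)^-1 * 1.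
      exact: cvgCZ L.
    rewrite mulr1 in L2; move: L2; apply: cvg_trans.
    apply: near_eq_cvg; exists (absz n).+1 => // k /= nk.
    rewrite /h ifT ?hE//.
    have := ltn_expl k (isT : (1 < 2)%N); lia.
apply: cvgC_uniq T _; suff -> : (fun k => tot (h k)) = (fun=> R4f z) by exact: cvg_cst.
by apply/funext.
Qed.

End HerglotzSum.

(** * The lattice sum with exponent 4 and Eisenstein series *)

Section Lattice.
Context {R : realType}.
Local Notation C := (Cplx R).

Lemma bsum_inv2 : bsum (fun n : int => ((1 + `|n%:~R : R|) ^+ 2)^-1).
Proof.
have h : bsum (fun n : nat => ((1 + n%:R : R) ^+ 2)^-1).
  apply: bsum_nat => [i|]; first by rewrite invr_ge0 sqr_ge0.
  (* The majorant 2 - 2/(1 + n) grows at each step by at least the new term, which makes the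
     induction close. *)
  exists 2 => n; suff : \sum_(i < n) ((1 + i%:R : R) ^+ 2)^-1 <= 2 - 2 / (1 + n%:R).
    have : 0 <= 2 / (1 + n%:R : R) by rewrite divr_ge0// addr_ge0.
    lra.
  elim: n => [|n IH]; first by rewrite big_ord0 addr0 divr1 subrr.
  rewrite big_ord_recr/= -natr1; have n0 : 0 <= n%:R :> R by [].
  apply: le_trans (lerD IH (lexx _)) _; move: n0; set x := n%:R => x0.
  rewrite -subr_ge0 [leRHS](_ : _ = x / ((1 + x) ^+ 2 * (2 + x))).
    by rewrite divr_ge0// mulr_ge0 ?sqr_ge0// addr_ge0.
  by field; lra.
apply: bsum_int => [i||]; first by rewrite invr_ge0 sqr_ge0.
- by apply: bsum_le h => n; rewrite normr_nat.
- by apply: bsum_le h => n; rewrite mulrNz normrN normr_nat.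
Qed.

Lemma pos_min (T : eqType) (f : T -> R) (s : seq T) : (forall i, 0 < f i) ->
  exists2 d, 0 < d & forall i, i \in s -> d <= f i.
Proof.
move=> f0; elim: s => [|x s [d d0 hd]]; first by exists 1.
exists (Num.min d (f x)); first by rewrite lt_min d0 f0.
move=> i; rewrite inE => /orP[/eqP ->|/hd di]; first by rewrite ge_min lexx orbT.
by rewrite ge_min di.
Qed.

Lemma tot_int (f : int -> C) : summ f ->
  tot f = f 0 + (tot (fun n : nat => f n.+1%:Z) + tot (fun n : nat => f (- n.+1%:Z))).
Proof.
move=> sf.
have s1 : summ (fun n : nat => f n%:Z) by apply: (summ_inj (f := f) (phi := fun n : nat => n%:Z)) sf => ? ? [].
have s2 : summ (fun n : nat => f (Negz n)) by apply: (summ_inj (f := f) (phi := Negz)) sf => ? ? [].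
rewrite -zsum_tot// /zsum (lim_C (hs_series (hs_tot s1))) (lim_C (hs_series (hs_tot s2))).
by rewrite tot_recl// -addrA; congr (_ + (_ + _)).
Qed.

(** Summation by parts: multiplication by 1 - x replaces the coefficients by their differences. *)
Lemma tot_diff (f : nat -> C) (x : C) : summ (fun n => f n * x ^+ n) ->
  (1 - x) * tot (fun n => f n * x ^+ n) = f 0%N + x * tot (fun n => (f n.+1 - f n) * x ^+ n).
Proof.
move=> sf; have s1 := summ_inj succn_inj sf; have s2 := summZ x sf.
have E : x * tot (fun n => (f n.+1 - f n) * x ^+ n) =
    tot (fun n => f n.+1 * x ^+ n.+1) - x * tot (fun n => f n * x ^+ n).
  have [->|x0] := eqVneq x 0.
    rewrite !mul0r (eq_tot (g := fun=> 0)); first by rewrite (hsE (hs0 _)) subr0.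
    by move=> n; rewrite exprS mul0r mulr0.
  have -> : tot (fun n => f n.+1 * x ^+ n.+1) - x * tot (fun n => f n * x ^+ n) =
      tot (fun n => f n.+1 * x ^+ n.+1 + -1 * (x * (f n * x ^+ n))).
    rewrite (totD s1 (summZ (-1) s2)) (totZ (-1) s2) (totZ x sf); ring.
  rewrite -totZ; first by apply: eq_tot => n; rewrite exprS; ring.
  have := summZ x^-1 (summD s1 (summZ (-1) s2)); apply: eq_summ => n /=.
  by rewrite exprS; field.
have h := tot_recl sf; rewrite expr0 mulr1 in h.
by rewrite E mulrBl mul1r {1}h; ring.
Qed.

(** Repeated differences take (n + 1)^3 to 3n^2 + 9n + 7, to 6n + 12, to 6 and to 0, and [tot_diff]
    is then solved backwards. *)
Lemma tot_cubes (x : C) : nrm x < 1 ->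
  tot (fun n : nat => n.+1%:R ^+ 3 * x ^+ n.+1) = x * (x ^+ 2 + 4 * x + 1) / (1 - x) ^+ 4.
Proof.
move=> x1; have x01 : 1 - x != 0 by have [] := geo_frac x1.
have x10 : 0 <= nrm x < 1 by rewrite nrm_ge0.
have sm m : summ (fun n : nat => n%:R ^+ m * x ^+ n).
  by apply: summ_le (bsum_poly m x10) => n; rewrite nrmM !nrmX nrm_nat.
have s0 : summ (fun n : nat => 6 * x ^+ n).
  by apply: summZ; apply: eq_summ (sm 0) => n; rewrite expr0 mul1r.
have s1 : summ (fun n : nat => (6 * n%:R + 12) * x ^+ n).
  apply: eq_summ (summD (summZ 6 (sm 1)) (summZ 2 s0)) => n; ring.
have s2 : summ (fun n : nat => (3 * n%:R ^+ 2 + 9 * n%:R + 7) * x ^+ n).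
  apply: eq_summ (summD (summZ 3 (sm 2)) (summD (summZ 9 (sm 1)) (summZ (7 / 6) s0))) => n; by field.
have s3 : summ (fun n : nat => (n%:R + 1) ^+ 3 * x ^+ n).
  apply: eq_summ (summD (sm 3) (summD (summZ 3 (sm 2)) (summD (summZ 3 (sm 1)) (summZ 6^-1 s0)))) => n; by field.
have e3 := tot_diff s3; have e2 := tot_diff s2; have e1 := tot_diff s1; have e0 := tot_diff s0.
rewrite (eq_tot (f := fun n => (6 - 6) * x ^+ n) (g := fun=> 0)) in e0; last by move=> n; rewrite subrr mul0r.
rewrite (hsE (hs0 _)) mulr0 addr0 in e0.
rewrite (eq_tot (f := fun n => (6 * n.+1%:R + 12 - (6 * n%:R + 12)) * x ^+ n) (g := fun n => 6 * x ^+ n)) in e1; last by move=> n; rewrite -natr1; ring.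
rewrite (eq_tot (f := fun n => (3 * n.+1%:R ^+ 2 + 9 * n.+1%:R + 7 - (3 * n%:R ^+ 2 + 9 * n%:R + 7)) * x ^+ n) (g := fun n => (6 * n%:R + 12) * x ^+ n)) in e2; last by move=> n; rewrite -natr1; ring.
rewrite (eq_tot (f := fun n => ((n.+1%:R + 1) ^+ 3 - (n%:R + 1) ^+ 3) * x ^+ n) (g := fun n => (3 * n%:R ^+ 2 + 9 * n%:R + 7) * x ^+ n)) in e3; last by move=> n; rewrite -natr1; ring.
have -> : tot (fun n : nat => n.+1%:R ^+ 3 * x ^+ n.+1) = x * tot (fun n : nat => (n%:R + 1) ^+ 3 * x ^+ n).
  by rewrite -totZ//; apply: eq_tot => n; rewrite [x ^+ n.+1]exprS -natr1; ring.
move: e0 e1 e2 e3; set t0 := tot _; set t1 := tot _; set t2 := tot _; set t3 := tot _ => e0 e1 e2 e3.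
have -> : t3 = (1 + x * ((7 + x * ((12 + x * (6 / (1 - x))) / (1 - x))) / (1 - x))) / (1 - x).
  have -> : t3 = (1 - x) * t3 / (1 - x) by rewrite mulrC mulKf.
  rewrite e3; have -> : t2 = (1 - x) * t2 / (1 - x) by rewrite mulrC mulKf.
  rewrite e2; have -> : t1 = (1 - x) * t1 / (1 - x) by rewrite mulrC mulKf.
  rewrite e1; have -> : t0 = (1 - x) * t0 / (1 - x) by rewrite mulrC mulKf.
  rewrite e0; field; exact: x01.
by field; exact: x01.
Qed.

Lemma R4_small (x : C) : nrm x < 1 ->
  R4 x = twopii R ^+ 4 / 6 * tot (fun n : nat => n.+1%:R ^+ 3 * x ^+ n.+1).
Proof.
move=> x1; have x01 : 1 - x != 0 by have [] := geo_frac x1.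
rewrite tot_cubes// /R4; congr (_ * _); congr (_ / _).
by ring.
Qed.

Lemma R4_inv (x : C) : x != 0 -> x != 1 -> R4 x^-1 = R4 x.
Proof.
move=> x0 x1; have x01 : x - 1 != 0 by rewrite subr_eq0.
rewrite /R4; have -> : x^-1 - 1 = - ((x - 1) / x) :> C by field.
by field; rewrite x0 x01.
Qed.

Section FixTau.
Variable tau : C.
Hypothesis tau_uhp : uhp tau.
Local Notation q := (ce tau).

(** For w = m tau + n the imaginary part controls m, and then n = w - m tau is controlled as
    well. *)
Lemma lattice_lower : exists2 c : R, 0 < c & forall m n : int,
  c * (`|m%:~R| + `|n%:~R|) <= nrm (m%:~R * tau + n%:~R).
Proof.
have y0 : 0 < ImC tau := tau_uhp.
pose K := (ImC tau)^-1 + (1 + nrm tau / ImC tau).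
have K0 : 0 < K.
  apply: addr_gt0; first by rewrite invr_gt0.
  by apply: ltr_pwDl => //; apply: divr_ge0; [exact: nrm_ge0|exact: ltW].
exists K^-1; first by rewrite invr_gt0.
move=> m n; set w := m%:~R * tau + n%:~R; rewrite mulrC ler_pdivrMr//.
have h1 : `|m%:~R| <= nrm w / ImC tau.
  rewrite ler_pdivlMr// -(gtr0_norm y0) -normrM; apply: le_trans (Im_nrm w).
  by rewrite /w -!toC_int ImCD ImCM /= mul0r !addr0.
have h2 : `|n%:~R| <= nrm w + `|m%:~R| * nrm tau.
  rewrite -nrm_int -[X in _ + X * _]nrm_int -nrmM.
  have -> : n%:~R = w - m%:~R * tau by rewrite /w addrAC subrr add0r.
  exact: nrmB.
have h3 : `|m%:~R| * nrm tau <= nrm w / ImC tau * nrm tau by apply: ler_wpM2r h1; exact: nrm_ge0.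
rewrite /K; apply: le_trans (lerD h1 (le_trans h2 (lerD (lexx _) h3))) _.
rewrite le_eqVlt; apply/orP; left; apply/eqP; field; lra.
Qed.

(** When |m| + |n| > M the lattice point has modulus at least 2 |z|, and [lattice_lower] applies;
    the finitely many remaining points have a positive minimal distance from -z. *)
Lemma lattice_lower_off z : off_lattice tau z -> exists2 d : R, 0 < d & forall m n : int,
  d * (1 + (`|m%:~R| + `|n%:~R|)) <= nrm (z + (m%:~R * tau + n%:~R)).
Proof.
move=> oz; have [c c0 hc] := lattice_lower.
have [L hL] := pow2_ge (2 * nrm z / c).
pose M := (2 ^ L)%N; have {hL}hL : 2 * nrm z / c <= M%:R by exact: hL.
have f0 (p : int * int) : 0 < nrm (z + (p.1%:~R * tau + p.2%:~R)).
  rewrite nrm_gt0; have := oz (- p.2) (- p.1); rewrite !mulrNz -subr_eq0.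
  by congr (_ != 0); ring.
pose rng := [seq (i%:Z - M%:Z) | i <- iota 0 (M + M).+1].
have rngP (m : int) : `|m| <= M%:Z -> m \in rng.
  move=> mM; apply/mapP; exists (absz (m + M%:Z)%R); last lia.
  by rewrite mem_iota; lia.
have [d d0 hd] := pos_min [seq (i, j) | i <- rng, j <- rng] f0.
exists (Num.min (c / 4) (d / (1 + (M%:R + M%:R)))).
  by rewrite lt_min !divr_gt0// ltr_pwDl// addr_ge0.
move=> m n; set A := `|_| + _.
have A0 : 0 <= A by rewrite addr_ge0.
case: (lerP A M%:R) => AM.
  have hm : `|m%:~R : R| <= M%:R by apply: le_trans AM; rewrite lerDl.
  have hn : `|n%:~R : R| <= M%:R by apply: le_trans AM; rewrite lerDr.
  have mn : (m, n) \in [seq (i, j) | i <- rng, j <- rng].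
    apply/allpairsP; have hm' : m \in rng by apply: rngP; rewrite -intr_norm -[leRHS]/((M : int)%:~R) ler_int in hm.
    have hn' : n \in rng by apply: rngP; rewrite -intr_norm -[leRHS]/((M : int)%:~R) ler_int in hn.
    by exists (m, n).
  apply: (@le_trans _ _ d); last exact: (hd (m, n) mn).
  apply: (@le_trans _ _ (d / (1 + (M%:R + M%:R)) * (1 + (M%:R + M%:R)))).
    apply: ler_pM; rewrite ?ge_min ?lexx ?orbT//; last by rewrite lerD2l lerD.
      by rewrite le_min !divr_ge0// ?ltW// addr_ge0// addr_ge0.
    by rewrite addr_ge0.
  by rewrite divfK// gt_eqF// ltr_pwDl// addr_ge0.
have M1 : 1 <= M%:R :> R by rewrite ler1n expn_gt0.
have h1 := hc m n; rewrite -/A in h1.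
have h2 : nrm (m%:~R * tau + n%:~R) <= nrm (z + (m%:~R * tau + n%:~R)) + nrm z.
  by have := nrmB (z + (m%:~R * tau + n%:~R)) z; rewrite addrAC subrr add0r.
have h3 : 2 * nrm z <= c * A.
  by move: hL; rewrite ler_pdivrMr// => hL; apply: le_trans hL _; rewrite mulrC ler_pM2l// ltW.
have h4 : c <= c * A by rewrite ler_pMr//; lra.
apply: (@le_trans _ _ (c / 4 * (1 + A))); last lra.
by apply: ler_wpM2r; [rewrite addr_ge0|rewrite ge_min lexx].
Qed.

Definition Kterm (z : C) (p : int * int) : C := ((z + (p.1%:~R * tau + p.2%:~R)) ^+ 4)^-1.

(** Since (1 + x + y)^2 >= (1 + x)(1 + y) for x, y >= 0, a fourth power suffices to dominate the
    family by a product of two summable ones. *)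
Lemma summ_Kterm z : off_lattice tau z -> summ (Kterm z).
Proof.
move=> oz; have [d d0 hd] := lattice_lower_off oz.
apply: (summ_le (g := fun p : int * int => (d ^+ 4)^-1 * (((1 + `|p.1%:~R|) ^+ 2)^-1 * ((1 + `|p.2%:~R|) ^+ 2)^-1))).
  move=> [m n] /=; rewrite nrmV nrmX -!invfM lef_pV2 ?posrE; first last.
  - have x0 : 0 < (1 + `|m%:~R|) ^+ 2 :> R by rewrite exprn_gt0// ltr_pwDl.
    have y0 : 0 < (1 + `|n%:~R|) ^+ 2 :> R by rewrite exprn_gt0// ltr_pwDl.
    by rewrite mulr_gt0 ?exprn_gt0// mulr_gt0.
  - apply: exprn_gt0; apply: lt_le_trans (hd m n).
    by rewrite mulr_gt0// ltr_pwDl// addr_ge0.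
  have h := hd m n; apply: (@le_trans _ _ ((d * (1 + (`|m%:~R| + `|n%:~R|))) ^+ 4)).
    rewrite exprMn; apply: ler_wpM2l; first by rewrite exprn_ge0// ltW.
    have x0 := normr_ge0 (m%:~R : R); have y0 := normr_ge0 (n%:~R : R).
    move: x0 y0; set x := `|_|; set y := `|_| => x0 y0.
    rewrite -exprMn (_ : 4 = 2 * 2)%N// exprM lerXn2r ?nnegrE ?sqr_ge0 ?mulr_ge0 ?addr_ge0//.
    nra.
  rewrite lerXn2r ?nnegrE ?nrm_ge0// mulr_ge0 ?(ltW d0)// !addr_ge0//.
apply: bsumZ; first by rewrite invr_ge0 exprn_ge0// ltW.
apply: (bsum_prod (g := fun m : int => ((1 + `|m%:~R|) ^+ 2)^-1) (h := fun m : int => ((1 + `|m%:~R|) ^+ 2)^-1)).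
- by move=> i; rewrite invr_ge0 sqr_ge0.
- by move=> i; rewrite invr_ge0 sqr_ge0.
- exact: bsum_inv2.
- exact: bsum_inv2.
Qed.

Definition KK z := tot (Kterm z).

Lemma off_small z : z != 0 -> nrm z < ImC tau -> nrm z < 1 -> off_lattice tau z.
Proof.
have y0 : 0 < ImC tau := tau_uhp.
move=> z0 zt z1 m n; apply/eqP => zE.
have hI : ImC z = n%:~R * ImC tau.
  by rewrite zE -!toC_int ImCD ImCM /= mul0r addr0 add0r.
have n0 : n = 0.
  have := le_lt_trans (Im_nrm z) zt; rewrite hI normrM (gtr0_norm y0) gtr_pMl// -intr_norm -[1]/(1%:~R) ltr_int.
  lia.
move: z0 z1; rewrite zE n0 mul0r addr0 nrm_int -intr_norm -[1 in X in _ -> X]/(1%:~R) ltr_int => m0 m1.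
have m00 : m = 0 by lia.
by rewrite m00 eqxx in m0.
Qed.

(** Each row is summed by [herglotz]. The row 0 stays as [R4f z]; a row m > 0 is expanded in powers
    of q^m e(z), and the row -m in powers of q^m e(-z) by the symmetry [R4_inv]. *)
Lemma K_exp z : z != 0 -> nrm z < ImC tau -> nrm z < 1 ->
  KK z = R4f z + twopii R ^+ 4 / 6 * (Wf tau 3 z + Wf tau 3 (- z)).
Proof.
move=> z0 zt z1; have oz := off_small z0 zt z1; have sK := summ_Kterm oz.
have zt' : nrm (- z) < ImC tau by rewrite nrmN.
have row (m : int) : tot (fun n => Kterm z (m, n)) = R4f (z + m%:~R * tau).
  rewrite -herglotz; first by apply: eq_tot => n; rewrite /Kterm/= addrA.
    apply/eqP => /ce_eq1[n hn]; have /eqP := oz n (- m); apply.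
    by rewrite mulrNz -hn; ring.
  have ij : injective (fun n : int => (m, n)) by move=> ? ? [].
  by apply: eq_summ (summ_inj ij sK) => n /=; rewrite /Kterm/= addrA.
have [s1 _] := fubini sK.
rewrite /KK -(tot_fubini sK) tot_int//; congr (_ + _); first by rewrite row mul0r addr0.
have lam (x : C) i : nrm x < ImC tau -> nrm (q ^+ i.+1 * ce x) < 1 /\
   R4 (q ^+ i.+1 * ce x) = twopii R ^+ 4 / 6 * tot (fun n => Wterm tau 3 x (i, n)).
  move=> xt; have x1 : nrm (q ^+ i.+1 * ce x) < 1.
    have /andP[q0 q1] := nrm_q tau_uhp.
    rewrite nrmM nrmX; apply: le_lt_trans (W_bound xt).
    apply: ler_pM; rewrite ?exprn_ge0 ?nrm_ge0//.
      by rewrite exprS ler_piMr// exprn_ile1// ltW.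
    rewrite nrm_ce ler_expR -mulrN; apply: ler_wpM2l; first by rewrite mulr_ge0// pi_ge0.
    by apply: le_trans (Im_nrm x); rewrite -normrN ler_norm.
  split => //; rewrite R4_small//; congr (_ * _); apply: eq_tot => n.
  by rewrite /Wterm/= ceMn exprMn -exprM mulrCA.
rewrite mulrDr; congr (_ + _).
  have [sW _] := fubini (summ_Wterm tau_uhp 3 zt).
  rewrite /Wf -(tot_fubini (summ_Wterm tau_uhp 3 zt)) -totZ//; apply: eq_tot => i.
  have [_ <-] := lam z i zt; rewrite row /R4f ceD ce_tauX mulrC.
  by rewrite -[_%:~R]/(i.+1%:R).
have [sW _] := fubini (summ_Wterm tau_uhp 3 zt').
rewrite /Wf -(tot_fubini (summ_Wterm tau_uhp 3 zt')) -totZ//; apply: eq_tot => i.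
have [x1 <-] := lam (- z) i zt'; rewrite row /R4f -R4_inv.
- by congr R4; rewrite ce_tauX -ceD -ceN; congr ce; rewrite mulrNz -[_%:~R]/(i.+1%:R); ring.
- exact: ce_neq0.
- apply/eqP => /ce_eq1[n hn]; have /eqP := oz n i.+1%:Z; apply.
  by rewrite -hn mulrNz -[_%:~R]/(i.+1%:R); ring.
Qed.

Definition kcoef k : C := rcoef k + twopii R ^+ 4 / 6 *
  shift_coef (shift_coef (shift_coef (shift_coef
    (fun k => (1 + (-1) ^+ k) * (twopii R ^+ k / k`!%:R * Ss tau (k + 3)))))) k.

Lemma has_ps_K : has_ps (fun z => z ^+ 4 * KK z) kcoef.
Proof.
have n1 : (-1 : C) != 0 by rewrite oppr_eq0 oner_neq0.
have h1 := W_ps tau_uhp 3; have h2 := has_ps_scale h1 n1.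
have h3 := has_psD h1 h2.
have h4 := has_psZ (twopii R ^+ 4 / 6) (has_ps_shift (has_ps_shift (has_ps_shift (has_ps_shift h3)))).
apply: eq_has_ps (has_ps_eq (has_psD (has_ps_R4f (R := R)) h4) _) _; last first.
  move=> k; rewrite /kcoef; congr (_ + _ * _).
  by case: k => [|[|[|[|k]]]]//=; ring.
apply/near0P; exists (Num.min (ImC tau) 1); first by rewrite lt_min ltr01 andbT; exact: tau_uhp.
move=> z z0; rewrite lt_min => /andP[zt z1].
by rewrite K_exp// mulN1r; ring.
Qed.

(** [rcoef] contributes the Bernoulli number and the Lambert part the divisor sum, in the same ratio
    as in [Gseries]. The degree is at least 4 because of the factor z^4. *)
Lemma kcoef_G j : (1 < j)%N ->
  kcoef (2 * j) = twopii R ^+ (2 * j) / (3 * (2 * j - 4)`!%:R) * Gseries j tau.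
Proof.
move=> j1; have j0 : (0 < j)%N by lia.
rewrite Gseries_Ss// bernoulliE.
have [m mE] : exists m, (2 * j = m.+4)%N by exists (2 * j - 4)%N; lia.
have om : ~~ odd m by have := congr1 odd mE; rewrite mul2n odd_double/= !negbK; case: (odd m).
have -> : (4 * j = 2 * m.+4)%N by lia.
have e4 : (2 * j - 4 = m)%N by lia.
have e1 : (2 * j - 1 = m.+3)%N by lia.
rewrite e4 e1 mE /kcoef /rcoef/=.
rewrite -signr_odd (negPf om) expr0 addn3 !factS !natrM !exprS.
have f0 : m`!%:R != 0 :> C by exact: fact_neq0.
have a0 i : m.+1%:R + i%:R != 0 :> C by rewrite -natrD pnatr_eq0 addSn.
have := a0 0%N; have := a0 1%N; have := a0 2%N; have := a0 3%N.
have -> : m.+4%:R = m.+1%:R + 3 :> C by rewrite -[3]/(3%:R) -natrD addn3.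
have -> : m.+3%:R = m.+1%:R + 2 :> C by rewrite -[2]/(2%:R) -natrD addn2.
have -> : m.+2%:R = m.+1%:R + 1 :> C by rewrite -[1 in RHS]/(1%:R) -natrD addn1.
rewrite addr0; move: f0; move: (m`!%:R) (m.+1%:R) (bern _) (Ss _ _) (twopii R ^+ m) (twopii R) => f a b s t I f0 h3 h2 h1 h0.
by field; rewrite f0 h3.
Qed.

End FixTau.
End Lattice.

(** * Modular transformation of the theta function *)

Section Cauchy.
Context {R : realType}.
Local Notation C := (Cplx R).
Implicit Types c d e u v l : nat -> C.

(** In each degree the Cauchy product is that of truncated polynomials, from which it inherits
    commutativity and associativity. *)
Lemma cauchy_poly c d N k : (k < N)%N ->
  cauchy c d k = (\poly_(i < N) c i * \poly_(i < N) d i)`_k.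
Proof.
move=> kN; rewrite coefM; apply: eq_bigr => i _; rewrite !coef_poly.
by rewrite (leq_ltn_trans _ kN) ?leq_ord// (leq_ltn_trans _ kN)// leq_subr.
Qed.

Lemma cauchyC c d : cauchy c d = cauchy d c.
Proof. by apply/funext => k; rewrite !(@cauchy_poly _ _ k.+1)// mulrC. Qed.

Lemma cauchyA c d e : cauchy c (cauchy d e) = cauchy (cauchy c d) e.
Proof.
apply/funext => k; pose P (u : nat -> C) := \poly_(i < k.+1) u i.
have h u v (i : 'I_k.+1) : cauchy u v i = (P u * P v)`_i by rewrite (@cauchy_poly _ _ k.+1).
transitivity ((P c * (P d * P e))`_k); last rewrite mulrA.
  rewrite coefM; apply: eq_bigr => i _; rewrite coef_poly ltn_ord; congr (_ * _).
  by rewrite (@cauchy_poly _ _ k.+1)// ltnS leq_subr.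
rewrite coefM; apply: eq_bigr => i _; rewrite -h; congr (_ * _).
by rewrite coef_poly ltnS leq_subr.
Qed.

Lemma cauchyDr c d e : cauchy c (fun k => d k + e k) = fun k => cauchy c d k + cauchy c e k.
Proof. by apply/funext => k; rewrite -big_split; apply: eq_bigr => i _; rewrite mulrDr. Qed.

Lemma cauchy_scale c d a k :
  cauchy (fun k => c k * a ^+ k) (fun k => d k * a ^+ k) k = cauchy c d k * a ^+ k.
Proof.
rewrite /cauchy mulr_suml; apply: eq_bigr => i _.
by rewrite mulrACA -exprD subnKC ?leq_ord.
Qed.

Lemma cauchy_deriv c d k :
  k%:R * cauchy c d k = cauchy (fun k => k%:R * c k) d k + cauchy c (fun k => k%:R * d k) k.
Proof.
rewrite /cauchy mulr_sumr -big_split; apply: eq_bigr => i _ /=.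
have -> : k%:R = i%:R + (k - i)%:R :> C by rewrite -natrD subnKC ?leq_ord.
ring.
Qed.

(* The equation z u' = u l has a one-dimensional space of solutions when l_0 = 1. *)
Lemma euler_uniq u v l : l 0%N = 1 ->
  (forall k, k%:R * u k = cauchy u l k) -> (forall k, k%:R * v k = cauchy v l k) ->
  forall k, v 1%N * u k = u 1%N * v k.
Proof.
move=> l0 hu hv; pose w k := v 1%N * u k - u 1%N * v k.
have hw k : k%:R * w k = cauchy w l k.
  rewrite /w mulrBr mulrCA hu mulrCA [X in _ - _ * X]hv /cauchy !mulr_sumr -sumrB.
  by apply: eq_bigr => i _; ring.
have w1 : w 1%N = 0 by rewrite /w mulrC subrr.
suff w0 k : w k = 0 by move=> k; apply/eqP; rewrite -subr_eq0; apply/eqP; exact: w0.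
elim/ltn_ind: k => k IH; have := hw k.
rewrite /cauchy big_ord_recr big1 => [|i _]; last by rewrite /= IH ?mul0r.
rewrite /= add0r subnn l0 mulr1 => /eqP; case: k IH => [|[|k]] IH //.
  by rewrite mul0r eq_sym => /eqP.
rewrite -subr_eq0 -[X in _ - X]mul1r -mulrBl mulf_eq0 -[1]/(1%:R) -natrB//.
by rewrite pnatr_eq0 => /eqP.
Qed.

(* The coefficients of exp (a z ^+ 2). *)
Definition gauss (a : C) k : C := if odd k then 0 else a ^+ k./2 / (k./2)`!%:R.

(** The equation z u' = 2 a z^2 u of exp(a z^2), on coefficients. *)
Lemma gauss_ode a k : k%:R * gauss a k = cauchy (gauss a) (fun k => (k == 2%N)%:R * (2 * a)) k.
Proof.
case: k => [|[|k]].
- by rewrite /cauchy big_ord_recr big_ord0/= add0r mul0r mul0r mulr0.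
- by rewrite /cauchy !big_ord_recr big_ord0/= /gauss/= !mul0r !mulr0 !addr0.
rewrite /cauchy (bigD1 (inord k)) //= inordK; last by rewrite ltnS leqW.
rewrite big1 => [|i ik]; last first.
  have : (i : nat) != k by apply: contra ik => /eqP e; apply/eqP/val_inj; rewrite /= e inordK// ltnS leqW.
  move=> ik'; have -> : ((k.+2 - i)%N == 2%N) = false by apply/eqP; have := ltn_ord i; lia.
  by rewrite mul0r mulr0.
have -> : (k.+2 - k = 2)%N by lia.
rewrite eqxx addr0 /gauss/= negbK; case: ifP => ok; first by rewrite mulr0 mul0r.
rewrite mul1r exprS factS natrM; have f0 := @fact_neq0 R k./2.
have -> : k.+2%:R = 2 * (k./2).+1%:R :> C.
  by rewrite -natrM; congr (_%:R); have := odd_double_half k; rewrite ok; lia.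
have s0 : (k./2).+1%:R != 0 :> C by rewrite pnatr_eq0.
move: f0 s0; move: (_`!%:R) (_.+1%:R) (a ^+ _) => f s p f0 s0.
by field; rewrite f0 s0.
Qed.

Lemma ps_gauss a : (forall r, 0 <= r -> psum (gauss a) r) /\ (forall z, ps (gauss a) z = Cexp (a * z ^+ 2)).
Proof.
have h z : summ (fun k : nat => gauss a k * z ^+ k) /\
    hs (fun k : nat => gauss a k * z ^+ k) (Cexp (a * z ^+ 2)).
  have s : summ (fun i : nat => expc i * (a * z ^+ 2) ^+ i :> C).
    by apply: summ_ps (psum_expc (nrm_ge0 (a * z ^+ 2))) _.
  have [h1 h2] := tot_fiber (fun i : nat => i.*2) s.
  have E k : tot (fun t : nat => (t.*2 == k)%:R * (expc t * (a * z ^+ 2) ^+ t)) = gauss a k * z ^+ k.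
    have := @hs1 R _ (fun t : nat => (t.*2 == k)%:R * (expc t * (a * z ^+ 2) ^+ t)) k./2.
    move=> /(_ _)/hsE ->; last first.
      by move=> i ik; case: eqP => [e|_]; [rewrite -e doubleK eqxx in ik|rewrite mul0r].
    rewrite /gauss; case: ifP => ok.
      by case: eqP => [e|_]; [rewrite -e odd_double in ok|rewrite !mul0r].
    have kE : k./2.*2 = k by have := odd_double_half k; rewrite ok.
    rewrite kE eqxx mul1r exprMn -exprM mul2n kE /expc; ring.
  split; first by apply: eq_summ h1.
  by rewrite Cexp_ps; apply: eq_hs h2.
split=> [r r0|z]; first by have [] := h (toC r).
by apply: hsE; have [] := h z.
Qed.

End Cauchy.

Section Modular.
Context {R : realType}.
Local Notation C := (Cplx R).
Variables (tau : C) (a b c d : int).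
Hypothesis tau_uhp : uhp tau.
Hypothesis det1 : a * d - b * c = 1.
Let J : C := c%:~R * tau + d%:~R.
Let gtau : C := (a%:~R * tau + b%:~R) / J.

Lemma detC : a%:~R * d%:~R - b%:~R * c%:~R = 1 :> C.
Proof. by rewrite -!intrM -intrB det1. Qed.

Lemma jfac_neq0 : J != 0.
Proof.
have y0 : 0 < ImC tau := tau_uhp.
apply/eqP => j0; have := congr1 ImC j0; have := congr1 ReC j0.
rewrite /J -!toC_int ReCD ReCM ImCD ImCM /= !mul0r subr0 !addr0 => h1 /eqP.
rewrite mulf_eq0 (gt_eqF y0) orbF intr_eq0 => /eqP c0; move: h1 det1.
rewrite c0 mul0r add0r => /eqP; rewrite intr_eq0 => /eqP ->; lia.
Qed.
Let J0 := jfac_neq0.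

Lemma gtau_J : gtau * J = a%:~R * tau + b%:~R.
Proof. by rewrite divfK. Qed.

Lemma invJ : J^-1 = a%:~R - c%:~R * gtau.
Proof.
apply: (mulIf J0); rewrite mulVf// mulrBl -mulrA gtau_J -[LHS]detC /J; ring.
Qed.

Lemma gtau_uhp : uhp gtau.
Proof.
have y0 : 0 < ImC tau := tau_uhp.
have n0 : 0 < nrm J ^+ 2 by rewrite exprn_gt0// nrm_gt0.
rewrite /uhp/= -[complex.Im _]/(ImC gtau).
suff : ImC gtau * nrm J ^+ 2 = ImC tau by move=> h; rewrite -(pmulr_lgt0 _ n0) h.
have := gtau_J; move: (gtau) => g hg; have := congr1 ImC hg; have := congr1 ReC hg.
rewrite nrm2E /J -!toC_int !(ReCD, ReCM, ImCD, ImCM) /= !mul0r !subr0 !addr0.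
have hd : a%:~R * d%:~R - b%:~R * c%:~R = 1 :> R by rewrite -!intrM -intrB det1.
move: (ReC g) (ImC g) (ReC tau) (ImC tau) hd.
move: (a%:~R : R) (b%:~R : R) (c%:~R : R) (d%:~R : R) => A B E D x y u v hd h1 h2.
have -> : y * ((E * u + D) ^+ 2 + (E * v) ^+ 2) =
  (E * u + D) * (x * (E * v) + y * (E * u + D)) - E * v * (x * (E * u + D) - y * (E * v)) by ring.
by rewrite h1 h2 -[RHS]mul1r -hd; ring.
Qed.

Lemma off_gtau z : off_lattice tau z -> off_lattice gtau (z / J).
Proof.
move=> oz m n; apply/eqP => h; have /eqP := oz (m * d + n * b) (m * c + n * a); apply.
rewrite -(divfK J0 z) h mulrDl -mulrA gtau_J !intrD !intrM /J; ring.
Qed.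

(** J (z/J + m gtau + n) = z + (m a + n c) tau + (m b + n d), and the unimodular substitution
    permutes Z^2. *)
Lemma KK_mod z : off_lattice tau z -> KK gtau (z / J) = J ^+ 4 * KK tau z.
Proof.
move=> oz; have s := summ_Kterm tau_uhp oz.
have dE : d * a = 1 + b * c by rewrite -det1; ring.
rewrite /KK -(@tot_reindex _ _ _ (Kterm tau z)
  (fun p : int * int => (p.1 * a + p.2 * c, p.1 * b + p.2 * d))
  (fun p : int * int => (p.1 * d - p.2 * c, p.2 * a - p.1 * b))) //.
- rewrite -totZ; last first.
    apply: (@summ_inj _ _ _ (Kterm tau z) (fun p : int * int => (p.1 * a + p.2 * c, p.1 * b + p.2 * d))) => //.
    apply: (can_inj (g := fun p : int * int => (p.1 * d - p.2 * c, p.2 * a - p.1 * b))).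
    by move=> [m n] /=; congr (_, _); rewrite -[RHS]mulr1 -det1; ring.
  apply: eq_tot => -[m n]; rewrite /Kterm /= -[J ^+ 4]invrK -invfM; congr (_^-1).
  rewrite -exprVn -exprMn; congr (_ ^+ 4).
  apply: (mulIf J0); rewrite mulrAC mulVf// mul1r !mulrDl divfK// -mulrA gtau_J !intrD !intrM /J; ring.
- by move=> [m n] /=; congr (_, _); rewrite -[RHS]mulr1 -det1; ring.
- by move=> [m n] /=; congr (_, _); rewrite -[RHS]mulr1 -det1; ring.
Qed.

Lemma kcoef_mod k : kcoef gtau k * J^-1 ^+ k = kcoef tau k.
Proof.
have J1 : J^-1 != 0 by rewrite invr_eq0.
have h1 := has_ps_scale (has_ps_K gtau_uhp) J1.
suff : has_ps (fun z => (J^-1 * z) ^+ 4 * KK gtau (J^-1 * z)) (kcoef tau).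
  by move=> h; have := has_ps_uniq h1 h => /(congr1 (fun f => f k)).
apply: has_ps_eq (has_ps_K tau_uhp) _; apply/near0P.
exists (Num.min (ImC tau) 1); first by rewrite lt_min ltr01 andbT; exact: tau_uhp.
move=> z z0; rewrite lt_min => /andP[zt z1].
rewrite [J^-1 * z]mulrC KK_mod; last exact: off_small.
by rewrite exprMn exprVn; field.
Qed.

Lemma Gseries_mod j : (1 < j)%N -> Gseries j gtau = J ^+ (2 * j) * Gseries j tau.
Proof.
move=> j1; have := kcoef_mod (2 * j); rewrite !kcoef_G//; last exact: gtau_uhp.
have f0 := @fact_neq0 R (2 * j - 4); have I0 : twopii R ^+ (2 * j) != 0 by rewrite expf_neq0// twopii_neq0.
have j0 : J ^+ (2 * j) != 0 by rewrite expf_neq0.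
rewrite exprVn; move: f0 I0 j0; move: (_`!%:R) (twopii R ^+ _) (J ^+ _) (Gseries j gtau) (Gseries j tau).
move=> f I j0 g g' f0 I0 jn0 /(congr1 (fun x => x * (3 * f) / I * j0)) h.
have -> : g = I / (3 * f) * g / j0 * (3 * f) / I * j0 by field; rewrite f0 I0 jn0.
by rewrite h; field; rewrite f0 I0.
Qed.

Lemma lcoef_mod k : k != 2%N -> lcoef gtau k * J^-1 ^+ k = lcoef tau k.
Proof.
move=> k2; have [ok|ek] := boolP (odd k); first by rewrite !lcoef_odd// mul0r.
have [j jE] : exists j, k = (2 * j)%N by exists k./2; have := odd_double_half k; rewrite (negPf ek); lia.
case: j jE => [|[|j]] jE; rewrite {k ek}jE in k2 *.
- by rewrite muln0 !lcoef0 expr0 mulr1.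
- by [].
rewrite (lcoef_even gtau_uhp)// (lcoef_even tau_uhp)// Gseries_mod//.
rewrite exprVn; have j0 : J ^+ (2 * j.+2) != 0 by rewrite expf_neq0.
by move: j0; move: (J ^+ _) => x x0; field; rewrite x0 fact_neq0.
Qed.

(** Half of the defect in degree 2, because a factor exp(delta z^2) adds 2 delta z^2 to z times the
    logarithmic derivative. *)
Let delta : C := (lcoef gtau 2 * J^-1 ^+ 2 - lcoef tau 2) / 2.

Lemma off_ex : exists2 z : C, off_lattice tau z & z != 0.
Proof.
have y0 : 0 < ImC tau := tau_uhp.
have r0 : 0 < Num.min (ImC tau) 1 / 2 by rewrite divr_gt0// lt_min y0 ltr01.
have z0 : toC (Num.min (ImC tau) 1 / 2) != 0 by rewrite -nrm_gt0 nrm_toC gtr0_norm.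
have h : nrm (toC (Num.min (ImC tau) 1 / 2)) < Num.min (ImC tau) 1.
  by rewrite nrm_toC gtr0_norm//; lra.
move: h; rewrite lt_min => /andP[h1 h2].
by exists (toC (Num.min (ImC tau) 1 / 2)) => //; exact: off_small.
Qed.

(** If the first coefficient vanished, the recursion [Th_ode] would make all coefficients vanish,
    against [Th_neq0]. *)
Lemma tc1_neq0 : tc tau 0 1 != 0.
Proof.
apply/eqP => t1; have [z oz z0] := off_ex; have /eqP := Th_neq0 tau_uhp oz; apply.
have t0 k : tc tau 0 k = 0.
  elim/ltn_ind: k => k IH; have := Th_ode tau_uhp k.
  rewrite /cauchy big_ord_recr big1 => [|i _]; last by rewrite /= IH ?mul0r.
  rewrite /= add0r subnn lcoef0 mulr1 => /eqP; case: k IH => [|[|k]] IH //.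
    by rewrite mul0r eq_sym => /eqP.
  rewrite -subr_eq0 -[X in _ - X]mul1r -mulrBl mulf_eq0 -[1]/(1%:R) -natrB//.
  by rewrite pnatr_eq0 => /eqP.
have [_ h] := Th_Taylor tau_uhp 0; rewrite -[z]add0r h.
by apply: hsE; apply: eq_hs (hs0 _) => k; rewrite t0 mul0r.
Qed.

Lemma Th_mod_delta z : Th gtau (z / J) =
  tc gtau 0 1 / J / tc tau 0 1 * (Cexp (delta * z ^+ 2) * Th tau z).
Proof.
(* Here y and x are the Taylor coefficients of Th gtau (z/J) and of exp(delta z^2) Th tau z, and l
   is their common coefficient series in z u' = u l. *)
pose y k := tc gtau 0 k * J^-1 ^+ k.
pose l k := lcoef gtau k * J^-1 ^+ k.
pose x := cauchy (gauss delta) (tc tau 0).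
have lE : l = fun k => lcoef tau k + (k == 2%N)%:R * (2 * delta).
  apply/funext => k; rewrite /l; case: eqP => [->|/eqP k2].
    by rewrite mul1r /delta; move: (lcoef gtau 2 * _) (lcoef tau 2) => p p'; field.
  by rewrite lcoef_mod// mul0r addr0.
have l0 : l 0%N = 1 by rewrite /l lcoef0 expr0 mulr1.
have hy k : k%:R * y k = cauchy y l k.
  by rewrite /y /l cauchy_scale -Th_ode ?mulrA//; exact: gtau_uhp.
have hx k : k%:R * x k = cauchy x l k.
  rewrite /x cauchy_deriv lE cauchyDr.
  have -> : (fun k => k%:R * gauss delta k) = cauchy (gauss delta) (fun k => (k == 2%N)%:R * (2 * delta)).
    by apply/funext => i; exact: gauss_ode.
  have -> : (fun k => k%:R * tc tau 0 k) = cauchy (tc tau 0) (lcoef tau).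
    by apply/funext => i; exact: Th_ode.
  by rewrite cauchyA [in RHS]addrC; congr (_ + _); rewrite -!cauchyA; congr (cauchy _ _ _); rewrite cauchyC.
have t1 := tc1_neq0.
have x1 : x 1%N = tc tau 0 1.
  rewrite /x /cauchy !big_ord_recr big_ord0/= /gauss/= mul0r expr0 divr1 mul1r; ring.
have hxy k : y k = tc gtau 0 1 / J / tc tau 0 1 * x k.
  apply: (mulfI t1); rewrite -{1}x1 (euler_uniq l0 hy hx k) /y expr1; field.
  by rewrite t1 J0.
have [s1 p1] := Th_Taylor gtau_uhp 0; have [s2 p2] := Th_Taylor tau_uhp 0.
have [s3 p3] := ps_gauss delta.
have q1 := p1 (z / J); have q2 := p2 z; rewrite !add0r in q1 q2; rewrite q1 q2 -p3.
have [sx <-] := psM (s3 _ (nrm_ge0 z)) (s2 (nrm z)) (lexx (nrm z)).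
have e k : tc gtau 0 k * (z / J) ^+ k = tc gtau 0 1 / J / tc tau 0 1 * (x k * z ^+ k).
  by rewrite [RHS]mulrA -hxy /y exprMn mulrA mulrAC.
by rewrite /ps (eq_tot e) totZ.
Qed.

(** Replacing z by z + 1 in [Th_mod_delta] translates the left side by 1/J = a - c gtau. Both sides
    change by known factors, whose comparison makes exp(b0 z) constant near 0; its linear
    coefficient b0 must vanish. *)
Lemma deltaE : delta = twopii R / 2 * c%:~R / J.
Proof.
set b0 : C := 2 * delta - twopii R * c%:~R / J.
suff bz : b0 = 0.
  have -> : delta = (b0 + twopii R * c%:~R / J) / 2 by rewrite /b0; field.
  by rewrite bz; field.
apply/eqP/negPn/negP => b_neq0.
(* Up to sign, the constant part of the factor in [Th_period] for the translation by a - c gtau. *)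
pose K0 : C := - ((-1) ^ (- c) * (-1) ^ a * ce (- ((- c)%:~R ^+ 2 * gtau / 2))).
pose kap := K0 / Cexp delta.
have hk z : off_lattice tau z -> Cexp (b0 * z) = kap.
  move=> oz; have T0 := Th_neq0 tau_uhp oz.
  have Tg0 := Th_neq0 gtau_uhp (off_gtau oz).
  have h1 : Th gtau ((z + 1) / J) = - K0 * ce (c%:~R * (z / J)) * Th gtau (z / J).
    have -> : (z + 1) / J = z / J + (- c)%:~R * gtau + a%:~R.
      by rewrite mulrDl mul1r invJ mulrNz; ring.
    rewrite Th_period; last exact: gtau_uhp.
    have -> : ce (- ((- c)%:~R ^+ 2 * gtau / 2) - (- c)%:~R * (z / J)) =
        ce (- ((- c)%:~R ^+ 2 * gtau / 2)) * ce (c%:~R * (z / J)).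
      by rewrite -ceD; congr ce; rewrite !mulrNz; ring.
    by rewrite /K0 opprK !mulrA.
  have h2 : Th tau (z + 1) = - Th tau z.
    have := Th_period tau_uhp z 0 1; rewrite mul0r addr0 => ->.
    have -> : - (0%:~R ^+ 2 * tau / 2) - 0%:~R * z = 0 :> C by rewrite mulr0z; ring.
    by rewrite ce0 expr0z expr1z; ring.
  move: h1; rewrite Th_mod_delta h2 => h1.
  have e1 : Cexp (delta * (z + 1) ^+ 2) = Cexp (delta * z ^+ 2) * Cexp (2 * delta * z) * Cexp delta.
    by rewrite -!CexpD; congr Cexp; ring.
  have e2 : Cexp (b0 * z) = Cexp (2 * delta * z) / ce (c%:~R * (z / J)).
    by rewrite -CexpB /b0; congr Cexp; field.
  rewrite e2 /kap; move: h1; rewrite [X in _ = _ * X]Th_mod_delta e1.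
  have u0 := Cexp_neq0 (delta * z ^+ 2); have v0 := Cexp_neq0 delta; have w0 := ce_neq0 (c%:~R * (z / J)).
  have f0 : tc gtau 0 1 / J / tc tau 0 1 != 0.
    by move: Tg0; rewrite Th_mod_delta; apply: contraNN => /eqP ->; rewrite mul0r.
  move: u0 v0 w0 f0 T0; move: (Cexp (2 * _ * _)) (Cexp _) (Cexp _) (ce _) (tc gtau 0 1 / _ / _) (Th tau z).
  move=> p v u w f t u0 v0 w0 f0 t0 h.
  have h' : p * v = K0 * w.
    apply: (mulfI (mulf_neq0 f0 (mulf_neq0 u0 t0))); apply: (can_inj opprK).
    transitivity (f * (u * p * v * - t)); first by ring.
    by rewrite h; ring.
  have -> : p = p * v / v by rewrite mulfK.
  by rewrite h'; field; rewrite v0 w0.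
have h1 := has_ps_scale has_ps_Cexp b_neq0.
have h2 : has_ps (fun z => Cexp (b0 * z)) (cst_coef kap).
  apply: has_ps_eq (has_ps_cst kap) _; apply/near0P.
  exists (Num.min (ImC tau) 1); first by rewrite lt_min ltr01 andbT; exact: tau_uhp.
  move=> z z0; rewrite lt_min => /andP[zt z1].
  by rewrite hk//; exact: off_small.
have := has_ps_uniq h1 h2 => /(congr1 (fun f => f 1%N))/=.
rewrite /expc expr1 invr1 mul1r => b00; by rewrite b00 eqxx in b_neq0.
Qed.

Lemma Th_mod z : Th gtau (z / J) =
  tc gtau 0 1 / J / tc tau 0 1 * (ce (c%:~R * z ^+ 2 / (2 * J)) * Th tau z).
Proof.
rewrite Th_mod_delta deltaE; congr (_ * (_ * _)); rewrite /ce; congr Cexp.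
by field.
Qed.

End Modular.

(** * The Kronecker function *)

Section Kronecker.
Context {R : realType}.
Local Notation C := (Cplx R).

(* The coefficients of e(lambda z). *)
Definition cexc (lambda : C) k : C := (twopii R * lambda) ^+ k / k`!%:R.

Lemma has_ps_ce lambda : has_ps (fun z => ce (lambda * z)) (cexc lambda).
Proof.
have [->|l0] := eqVneq lambda 0.
  apply: eq_has_ps (has_ps_eq (has_ps_cst 1) _) _.
    by apply/near0P; exists 1 => // z _ _; rewrite mul0r ce0.
  by case=> [|k]; rewrite /cexc mulr0 ?expr0 ?divr1// exprS !mul0r.
have l1 : twopii R * lambda != 0 by rewrite mulf_neq0// twopii_neq0.
apply: eq_has_ps (has_ps_eq (has_ps_scale has_ps_Cexp l1) _) _.
  by apply/near0P; exists 1 => // z _ _; rewrite /ce mulrA.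
by move=> k; rewrite /expc /cexc mulrC.
Qed.

Lemma cexcD l m : cauchy (cexc l) (cexc m) = cexc (l + m).
Proof.
apply: has_ps_uniq (has_psM (has_ps_ce l) (has_ps_ce m)) _.
apply: has_ps_eq (has_ps_ce (l + m)) _; apply/near0P; exists 1 => // z _ _.
by rewrite mulrDl ceD.
Qed.

Lemma cexc_scale l a k : cexc l k * a ^+ k = cexc (l * a) k.
Proof. by rewrite /cexc mulrAC -exprMn mulrA. Qed.

Lemma cexc0 : cexc 0 = cst_coef 1.
Proof.
by apply/funext => -[|k]; rewrite /cexc mulr0 ?expr0 ?divr1// exprS !mul0r.
Qed.

Section FixTau.
Variable tau : C.
Hypothesis tau_uhp : uhp tau.

Lemma kronFE xi eta : kronF xi eta tau = tc tau 0 1 * Th tau (xi + eta) / (Th tau xi * Th tau eta).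
Proof. by rewrite /kronF mulrA mulrA derive1_theta0. Qed.

Lemma tc0_0 : tc tau 0 0 = 0.
Proof.
have := Th_ode tau_uhp 0; rewrite mul0r /cauchy big_ord_recl big_ord0 addr0 lcoef0 mulr1.
by move/esym.
Qed.

(* The coefficients of eta F(xi, eta, tau) in eta. *)
Definition hcoef xi k : C :=
  tc tau 0 1 / Th tau xi * cauchy (tc tau xi) (inv_coef (fun k => tc tau 0 k.+1)) k.

Lemma has_ps_kronF xi : off_lattice tau xi ->
  has_ps (fun eta => eta * kronF xi eta tau) (hcoef xi).
Proof.
move=> ox; have [s0 h0] := Th_Taylor tau_uhp 0; have [s1 h1] := Th_Taylor tau_uhp xi.
have p0 : has_ps (Th tau) (tc tau 0).
  by exists 1 => //; split => // z _ _; rewrite -h0 add0r.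
have p1 : has_ps (fun eta => Th tau (xi + eta)) (tc tau xi).
  by exists 1 => //; split => // z _ _; rewrite -h1.
have p2 := has_psV (has_ps_unshift p0 tc0_0) (tc1_neq0 tau_uhp).
have p3 := has_psZ (tc tau 0 1 / Th tau xi) (has_psM p1 p2).
apply: has_ps_eq p3 _; apply/near0P; exists 1 => // z z0 _.
rewrite kronFE !invfM invrK; ring.
Qed.

Lemma hcoef0 xi : off_lattice tau xi -> hcoef xi 0 = 1.
Proof.
move=> ox; have T0 := Th_neq0 tau_uhp ox; have t0 := tc1_neq0 tau_uhp.
rewrite /hcoef /cauchy big_ord_recl big_ord0 addr0 subnn tc0E//.
by rewrite /inv_coef/=; field; rewrite T0 t0.
Qed.

(** 1/eta + eta F' = (1 - eta F)/eta + (eta F)', and eta F has a power series with constant term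
    1. *)
Lemma has_ps_kronF_tau xi : off_lattice tau xi ->
  has_ps (fun eta : C => eta^-1 + eta * derive1 (fun z => kronF xi z tau) eta)
    (fun k => k%:R * hcoef xi k.+1).
Proof.
move=> ox; have h := has_ps_kronF ox; have [r r0 [s hr]] := h.
have h1 : has_ps (fun z => ((fun _ => 1) z - z * kronF xi z tau) / z) (fun k => cst_coef 1 k.+1 - hcoef xi k.+1).
  by apply: has_ps_unshift (has_psB (has_ps_cst 1) h) _; rewrite hcoef0//= subrr.
have h2 := has_psD h1 (has_ps_derive1 h).
apply: eq_has_ps (has_ps_eq h2 _) _; last first.
  by move=> k; rewrite /deriv_coef/= -natr1; ring.
apply/near0P; exists r => // z z0 zr.
have d := ps_derive s zr.
have dH : is_derive z (1 : C) (fun z => z * kronF xi z tau : C) (ps (deriv_coef (hcoef xi)) z).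
  have [d1 d2] := d; have e : {near z, ps (hcoef xi) =1 (fun z => z * kronF xi z tau : C)}.
    by apply: (near_neq z0 zr) => y y0 yr; rewrite hr.
  apply: DeriveDef; last by rewrite -d2; apply: near_eq_derive; apply: filterS e => y ->.
  exact: near_eq_derivable e _.
have e : derive1 (fun z => z * kronF xi z tau : C) z = ps (deriv_coef (hcoef xi)) z.
  by rewrite derive1E; have [_ ->] := dH.
rewrite e; have dF := dC_mul (dvv z0) dH.
have [_ dE] := dF; rewrite -derive1E in dE.
have -> : derive1 (fun z0 : C => kronF xi z0 tau) z = derive1 (fun y : C => y^-1 * (y * kronF xi y tau) : C) z.
  rewrite !derive1E; apply: near_eq_derive; apply: (near_neq z0 zr) => y y0 yr.
  by rewrite mulKf.
by rewrite dE; field.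
Qed.

(** Signs and Gaussian factors cancel between numerator and denominator; only the part of the
    exponent that is linear in eta survives. *)
Lemma kronF_trans xi eta (m n : int) :
  kronF (xi + m%:~R * tau + n%:~R) eta tau = ce (- m%:~R * eta) * kronF xi eta tau.
Proof.
rewrite !kronFE; have -> : xi + m%:~R * tau + n%:~R + eta = xi + eta + m%:~R * tau + n%:~R by ring.
rewrite !Th_period//.
have -> : ce (- (m%:~R ^+ 2 * tau / 2) - m%:~R * (xi + eta)) =
  ce (- m%:~R * eta) * ce (- (m%:~R ^+ 2 * tau / 2) - m%:~R * xi) by rewrite -ceD; congr ce; ring.
have a0 := N1z_neq0 (R := R) m; have b0 := N1z_neq0 (R := R) n.
have c0 := ce_neq0 (- (m%:~R ^+ 2 * tau / 2) - m%:~R * xi).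
move: a0 b0 c0; move: (ce (- _ * eta)) (ce _) ((-1) ^ m) ((-1) ^ n) => p q a b a0 b0 q0.
rewrite !invfM; set X := (Th tau xi)^-1; set Y := (Th tau eta)^-1.
transitivity (tc tau 0 1 * p * Th tau (xi + eta) * X * Y * ((a * b * q) * (a^-1 * b^-1 * q^-1))); first by ring.
have -> : (a * b * q) * (a^-1 * b^-1 * q^-1) = 1 by field; rewrite a0 b0 q0.
by rewrite mulr1; ring.
Qed.

End FixTau.

Lemma off_trans (tau xi : C) (m n : int) : off_lattice tau xi ->
  off_lattice tau (xi + m%:~R * tau + n%:~R).
Proof.
move=> ox i j; have := ox (i - n) (j - m); apply: contra => /eqP h; apply/eqP.
rewrite !intrB; transitivity (xi + m%:~R * tau + n%:~R - m%:~R * tau - n%:~R); first by ring.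
by rewrite h; ring.
Qed.

Section Equivariance.
Variables (tau xi : C) (a b c d m n : int).
Hypothesis tau_uhp : uhp tau.
Hypothesis det1 : a * d - b * c = 1.
Hypothesis ox : off_lattice tau xi.
Let J : C := c%:~R * tau + d%:~R.
Let gtau : C := (a%:~R * tau + b%:~R) / J.
Let xi' := xi + m%:~R * tau + n%:~R.
Let J0 : J != 0 := jfac_neq0 tau_uhp det1.

(** Of the Gaussian factors of the three theta values only (xi' + eta)^2 - xi'^2 - eta^2 = 2 xi' eta
    survives, and the constants of [Th_mod] leave the factor J. *)
Lemma kronF_mod eta : kronF (xi' / J) (eta / J) gtau = J * ce (c%:~R * xi' * eta / J) * kronF xi' eta tau.
Proof.
have gu := gtau_uhp tau_uhp det1.
rewrite (kronFE gu) (kronFE tau_uhp) -mulrDl !(Th_mod tau_uhp det1) -/J -/gtau.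
have -> : ce (c%:~R * (xi' + eta) ^+ 2 / (2 * J)) =
  ce (c%:~R * xi' * eta / J) * ce (c%:~R * xi' ^+ 2 / (2 * J)) * ce (c%:~R * eta ^+ 2 / (2 * J)).
  by rewrite -!ceD; congr ce; field.
have t0 := tc1_neq0 tau_uhp; have s0 := tc1_neq0 gu.
have u0 := ce_neq0 (c%:~R * xi' ^+ 2 / (2 * J)); have v0 := ce_neq0 (c%:~R * eta ^+ 2 / (2 * J)).
rewrite -/J -/gtau in s0; have j0 := J0; move: t0 s0 u0 v0 j0.
move: (ce (c%:~R * xi' ^+ 2 / (2 * J))) (ce (c%:~R * eta ^+ 2 / (2 * J))) (ce (c%:~R * xi' * eta / J)) (tc tau 0 1) (tc gtau 0 1) => u v w t s.
move: (J) => j t0 s0 u0 v0 j0.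
rewrite !invfM; set X := (Th tau xi')^-1; set Y := (Th tau eta)^-1; set Z := Th tau _.
transitivity (w * t * Z * X * Y * j * ((u * v * s * s / t / j) * (u^-1 * v^-1 * s^-1 * s^-1 * t^-1^-1 * j^-1^-1))).
  by rewrite !invrK; field; rewrite t0 j0 s0 u0 v0.
rewrite !invrK; have -> : u * v * s * s / t / j * (u^-1 * v^-1 * s^-1 * s^-1 * t * j) = 1.
  by field; rewrite t0 j0 s0 u0 v0.
by ring.
Qed.

(** The modular law and the translation law combined. The exponent c xi'/J - m equals (c xi + c n -
    d m)/J, since the terms m c tau cancel in the numerator. *)
Lemma hcoef_equiv k : hcoef gtau (xi' / J) k =
  J ^+ k * cauchy (cexc (c%:~R * xi' / J - m%:~R)) (hcoef tau xi) k.
Proof.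
have gu := gtau_uhp tau_uhp det1.
have ox' : off_lattice tau xi' := off_trans m n ox.
have og : off_lattice gtau (xi' / J) := off_gtau tau_uhp det1 ox'.
have J1 : J^-1 != 0 by rewrite invr_eq0.
have h1 := has_ps_scale (has_ps_kronF gu og) J1.
have h2 := has_psM (has_ps_ce (c%:~R * xi' / J - m%:~R)) (has_ps_kronF tau_uhp ox).
have h : has_ps (fun z => J^-1 * z * kronF (xi' / J) (J^-1 * z) gtau)
  (cauchy (cexc (c%:~R * xi' / J - m%:~R)) (hcoef tau xi)).
  apply: has_ps_eq h2 _; apply/near0P; exists 1 => // z _ _.
  rewrite [J^-1 * z]mulrC kronF_mod kronF_trans//.
  have -> : ce ((c%:~R * xi' / J - m%:~R) * z) = ce (c%:~R * xi' * z / J) * ce (- m%:~R * z).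
    by rewrite -ceD; congr ce; ring.
  by move: (ce _) (ce _) (kronF _ _ _) => p q f; field.
have := has_ps_uniq h1 h => /(congr1 (fun f => f k)) <-.
by rewrite exprVn mulrCA mulfV ?mulr1// expf_neq0.
Qed.

End Equivariance.
End Kronecker.

(** * Noncommutative power series *)

Section NcAlgebra.
Context {R : realType}.
Local Notation C := (Cplx R).
Local Notation ncs := (ncseries R).
Local Notation one := (mono R [::]).
Local Notation t := (nct R).
Local Notation a := (nca R).
Implicit Types (x y z U V : ncs) (w : word) (L M D : ncs -> ncs).

Lemma ncDE x y w : (x + y) w = x w + y w. Proof. by []. Qed.
Lemma ncNE x w : (- x) w = - x w. Proof. by []. Qed.
Lemma ncBE x y w : (x - y) w = x w - y w. Proof. by []. Qed.
Lemma ncZE (k : C) x w : (k *: x) w = k * x w. Proof. by []. Qed.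
Lemma nc0E w : (0 : ncs) w = 0. Proof. by []. Qed.
Lemma nc_sumE (I : Type) (s : seq I) (P : pred I) (F : I -> ncs) w :
  (\sum_(i <- s | P i) F i) w = \sum_(i <- s | P i) F i w.
Proof. by elim/big_rec2: _ => // i f g _ <-. Qed.

Lemma nmul_nil x y : nmul x y [::] = x [::] * y [::].
Proof. by rewrite /nmul /= big_nat1. Qed.

(** Recursion on the first letter; [fun u => x (l :: u)] is the left quotient of the series x by the
    letter l. *)
Lemma nmul_cons x y l w :
  nmul x y (l :: w) = x [::] * y (l :: w) + nmul (fun u => x (l :: u)) y w.
Proof. by rewrite /nmul /= big_nat_recl. Qed.

Lemma nmulDl x y z : nmul (x + y) z = nmul x z + nmul y z.
Proof.
by apply/funext => w; rewrite ncDE /nmul -big_split; apply: eq_bigr => i _; rewrite mulrDl.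
Qed.

Lemma nmulDr x y z : nmul x (y + z) = nmul x y + nmul x z.
Proof.
by apply/funext => w; rewrite ncDE /nmul -big_split; apply: eq_bigr => i _; rewrite mulrDr.
Qed.

Lemma nmulZl (k : C) x y : nmul (k *: x) y = k *: nmul x y.
Proof.
by apply/funext => w; rewrite ncZE /nmul mulr_sumr; apply: eq_bigr => i _; rewrite ncZE mulrA.
Qed.

Lemma nmulZr (k : C) x y : nmul x (k *: y) = k *: nmul x y.
Proof.
by apply/funext => w; rewrite ncZE /nmul mulr_sumr; apply: eq_bigr => i _; rewrite ncZE mulrCA.
Qed.

Lemma nmul0l x : nmul 0 x = 0.
Proof. by have := nmulZl 0 0 x; rewrite !scale0r. Qed.
Lemma nmul0r x : nmul x 0 = 0.
Proof. by have := nmulZr 0 x 0; rewrite !scale0r. Qed.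
Lemma nmulNl x y : nmul (- x) y = - nmul x y.
Proof. by rewrite -scaleN1r nmulZl scaleN1r. Qed.
Lemma nmulNr x y : nmul x (- y) = - nmul x y.
Proof. by rewrite -scaleN1r nmulZr scaleN1r. Qed.
Lemma nmulBl x y z : nmul (x - y) z = nmul x z - nmul y z.
Proof. by rewrite nmulDl nmulNl. Qed.
Lemma nmulBr x y z : nmul x (y - z) = nmul x y - nmul x z.
Proof. by rewrite nmulDr nmulNr. Qed.

Lemma nmulA x y z : nmul x (nmul y z) = nmul (nmul x y) z.
Proof.
apply/funext => w; elim: w x y => [|l w IH] x y; first by rewrite !nmul_nil mulrA.
rewrite !nmul_cons nmul_nil IH.
have -> : (fun u => nmul x y (l :: u)) = x [::] *: (fun u => y (l :: u)) + nmul (fun u => x (l :: u)) y.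
  by apply/funext => u; rewrite nmul_cons.
by rewrite nmulDl nmulZl ncDE ncZE; ring.
Qed.

Lemma mono_cons l w : (fun u => mono R (l :: w) (l :: u)) = mono R w.
Proof. by apply/funext => u; rewrite /mono eqseq_cons eqxx. Qed.

Lemma mono_cons_neq l l' w : l != l' -> (fun u => mono R (l :: w) (l' :: u)) = 0.
Proof. by move=> h; apply/funext => u; rewrite /mono eqseq_cons eq_sym (negPf h). Qed.

Lemma nmul1l x : nmul one x = x.
Proof.
apply/funext => -[|l w]; first by rewrite nmul_nil /mono eqxx mul1r.
rewrite nmul_cons {1}/mono eqxx mul1r (_ : (fun u => one (l :: u)) = 0)//.
by rewrite nmul0l addr0.
Qed.

Lemma nmul_mono u w : nmul (mono R u) (mono R w) = mono R (u ++ w).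
Proof.
elim: u => [|l u IH]; first by rewrite nmul1l.
apply/funext => -[|l' v]; first by rewrite nmul_nil /mono/= mul0r.
rewrite nmul_cons {1}/mono mul0r add0r; have [->|h] := eqVneq l l'.
  by rewrite mono_cons IH /mono/= eqseq_cons eqxx.
by rewrite mono_cons_neq// nmul0l /mono/= eqseq_cons [l' == l]eq_sym (negPf h).
Qed.

Definition ord_ge n x := forall w, (size w < n)%N -> x w = 0.

Lemma ord_ge0 x : ord_ge 0 x. Proof. by []. Qed.
Lemma ord_geW m n x : (m <= n)%N -> ord_ge n x -> ord_ge m x.
Proof. by move=> mn h w wm; apply: h; exact: leq_trans mn. Qed.
Lemma ordD n x y : ord_ge n x -> ord_ge n y -> ord_ge n (x + y).
Proof. by move=> hx hy w wn; rewrite ncDE hx// hy// addr0. Qed.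
Lemma ordZ n (k : C) x : ord_ge n x -> ord_ge n (k *: x).
Proof. by move=> hx w wn; rewrite ncZE hx// mulr0. Qed.
Lemma ordN n x : ord_ge n x -> ord_ge n (- x).
Proof. by move=> hx w wn; rewrite ncNE hx// oppr0. Qed.
Lemma ordB n x y : ord_ge n x -> ord_ge n y -> ord_ge n (x - y).
Proof. by move=> hx hy; apply: ordD => //; exact: ordN. Qed.
Lemma ord_sum n (I : Type) (s : seq I) (P : pred I) (F : I -> ncs) :
  (forall i, P i -> ord_ge n (F i)) -> ord_ge n (\sum_(i <- s | P i) F i).
Proof. by move=> h w wn; rewrite nc_sumE big1// => i Pi; exact: h. Qed.

Lemma ord_nmul m n x y : ord_ge m x -> ord_ge n y -> ord_ge (m + n) (nmul x y).
Proof.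
move=> hx hy w wmn; rewrite /nmul big_nat big1// => i /andP[_ iw].
case: (ltnP i m) => im.
  by rewrite hx ?mul0r// size_takel.
by rewrite hy ?mulr0// size_drop; lia.
Qed.

Lemma ord_mono w : ord_ge (size w) (mono R w).
Proof. by move=> v; rewrite /mono; case: eqP => // -> ; rewrite ltnn. Qed.

Lemma ord_ncad m n x y : ord_ge m x -> ord_ge n y -> ord_ge (m + n) (ncad x y).
Proof. by move=> hx hy; apply: ordB; [|rewrite addnC]; exact: ord_nmul. Qed.

Lemma ncadE x y : ncad x y = nmul x y - nmul y x. Proof. by []. Qed.

Lemma ncadDr x y z : ncad x (y + z) = ncad x y + ncad x z.
Proof. by rewrite !ncadE nmulDl nmulDr opprD addrACA. Qed.
Lemma ncadDl x y z : ncad (x + y) z = ncad x z + ncad y z.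
Proof. by rewrite !ncadE nmulDl nmulDr opprD addrACA. Qed.
Lemma ncadZr (k : C) x y : ncad x (k *: y) = k *: ncad x y.
Proof. by rewrite !ncadE nmulZl nmulZr scalerBr. Qed.
Lemma ncadZl (k : C) x y : ncad (k *: x) y = k *: ncad x y.
Proof. by rewrite !ncadE nmulZl nmulZr scalerBr. Qed.
Lemma ncadxx x : ncad x x = 0. Proof. by rewrite ncadE subrr. Qed.
Lemma ncadC x y : ncad x y = - ncad y x. Proof. by rewrite !ncadE opprB. Qed.
Lemma ncadNl x y : ncad (- x) y = - ncad x y.
Proof. by rewrite -scaleN1r ncadZl scaleN1r. Qed.
Lemma ncad0r x : ncad x 0 = 0. Proof. by rewrite ncadE nmul0l nmul0r subr0. Qed.
(** [clin_ord] plays the role of continuity: by [clin_eq] such a map is determined by its values on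
    words. *)
Record clin L : Prop := Clin {
  clinD : forall x y, L (x + y) = L x + L y;
  clinZ : forall (k : C) x, L (k *: x) = k *: L x;
  clin_ord : forall n x, ord_ge n x -> ord_ge n (L x) }.

Lemma clin0 L : clin L -> L 0 = 0.
Proof. by move=> cL; have := clinZ cL 0 0; rewrite !scale0r. Qed.
Lemma clinN L x : clin L -> L (- x) = - L x.
Proof. by move=> cL; rewrite -scaleN1r (clinZ cL) scaleN1r. Qed.
Lemma clinB L x y : clin L -> L (x - y) = L x - L y.
Proof. by move=> cL; rewrite (clinD cL) (clinN _ cL). Qed.
Lemma clin_sum L (I : Type) (s : seq I) (P : pred I) (F : I -> ncs) : clin L ->
  L (\sum_(i <- s | P i) F i) = \sum_(i <- s | P i) L (F i).
Proof.
move=> cL; elim: s => [|i s IH]; first by rewrite !big_nil clin0.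
by rewrite !big_cons; case: ifP => _ //; rewrite (clinD cL) IH.
Qed.

Definition trunc n x : ncs := \sum_(k < n) \sum_(w : k.-tuple bool) x w *: mono R w.

Lemma truncE n x v : trunc n x v = (size v < n)%:R * x v.
Proof.
rewrite /trunc nc_sumE; under eq_bigr do rewrite nc_sumE.
have E (k : nat) : \sum_(w : k.-tuple bool) (x w *: mono R w) v = (size v == k)%:R * x v.
  case: eqP => [vk|vk]; last first.
    rewrite mul0r big1// => w _; rewrite ncZE /mono; case: eqP => [vw|_]; last by rewrite mulr0.
    by case: vk; rewrite vw size_tuple.
  subst k; rewrite mul1r (bigD1 (in_tuple v))//= ncZE /mono eqxx mulr1 big1 ?addr0// => w wv.
  rewrite ncZE; case: eqP => [vw|_]; last by rewrite mulr0.
  by case/eqP: wv; apply: val_inj.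
under eq_bigr do rewrite E; case: (ltnP (size v) n) => vn.
  rewrite mul1r (bigD1 (Ordinal vn))//= eqxx mul1r big1 ?addr0// => i; rewrite -val_eqE/= eq_sym.
  by move/negPf ->; rewrite mul0r.
rewrite mul0r big1// => i _; case: eqP => [vi|_]; last by rewrite mul0r.
by have := ltn_ord i; rewrite -vi ltnNge vn.
Qed.

Lemma ord_trunc n x : ord_ge n (x - trunc n x).
Proof. by move=> w wn; rewrite ncBE truncE wn mul1r subrr. Qed.

Lemma clin_trunc L n x v : clin L -> (size v < n)%N -> L x v = L (trunc n x) v.
Proof.
move=> cL vn; apply/eqP; rewrite -subr_eq0 -ncBE -(clinB _ _ cL).
by rewrite (clin_ord cL (ord_trunc x)).
Qed.

Lemma clin_eq L M : clin L -> clin M -> (forall w, L (mono R w) = M (mono R w)) ->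
  forall x, L x = M x.
Proof.
move=> cL cM h x; apply/funext => v.
rewrite (clin_trunc _ cL (ltnSn _)) (clin_trunc _ cM (ltnSn _)); congr (_ v).
rewrite /trunc (clin_sum _ _ _ cL) (clin_sum _ _ _ cM); apply: eq_bigr => k _.
rewrite (clin_sum _ _ _ cL) (clin_sum _ _ _ cM).
by apply: eq_bigr => w _; rewrite (clinZ cL) (clinZ cM) h.
Qed.

Lemma clin_id : clin id. Proof. by split. Qed.
Lemma clin_comp L M : clin L -> clin M -> clin (fun x => L (M x)).
Proof.
move=> cL cM; split => [x y|k x|n x xn]; first by rewrite (clinD cM) (clinD cL).
  by rewrite (clinZ cM) (clinZ cL).
exact: (clin_ord cL (clin_ord cM xn)).
Qed.
Lemma clin_add L M : clin L -> clin M -> clin (fun x => L x + M x).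
Proof.
move=> cL cM; split => [x y|k x|n x xn]; first by rewrite (clinD cM) (clinD cL) addrACA.
  by rewrite (clinZ cM) (clinZ cL) scalerDr.
exact: ordD (clin_ord cL xn) (clin_ord cM xn).
Qed.
Lemma clin_scale (k : C) L : clin L -> clin (fun x => k *: L x).
Proof.
move=> cL; split => [x y|l x|n x xn]; first by rewrite (clinD cL) scalerDr.
  by rewrite (clinZ cL) !scalerA mulrC.
exact: ordZ (clin_ord cL xn).
Qed.
Lemma clin_opp L : clin L -> clin (fun x => - L x).
Proof.
move=> cL; have := clin_scale (-1) cL; congr clin; apply/funext => x.
by rewrite scaleN1r.
Qed.
Lemma clin_sub L M : clin L -> clin M -> clin (fun x => L x - M x).
Proof. by move=> cL cM; apply: clin_add => //; exact: clin_opp. Qed.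
Lemma clin_mull x : clin (nmul x).
Proof.
by split=> [y z|k y|n y yn]; [exact: nmulDr|exact: nmulZr|apply: (@ord_nmul 0)].
Qed.
Lemma clin_mulr x : clin (fun y => nmul y x).
Proof.
split=> [y z|k y|n y yn]; [exact: nmulDl|exact: nmulZl|].
by rewrite -[n]addn0; apply: ord_nmul.
Qed.
Lemma clin_ncad x : clin (ncad x).
Proof. exact: clin_sub (clin_mull x) (clin_mulr x). Qed.

Lemma nmul1r x : nmul x one = x.
Proof.
apply: (@clin_eq (fun x => nmul x one) id (clin_mulr one) clin_id) => w.
by rewrite nmul_mono cats0.
Qed.

(** The common form of [ncsubst], [ncder] and [ncact]; in each of them the series attached to w has
    order at least the length of w, so the sum is locally finite. *)
Definition wsum (T : word -> ncs) x : ncs :=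
  fun v => sum_words (size v) (fun w => x w * T w v).

Section WSum.
Variable T : word -> ncs.
Hypothesis ordT : forall w, ord_ge (size w) (T w).

Lemma wsumE N x v : (size v <= N)%N -> wsum T x v = sum_words N (fun w => x w * T w v).
Proof.
move=> vN; rewrite /wsum /sum_words.
rewrite (big_ord_widen N.+1 (fun k => \sum_(w : k.-tuple bool) x w * T w v))// big_mkcond/=.
apply: eq_bigr => k _; case: ifPn => // kv; rewrite big1// => w _.
by rewrite ordT ?mulr0// size_tuple; lia.
Qed.

Lemma clin_wsum : clin (wsum T).
Proof.
split=> [x y|k x|n x xn]; try apply/funext => v.
- rewrite ncDE /wsum /sum_words -big_split; apply: eq_bigr => k _.
  by rewrite -big_split; apply: eq_bigr => w _; rewrite ncDE mulrDl.
- rewrite ncZE /wsum /sum_words mulr_sumr; apply: eq_bigr => i _.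
  by rewrite mulr_sumr; apply: eq_bigr => w _; rewrite ncZE mulrA.
- move=> v vn; rewrite /wsum /sum_words big1// => k _; rewrite big1// => w _.
  by rewrite xn ?mul0r// size_tuple; have := ltn_ord k; lia.
Qed.

Lemma wsum_mono w : wsum T (mono R w) = T w.
Proof.
apply/funext => v; rewrite (@wsumE (maxn (size v) (size w))) ?leq_maxl// /sum_words.
have h : (size w < (maxn (size v) (size w)).+1)%N by rewrite ltnS leq_maxr.
rewrite (bigD1 (Ordinal h))//= (bigD1 (in_tuple w))//= /mono eqxx mul1r !big1 ?addr0//.
- move=> k; rewrite -val_eqE/= => kw; rewrite big1// => u _; case: eqP => [uw|_]; last by rewrite mul0r.
  by case/eqP: kw; transitivity (size u); [rewrite size_tuple|rewrite uw].
- move=> u; rewrite -val_eqE/= => /negPf ->; by rewrite mul0r.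
Qed.

End WSum.

Section Subst.
Variables U V : ncs.
Hypotheses (U1 : ord_ge 1 U) (V1 : ord_ge 1 V).

Let word_img w := foldr (fun (l : bool) y => nmul (if l then V else U) y) one w.

Let word_img_ord w : ord_ge (size w) (word_img w).
Proof. by elim: w => //= l w IH; rewrite -add1n; apply: ord_nmul => //; case: l. Qed.

Lemma clin_subst : clin (ncsubst U V).
Proof. by change (clin (wsum word_img)); exact: clin_wsum. Qed.

Lemma subst_mono w : ncsubst U V (mono R w) = word_img w.
Proof. by change (wsum word_img (mono R w) = word_img w); exact: wsum_mono word_img_ord _. Qed.

Lemma subst1 : ncsubst U V one = one. Proof. by rewrite subst_mono. Qed.
Lemma subst_t : ncsubst U V t = U. Proof. by rewrite subst_mono /= nmul1r. Qed.
Lemma subst_a : ncsubst U V a = V. Proof. by rewrite subst_mono /= nmul1r. Qed.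

Lemma substM x y : ncsubst U V (nmul x y) = nmul (ncsubst U V x) (ncsubst U V y).
Proof.
have cS := clin_subst.
apply: (clin_eq (L := fun x => ncsubst U V (nmul x y)) (M := fun x => nmul (ncsubst U V x) (ncsubst U V y))).
- exact: clin_comp cS (clin_mulr y).
- exact: clin_comp (clin_mulr _) cS.
move=> u; apply: (clin_eq (L := fun y => ncsubst U V (nmul (mono R u) y)) (M := fun y => nmul (ncsubst U V (mono R u)) (ncsubst U V y))).
- exact: clin_comp cS (clin_mull _).
- exact: clin_comp (clin_mull _) cS.
move=> w; rewrite nmul_mono !subst_mono.
by elim: u => [|l u IH]; rewrite /= ?nmul1l// IH nmulA.
Qed.

End Subst.

Section Der.
Variables U V : ncs.
Hypotheses (U1 : ord_ge 1 U) (V1 : ord_ge 1 V).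

Lemma der_word_ord w : ord_ge (size w) (ncder_word U V w).
Proof.
rewrite /ncder_word big_nat; apply: ord_sum => i /andP[_ iw].
apply: (@ord_geW _ (i + (1 + (size w - i.+1))) _); first lia.
apply: ord_nmul; last apply: ord_nmul.
- by have := @ord_mono (take i w); rewrite size_takel// ltnW.
- by case: nth.
- by have := @ord_mono (drop i.+1 w); rewrite size_drop.
Qed.

Lemma clin_der : clin (ncder U V). Proof. by change (clin (wsum (ncder_word U V))); exact: clin_wsum. Qed.

Lemma der_mono w : ncder U V (mono R w) = ncder_word U V w.
Proof. by change (wsum (ncder_word U V) (mono R w) = ncder_word U V w); exact: wsum_mono der_word_ord _. Qed.

Lemma der_t : ncder U V t = U.
Proof. by rewrite der_mono /ncder_word big_nat1 /= nmul1l nmul1r. Qed.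
Lemma der_a : ncder U V a = V.
Proof. by rewrite der_mono /ncder_word big_nat1 /= nmul1l nmul1r. Qed.

Lemma derM x y : ncder U V (nmul x y) = nmul (ncder U V x) y + nmul x (ncder U V y).
Proof.
have cS := clin_der.
apply: (clin_eq (L := fun x => ncder U V (nmul x y)) (M := fun x => nmul (ncder U V x) y + nmul x (ncder U V y))).
- exact: clin_comp cS (clin_mulr y).
- exact: clin_add (clin_comp (clin_mulr _) cS) (clin_mulr _).
move=> u; apply: (clin_eq (L := fun y => ncder U V (nmul (mono R u) y)) (M := fun y => nmul (ncder U V (mono R u)) y + nmul (mono R u) (ncder U V y))).
- exact: clin_comp cS (clin_mull _).
- exact: clin_add (clin_mull _) (clin_comp (clin_mull _) cS).
move=> w; rewrite nmul_mono !der_mono /ncder_word size_cat (@big_cat_nat _ _ _ (size u))/= ?leq_addr//.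
congr (_ + _).
  rewrite (clin_sum _ _ _ (clin_mulr (mono R w))) !big_nat; apply: eq_bigr => i /andP[_ iu].
  rewrite take_cat iu nth_cat iu drop_cat; case: ltnP => h; rewrite -!nmulA nmul_mono//=.
  have e : (i.+1 = size u)%N by lia.
  by rewrite e drop_size subnn drop0.
rewrite -{1}[size u]add0n big_addn addKn (clin_sum _ _ _ (clin_mull (mono R u))).
apply: eq_bigr => i _; rewrite take_cat nth_cat ltnNge leq_addl/= addnK drop_cat.
by rewrite -addSn ltnNge leq_addl/= addnK !nmulA nmul_mono.
Qed.

End Der.

Definition mder M D := forall x y, D (nmul x y) = nmul (D x) (M y) + nmul (M x) (D y).

(** Because M(1) = 1, the Leibniz rule forces D(1) = 0 and then determines D on every word from its
    values on the letters. *)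
Lemma mder_eq M D D' : M one = one -> clin D -> clin D' -> mder M D -> mder M D' ->
  D t = D' t -> D a = D' a -> forall x, D x = D' x.
Proof.
move=> M1 cD cD' mD mD' ht ha; apply: clin_eq => //.
have D1 E : mder M E -> E one = 0.
  by move=> mE; have := mE one one; rewrite nmul1l M1 nmul1r nmul1l -[LHS]addr0 => /addrI.
elim=> [|l w IH]; first by rewrite !D1.
by rewrite -cat1s -nmul_mono mD mD' IH; case: l => /=; rewrite -/a -/t ?ha ?ht.
Qed.

Lemma mder_add M D D' : mder M D -> mder M D' -> mder M (fun x => D x + D' x).
Proof. by move=> h h' x y; rewrite h h' !(nmulDl, nmulDr) addrACA. Qed.
Lemma mder_scale M D (k : C) : mder M D -> mder M (fun x => k *: D x).
Proof. by move=> h x y; rewrite h !(nmulZl, nmulZr) scalerDr. Qed.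
Lemma mder_ncad u : mder id (ncad u).
Proof. by move=> x y; rewrite !ncadE nmulBl nmulBr !nmulA addrA subrK. Qed.
Lemma mder_compl M D : mder id D -> (forall x y, M (nmul x y) = nmul (M x) (M y)) ->
  mder M (fun x => D (M x)).
Proof. by move=> h hM x y; rewrite hM h. Qed.
Lemma mder_compr M D : clin M -> mder id D -> (forall x y, M (nmul x y) = nmul (M x) (M y)) ->
  mder M (fun x => M (D x)).
Proof. by move=> cM h hM x y; rewrite h (clinD cM) !hM. Qed.

Lemma hom_eq M M' : clin M -> clin M' -> M one = one -> M' one = one ->
  (forall x y, M (nmul x y) = nmul (M x) (M y)) ->
  (forall x y, M' (nmul x y) = nmul (M' x) (M' y)) ->
  M t = M' t -> M a = M' a -> forall x, M x = M' x.
Proof.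
move=> cM cM' M1 M1' hM hM' ht ha; apply: clin_eq => //.
elim=> [|l w IH]; first by rewrite M1.
by rewrite -cat1s -nmul_mono hM hM' IH; case: l => /=; rewrite -/a -/t ?ha ?ht.
Qed.

End NcAlgebra.

(** * Power series in ad_t and the exponential e(s t) *)

Section NcAction.
Context {R : realType}.
Local Notation C := (Cplx R).
Local Notation ncs := (ncseries R).
Local Notation one := (mono R [::]).
Local Notation t := (nct R).
Local Notation a := (nca R).
Implicit Types (x y z U V : ncs) (v w : word) (L M D : ncs -> ncs) (c d : nat -> C).

Lemma ord_t : ord_ge 1 t. Proof. exact: (@ord_mono R [:: false]). Qed.
Lemma ord_a : ord_ge 1 a. Proof. exact: (@ord_mono R [:: true]). Qed.

Lemma ord_iter_ad n k x : ord_ge n x -> ord_ge (k + n) (iter k (ncad t) x).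
Proof. by move=> xn; elim: k => //= k IH; rewrite addSn -add1n; apply: ord_ncad ord_t IH. Qed.

Lemma sum_triangle N (F : nat -> nat -> C) : (forall k j, (N < k + j)%N -> F k j = 0) ->
  \sum_(k < N.+1) \sum_(j < N.+1) F k j = \sum_(n < N.+1) \sum_(k < n.+1) F k (n - k)%N.
Proof.
move=> F0.
have E (k : 'I_N.+1) : \sum_(j < N.+1) F k j = \sum_(n < N.+1) (k <= n)%:R * F k (n - k)%N.
  have kN : (k <= N.+1)%N by rewrite ltnW.
  rewrite -(big_mkord xpredT (fun n => (k <= n)%:R * F k (n - k)%N)) (@big_cat_nat _ _ _ k)//=.
  rewrite [X in _ = X + _]big_nat [X in _ = X + _]big1 => [|i /andP[_ ik]]; last by rewrite leqNgt ik mul0r.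
  rewrite add0r -{2}[k : nat]add0n big_addn -(big_mkord xpredT (fun j => F k j)).
  rewrite (@big_cat_nat _ _ _ (N.+1 - k))//= ?leq_subr// [X in _ + X]big_nat.
  rewrite [X in _ + X]big1 ?addr0; last by move=> i /andP[h _]; rewrite F0//; lia.
  by apply: eq_bigr => i _; rewrite leq_addl addnK mul1r.
under eq_bigr do rewrite E.
rewrite exchange_big; apply: eq_bigr => n _ /=.
rewrite (big_ord_widen N.+1 (fun k => F k (n - k)%N))// [RHS]big_mkcond/=.
by apply: eq_bigr => k _; rewrite ltnS; case: leqP => _; rewrite ?mul1r ?mul0r.
Qed.

Lemma sum_words_t c (T : word -> C) N :
  sum_words N (fun w => tseries c w * T w) = \sum_(k < N.+1) c k * T (nseq k false).
Proof.
apply: eq_bigr => k _; rewrite (bigD1 [tuple of nseq k false])//= big1 ?addr0.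
  by rewrite /tseries size_nseq eqxx.
move=> w wk; rewrite /tseries size_tuple; case: eqP => [e|_]; last by rewrite mul0r.
by case/eqP: wk; exact: val_inj.
Qed.

Definition act c x : ncs := ncact (tseries c) x.

Lemma actE c x v N : (size v <= N)%N ->
  act c x v = \sum_(k < N.+1) c k * iter k (ncad t) x v.
Proof.
pose T w := foldr (fun (l : bool) y => ncad (if l then a else t) y) x w.
have oT w : ord_ge (size w) (T w).
  elim: w => //= l w IH; rewrite -add1n; apply: ord_ncad IH.
  by case: l; [exact: ord_a|exact: ord_t].
move=> vN; rewrite /act -[ncact _ _]/(wsum T (tseries c)) (wsumE oT _ vN) sum_words_t.
apply: eq_bigr => k _; congr (_ * _ v).
by elim: (k : nat) => //= n ->.
Qed.

Lemma ord_act c n x : ord_ge n x -> ord_ge n (act c x).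
Proof.
move=> xn w wn; rewrite (actE c x (leqnn _)) big1// => k _.
by rewrite (@ord_iter_ad n k x xn) ?mulr0//; lia.
Qed.

Lemma iter_adD k x y : iter k (ncad t) (x + y) = iter k (ncad t) x + iter k (ncad t) y.
Proof. by elim: k => //= k ->; rewrite ncadDr. Qed.
Lemma iter_adZ k (l : C) x : iter k (ncad t) (l *: x) = l *: iter k (ncad t) x.
Proof. by elim: k => //= k ->; rewrite ncadZr. Qed.

Lemma clin_act c : clin (act c).
Proof.
split=> [x y|k x|n x xn]; last exact: ord_act.
- apply/funext => v; rewrite ncDE !(actE c _ (leqnn (size v))) -big_split.
  by apply: eq_bigr => i _; rewrite iter_adD ncDE mulrDr.
- apply/funext => v; rewrite ncZE !(actE c _ (leqnn (size v))) mulr_sumr.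
  by apply: eq_bigr => i _; rewrite iter_adZ ncZE mulrCA.
Qed.

Lemma ord_act_trunc c x N :
  ord_ge N.+1 (act c x - \sum_(k < N.+1) c k *: iter k (ncad t) x).
Proof.
move=> w wN; rewrite ncBE nc_sumE (actE c x (N := N))//.
by apply/eqP; rewrite subr_eq0; apply/eqP/eq_bigr => i _.
Qed.

Lemma clin_actE L c x v N : clin L -> (size v <= N)%N ->
  L (act c x) v = \sum_(k < N.+1) c k * L (iter k (ncad t) x) v.
Proof.
move=> cL vN; have := clin_ord cL (@ord_act_trunc c x N) (w := v).
rewrite (clinB _ _ cL) (clin_sum _ _ _ cL) ncBE nc_sumE ltnS => /(_ vN)/eqP.
rewrite subr_eq0 => /eqP ->; apply: eq_bigr => i _.
by rewrite (clinZ cL).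
Qed.

Lemma act_act c d x : act c (act d x) = act (cauchy c d) x.
Proof.
apply/funext => v; rewrite (clin_actE d x (clin_act c) (leqnn _)) (actE _ _ (leqnn _)).
transitivity (\sum_(j < (size v).+1) \sum_(k < (size v).+1) d j * c k * iter (k + j) (ncad t) x v).
  apply: eq_bigr => j _; rewrite (actE _ _ (leqnn _)) mulr_sumr.
  by apply: eq_bigr => k _; rewrite iterD mulrA.
rewrite (@sum_triangle (size v) (fun j k => d j * c k * iter (k + j) (ncad t) x v)).
  rewrite cauchyC; apply: eq_bigr => n _; rewrite mulr_suml; apply: eq_bigr => k _.
  by rewrite subnK// leq_ord.
move=> k j kj; rewrite (@ord_iter_ad 0 (j + k) x (@ord_ge0 R x)) ?mulr0//.
by rewrite addn0 addnC.
Qed.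

Lemma actD c d x : act (fun k => c k + d k) x = act c x + act d x.
Proof.
apply/funext => v; rewrite ncDE !(actE _ _ (leqnn _)) -big_split.
by apply: eq_bigr => i _; rewrite mulrDl.
Qed.

Lemma actZ (l : C) c x : act (fun k => l * c k) x = l *: act c x.
Proof.
apply/funext => v; rewrite ncZE !(actE _ _ (leqnn _)) mulr_sumr.
by apply: eq_bigr => i _; rewrite mulrA.
Qed.

Lemma act_cst1 x : act (cst_coef 1) x = x.
Proof.
apply/funext => v; rewrite (actE _ _ (leqnn _)) big_ord_recl/= mul1r big1 ?addr0// => i _.
by rewrite mul0r.
Qed.

Lemma ad_act c x : ncad t (act c x) = act (shift_coef c) x.
Proof.
apply/funext => v; rewrite (clin_actE c x (clin_ncad t) (leqnn _)) (actE _ _ (leqnn _)).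
rewrite big_ord_recr [RHS]big_ord_recl/= mul0r add0r.
rewrite -[ncad t _]/(iter (size v).+1 (ncad t) x).
by rewrite (@ord_iter_ad 0 (size v).+1 x (@ord_ge0 R x)) ?mulr0 ?addr0// addn0.
Qed.

Lemma act_t c : act c t = c 0%N *: t.
Proof.
apply/funext => v; rewrite ncZE (actE _ _ (leqnn _)) big_ord_recl/= big1 ?addr0// => i _.
have -> : ncad t (iter i (ncad t) t) = 0; last by rewrite mulr0.
elim: (i : nat) => [|n IH]; first by rewrite ncadxx.
by rewrite iterS IH ncad0r.
Qed.

Lemma hom_ad M x (J : C) : clin M -> (forall x y, M (nmul x y) = nmul (M x) (M y)) ->
  M t = J *: t -> M (ncad t x) = J *: ncad t (M x).
Proof. by move=> cM hM Mt; rewrite ncadE (clinB _ _ cM) !hM Mt -ncadZl. Qed.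

Lemma hom_act M c x (J : C) : clin M -> (forall x y, M (nmul x y) = nmul (M x) (M y)) ->
  M t = J *: t -> M (act c x) = act (fun k => c k * J ^+ k) (M x).
Proof.
move=> cM hM Mt; apply/funext => v.
rewrite (clin_actE c x cM (leqnn _)) (actE _ _ (leqnn _)); apply: eq_bigr => k _.
have -> : M (iter k (ncad t) x) = J ^+ k *: iter k (ncad t) (M x).
  elim: (k : nat) => [|n IH]; first by rewrite expr0 scale1r.
  by rewrite !iterS (hom_ad _ cM hM Mt) IH ncadZr scalerA -exprS.
by rewrite ncZE mulrA.
Qed.

(** A derivation that kills t commutes with ad_t. *)
Lemma der_act D c x : clin D -> mder id D -> D t = 0 -> D (act c x) = act c (D x).
Proof.
move=> cD mD Dt; apply/funext => v.
rewrite (clin_actE c x cD (leqnn _)) (actE _ _ (leqnn _)); apply: eq_bigr => k _; congr (_ * _ v).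
elim: (k : nat) => //= n IH; rewrite -IH ncadE (clinB _ _ cD) !mD Dt.
by rewrite nmul0l nmul0r add0r addr0.
Qed.

Definition tp n : ncs := mono R (nseq n false).

Lemma tseriesE c v N : (size v <= N)%N -> tseries c v = \sum_(k < N.+1) c k * tp k v.
Proof.
move=> vN; rewrite /tseries /tp /mono; case: eqP => [e|ne].
  have h : (size v < N.+1)%N by [].
  rewrite (bigD1 (Ordinal h))//= -e eqxx mulr1 big1 ?addr0// => k; rewrite -val_eqE/= => kv.
  case: eqP => [e'|_]; last by rewrite mulr0.
  by move: kv; rewrite e' size_nseq eqxx.
rewrite big1// => k _; case: eqP => [e'|_]; last by rewrite mulr0.
by case: ne; rewrite e' size_nseq.
Qed.

Lemma clin_tseriesE L c v N : clin L -> (size v <= N)%N ->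
  L (tseries c) v = \sum_(k < N.+1) c k * L (tp k) v.
Proof.
move=> cL vN.
have o : ord_ge N.+1 (tseries c - \sum_(k < N.+1) c k *: tp k).
  move=> w wN; rewrite ncBE nc_sumE (@tseriesE c w N)//.
  by apply/eqP; rewrite subr_eq0; apply/eqP/eq_bigr => i _.
have := clin_ord cL o (w := v).
rewrite (clinB _ _ cL) (clin_sum _ _ _ cL) ncBE nc_sumE ltnS => /(_ vN)/eqP.
rewrite subr_eq0 => /eqP ->; apply: eq_bigr => i _.
by rewrite (clinZ cL).
Qed.

Lemma tpD m n : nmul (tp m) (tp n) = tp (m + n).
Proof. by rewrite /tp nmul_mono nseqD. Qed.

Lemma tseriesM c d : nmul (tseries c) (tseries d) = tseries (cauchy c d).
Proof.
apply/funext => v; rewrite (clin_tseriesE d (clin_mull _) (leqnn _)) (tseriesE _ (leqnn _)).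
transitivity (\sum_(j < (size v).+1) \sum_(k < (size v).+1) d j * c k * tp (k + j) v).
  apply: eq_bigr => j _; rewrite (clin_tseriesE c (clin_mulr _) (leqnn _)) mulr_sumr.
  by apply: eq_bigr => k _; rewrite tpD mulrA.
rewrite (@sum_triangle (size v) (fun j k => d j * c k * tp (k + j) v)).
  rewrite cauchyC; apply: eq_bigr => n _; rewrite mulr_suml; apply: eq_bigr => k _.
  by rewrite subnK// leq_ord.
move=> k j kj; rewrite /tp (@ord_mono R (nseq (j + k) false)) ?mulr0//.
by rewrite size_nseq addnC.
Qed.

Lemma tseries_cst1 : tseries (cst_coef 1) = one.
Proof.
apply/funext => v; rewrite (tseriesE _ (leqnn _)) big_ord_recl/= mul1r big1 ?addr0// => i _.
by rewrite mul0r.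
Qed.

Lemma tseries_cancel c x y : c 0%N != 0 -> nmul x (tseries c) = nmul y (tseries c) -> x = y.
Proof.
move=> c0 /(congr1 (fun z => nmul z (tseries (inv_coef c)))).
by rewrite -!nmulA tseriesM cauchy_inv// tseries_cst1 !nmul1r.
Qed.

(** Left multiplication by t is the sum of ad_t and right multiplication by t, and these two
    operators commute. *)
Lemma tp_binomial n x : nmul (tp n) x =
  \sum_(k < n.+1) 'C(n, k)%:R *: nmul (iter k (ncad t) x) (tp (n - k)).
Proof.
elim: n => [|n IH]; first by rewrite big_ord1 /= scale1r nmul1l nmul1r.
have -> : nmul (tp n.+1) x = nmul t (nmul (tp n) x) by rewrite nmulA (tpD 1 n).
rewrite IH (clin_sum _ _ _ (clin_mull t)).
have E (k : 'I_n.+1) : nmul t ('C(n, k)%:R *: nmul (iter k (ncad t) x) (tp (n - k))) =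
    'C(n, k)%:R *: nmul (iter k.+1 (ncad t) x) (tp (n - k)) +
    'C(n, k)%:R *: nmul (iter k (ncad t) x) (tp (n.+1 - k)).
  rewrite nmulZr nmulA -scalerDr; congr (_ *: _).
  have -> : tp (n.+1 - k) = nmul t (tp (n - k)) by rewrite (tpD 1) add1n subSn// leq_ord.
  by rewrite nmulA -nmulDl /= ncadE subrK.
under eq_bigr do rewrite E.
rewrite big_split [RHS]big_ord_recl bin0 subn0.
rewrite [X in _ + X = _]big_ord_recl bin0 subn0 addrCA; congr (_ + _).
under [RHS]eq_bigr => k _ do rewrite /= /bump add1n binS natrD scalerDl subSS.
rewrite big_split [X in _ = X + _]big_ord_recr bin_small// scale0r /= addr0 addrC.
by congr (_ + _); apply: eq_bigr => k _.
Qed.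

Section Exp.
Variable s : C.
Local Notation E := (act (cexc s)).
Local Notation g := (tseries (cexc s)).

Lemma cexc_0 : cexc s 0%N = 1. Proof. by rewrite /cexc expr0 divr1. Qed.
Let g0 : cexc s 0%N != 0. Proof. by rewrite cexc_0 oner_neq0. Qed.

(** [E] is conjugation by g = e(s t), written without an inverse; its multiplicativity then follows
    by cancelling g. *)
Lemma exp_conj x : nmul (E x) g = nmul g x.
Proof.
apply/funext => v.
rewrite (clin_actE _ x (clin_mulr g) (leqnn _)) (clin_tseriesE _ (clin_mulr x) (leqnn _)).
transitivity (\sum_(k < (size v).+1) \sum_(j < (size v).+1)
    cexc s k * cexc s j * nmul (iter k (ncad t) x) (tp j) v).
  apply: eq_bigr => k _; rewrite (clin_tseriesE _ (clin_mull _) (leqnn _)) mulr_sumr.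
  by apply: eq_bigr => j _; rewrite mulrA.
rewrite (@sum_triangle (size v) (fun k j => cexc s k * cexc s j * nmul (iter k (ncad t) x) (tp j) v)).
  apply: eq_bigr => n _; rewrite tp_binomial nc_sumE mulr_sumr; apply: eq_bigr => k _.
  rewrite ncZE mulrA; congr (_ * _); rewrite /cexc.
  have kn : (k <= n)%N by rewrite leq_ord.
  have h : 'C(n, k)%:R * (k`!%:R * (n - k)`!%:R) = n`!%:R :> C by rewrite -!natrM bin_fact.
  have -> : (twopii R * s) ^+ n = (twopii R * s) ^+ k * (twopii R * s) ^+ (n - k) by rewrite -exprD subnKC.
  have n0 := @fact_neq0 R n; have k0 := @fact_neq0 R k; have j0 := @fact_neq0 R (n - k).
  move: n0; rewrite -h; move: (_ ^+ k) (_ ^+ (n - k)) k0 j0.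
  move: (k`!%:R) ((n - k)`!%:R) ('C(n, k)%:R) => p q b X Y p0 q0 n0.
  have b0 : b != 0 by apply: contraNneq n0 => ->; rewrite mul0r.
  by field; rewrite p0 q0 b0.
move=> k j kj; have o1 := @ord_iter_ad 0 k x (@ord_ge0 R x); rewrite addn0 in o1.
by rewrite (ord_nmul o1 (@ord_mono R (nseq j false))) ?mulr0// size_nseq.
Qed.

Lemma expM x y : E (nmul x y) = nmul (E x) (E y).
Proof. by apply: (tseries_cancel g0); rewrite exp_conj -nmulA exp_conj !nmulA exp_conj. Qed.

Lemma exp1 : E one = one.
Proof. by apply: (tseries_cancel g0); rewrite exp_conj nmul1l nmul1r. Qed.

Lemma exp_t : E t = t. Proof. by rewrite act_t cexc_0 scale1r. Qed.

(** This is (e(s ad_t) - 1)/ad_t applied to a, cf. [ad_hser]. *)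
Definition hser : ncs := act (fun k => cexc s k.+1) a.

Lemma ad_hser : ncad t hser = E a - a.
Proof.
apply/eqP; rewrite eq_sym subr_eq /hser ad_act -[X in _ + X]act_cst1 -actD; apply/eqP.
congr act; apply/funext => -[|k] /=; first by rewrite add0r cexc_0.
by rewrite addr0.
Qed.

Definition nopure x := forall n, x (nseq n false) = 0.

Lemma nopure_mulr x y : nopure x -> nopure (nmul x y).
Proof.
move=> h n; rewrite /nmul big_nat big1// => i /andP[_]; rewrite size_nseq ltnS => i_n.
by rewrite take_nseq// h mul0r.
Qed.
Lemma nopure_mull x y : nopure x -> nopure (nmul y x).
Proof.
by move=> h n; rewrite /nmul big1// => i _; rewrite drop_nseq h mulr0.
Qed.
Lemma nopureB x y : nopure x -> nopure y -> nopure (x - y).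
Proof. by move=> hx hy n; rewrite ncBE hx hy subrr. Qed.
Lemma nopure_a : nopure a. Proof. by case. Qed.

Lemma nopure_act c x : nopure x -> nopure (act c x).
Proof.
move=> hx n; rewrite (actE _ _ (leqnn _)) big1// => k _.
have it m : nopure (iter m (ncad t) x).
  by elim: m => //= m IH; apply: nopureB; [exact: nopure_mull|exact: nopure_mulr].
by rewrite it mulr0.
Qed.

Lemma nopure_ddt x : nopure (ddt a x).
Proof.
move=> n; rewrite /ddt /ncder /sum_words big1// => k _; rewrite big1// => w _.
rewrite /ncder_word nc_sumE big1 ?mulr0// => i _.
apply/nopure_mull/nopure_mulr; case: nth => //; exact: nopure_a.
Qed.

Lemma nmul_rcons x y l w :
  nmul x y (rcons w l) = nmul x (fun u => y (rcons u l)) w + x (rcons w l) * y [::].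
Proof.
rewrite /nmul size_rcons big_nat_recr//= take_oversize ?size_rcons// drop_oversize ?size_rcons//.
congr (_ + _); rewrite !big_nat; apply: eq_bigr => i /andP[_ iw].
by rewrite -cats1 takel_cat// drop_cat; move: iw; rewrite ltnS leq_eqVlt => /orP[/eqP ->|->];
  rewrite ?ltnn ?subnn ?drop_size ?cats1.
Qed.

(** Comparing coefficients in t z = z t moves a trailing t of a word to its front, and kills the
    words that end in a. Only the powers of t could survive, and [nopure] excludes them. *)
Lemma centralizer_t z : ncad t z = 0 -> nopure z -> z = 0.
Proof.
move=> tz hz.
have zt u : z u = nmul z t (false :: u).
  have := congr1 (fun f => f (false :: u)) tz; rewrite ncadE ncBE nc0E nmul_cons {1}/nct {1}/mono mul0r add0r.
  by rewrite /nct mono_cons nmul1l => /eqP; rewrite subr_eq0 => /eqP.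
have ztE u l : nmul z t (rcons u l) = (l == false)%:R * z u.
  rewrite nmul_rcons (_ : t [::] = 0)// mulr0 addr0.
  have -> : (fun u => t (rcons u l)) = (l == false)%:R *: one.
    apply/funext => v; rewrite ncZE /nct /mono -[[:: false]]/(rcons [::] false) eqseq_rcons mulrC.
    by case: (v == [::]); rewrite ?mul1r ?mul0r.
  by rewrite nmulZr nmul1r.
have z0 j v : z (v ++ true :: nseq j false) = 0.
  elim: j v => [|j IH] v; first by rewrite zt cats1 -rcons_cons ztE mul0r.
  have -> : v ++ true :: nseq j.+1 false = rcons (v ++ true :: nseq j false) false.
    by rewrite rcons_cat/= -[in RHS]cats1 -(nseqD j 1) addn1.
  by rewrite zt -rcons_cons ztE eqxx mul1r -cat_cons IH.
apply/funext => w; rewrite nc0E.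
suff [[n ->]|[j [v ->]]] : (exists n, w = nseq n false) \/ (exists j v, w = v ++ true :: nseq j false) by [].
elim/last_ind: w => [|w [] IH]; first by left; exists 0%N.
  by right; exists 0%N, w; rewrite cats1.
case: IH => [[n ->]|[j [v ->]]].
  by left; exists n.+1; rewrite -cats1 -(nseqD n 1) addn1.
right; exists j.+1, v.
by rewrite rcons_cat/= -[in LHS]cats1 -(nseqD j 1) addn1.
Qed.

Lemma tseries_comm_t c : nmul t (tseries c) = nmul (tseries c) t.
Proof.
have -> : t = tseries (shift_coef (cst_coef 1)).
  apply/funext => v; rewrite (tseriesE (N := (size v).+1) _ (leqnSn _)).
  rewrite !big_ord_recl big1 => [|i _]; last by rewrite /= mul0r.
  by rewrite /= mul0r mul1r add0r addr0.
by rewrite !tseriesM cauchyC.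
Qed.

Lemma ddtM x y : ddt a (nmul x y) = nmul (ddt a x) y + nmul x (ddt a y).
Proof. by apply: derM => //; exact: ord_a. Qed.
Lemma ddt_t : ddt a t = a. Proof. by apply: der_t => //; exact: ord_a. Qed.
Lemma ddt_a : ddt a a = 0. Proof. by apply: der_a => //; exact: ord_a. Qed.

(* The derivative of the exponential, D(e^st) = ((e^(s ad_t) - 1)/ad_t . a) e^st for
   D = a d/dt; both sides have the same commutator with t. *)
Lemma ddt_exp : ddt a g = nmul hser g.
Proof.
apply/eqP; rewrite -subr_eq0; apply/eqP; apply: centralizer_t; last first.
  apply: nopureB; first exact: nopure_ddt.
  by apply: nopure_mulr; apply: nopure_act; exact: nopure_a.
rewrite ncadE nmulBl nmulBr.
have h1 : nmul t (ddt a g) - nmul (ddt a g) t = nmul g a - nmul a g.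
  have := congr1 (ddt a) (tseries_comm_t (cexc s)); rewrite !ddtM ddt_t => h.
  apply/eqP; rewrite subr_eq addrAC eq_sym subr_eq addrC [X in _ == X]addrC.
  by rewrite -h.
have h2 : nmul t (nmul hser g) - nmul (nmul hser g) t = nmul g a - nmul a g.
  rewrite nmulA -[nmul (nmul hser g) t]nmulA -tseries_comm_t nmulA -nmulBl -ncadE ad_hser.
  by rewrite nmulBl exp_conj.
rewrite -h1 in h2; apply/funext => v; have := congr1 (fun f : ncs => f v) h2; rewrite !ncBE nc0E.
move: (nmul t (nmul hser g) v) (nmul (nmul hser g) t v) (nmul t (ddt a g) v) (nmul (ddt a g) t v) => p q p' q' e.
have -> : p' - p - (q' - q) = (p' - q') - (p - q) by ring.
by rewrite e subrr.
Qed.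

(** The derivation a d/dt kills a; applied to E(a) g = g a, with [ddt_exp] for g, it gives the
    bracket after cancelling g. *)
Lemma ddt_exp_a : ddt a (E a) = ncad hser (E a).
Proof.
apply: (tseries_cancel g0).
have := congr1 (ddt a) (exp_conj a); rewrite !ddtM ddt_a nmul0r addr0 ddt_exp => h.
rewrite ncadE nmulBl -[X in X - _]nmulA exp_conj nmulA -h nmulA.
by rewrite addrK.
Qed.

End Exp.
End NcAction.

(** * The automorphisms and the connection *)

Section Automorphism.
Context {R : realType}.
Local Notation C := (Cplx R).
Local Notation ncs := (ncseries R).
Local Notation one := (mono R [::]).
Local Notation t := (nct R).
Local Notation a := (nca R).
Local Notation I2 := (twopii R).
Implicit Types (x y z U V : ncs) (v w : word) (L M D : ncs -> ncs) (h : nat -> C).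

Lemma plieP x : plie x <-> forall n, exists2 y, freeLie y & ord_ge n (x - y).
Proof.
split=> h n; have [y fy hy] := h n; exists y => // w wn.
  by rewrite ncBE hy// subrr.
by have := hy w wn; rewrite ncBE => /eqP; rewrite subr_eq0 => /eqP.
Qed.

Lemma plie_free x : freeLie x -> plie x.
Proof. by move=> fx n; exists x. Qed.

Lemma plie_lim x : (forall n, exists2 y, plie y & ord_ge n (x - y)) -> plie x.
Proof.
move=> h; apply/plieP => n; have [y /plieP/(_ n)[z fz hz] hy] := h n.
by exists z => //; rewrite -(subrK y x) -addrA; exact: ordD.
Qed.

Lemma plieD x y : plie x -> plie y -> plie (x + y).
Proof.
move=> /plieP hx /plieP hy; apply/plieP => n.
have [x' fx' hx'] := hx n; have [y' fy' hy'] := hy n.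
by exists (x' + y'); [exact: freeLie_add|rewrite opprD addrACA; exact: ordD].
Qed.

Lemma plieZ (k : C) x : plie x -> plie (k *: x).
Proof.
move=> /plieP hx; apply/plieP => n; have [x' fx' hx'] := hx n.
by exists (k *: x'); [exact: freeLie_scale|rewrite -scalerBr; exact: ordZ].
Qed.

Lemma plie_ncad x y : plie x -> plie y -> plie (ncad x y).
Proof.
move=> /plieP hx /plieP hy; apply/plieP => n.
have [x' fx' hx'] := hx n; have [y' fy' hy'] := hy n.
exists (ncad x' y'); first exact: freeLie_bracket.
have -> : ncad x y - ncad x' y' = ncad (x - x') y + ncad x' (y - y').
  by rewrite ncadDl ncadDr ncadNl (clinN _ (clin_ncad x')) addrA subrK.
apply: ordD; last exact: (@ord_ncad R 0).
by rewrite -[n]addn0; apply: ord_ncad.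
Qed.

Lemma plie_sum n (F : 'I_n -> ncs) : (forall i, plie (F i)) -> plie (\sum_(i < n) F i).
Proof.
move=> hF; apply: big_ind => //; last exact: plieD.
by rewrite -(scale0r (t : ncs)); apply/plieZ/plie_free/freeLie_t.
Qed.

Lemma plie_act c x : plie x -> plie (act c x).
Proof.
move=> hx; apply: plie_lim => n.
exists (\sum_(k < n.+1) c k *: iter k (ncad t) x); last exact: (@ord_geW R _ _ _ (leqnSn n) (@ord_act_trunc R c x n)).
apply: plie_sum => k; apply: plieZ; elim: (k : nat) => //= j IH.
by apply: plie_ncad IH; apply/plie_free/freeLie_t.
Qed.

Lemma plie_subst U V x : ord_ge 1 U -> ord_ge 1 V -> plie U -> plie V ->
  plie x -> plie (ncsubst U V x).
Proof.
move=> U1 V1 hU hV hx; have cS := clin_subst U V.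
have hf y : freeLie y -> plie (ncsubst U V y).
  elim=> [||y1 y2 _ h1 _ h2|k y1 _ h1|y1 y2 _ h1 _ h2].
  - by rewrite subst_t.
  - by rewrite subst_a.
  - by rewrite (clinD cS); exact: plieD.
  - by rewrite (clinZ cS); exact: plieZ.
  - by rewrite ncadE (clinB _ _ cS) !substM//; exact: plie_ncad.
apply: plie_lim => n; have /plieP/(_ n)[y fy hy] := hx.
exists (ncsubst U V y); first exact: hf.
by rewrite -(clinB _ _ cS); exact: clin_ord.
Qed.

(** The three parameters are independent, so that the family contains right inverses of its members
    ([SmapK]); the automorphy factor has kap = 2 pi i c. *)
Definition Smap (J kap rho : C) : ncs -> ncs :=
  ncsubst (J *: t) (J^-1 *: act (cexc rho) a + kap *: t).

Section Fixed.
Variables J kap rho : C.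
Hypothesis J0 : J != 0.
Local Notation S := (Smap J kap rho).
Local Notation E := (act (cexc rho)).

Let U1 : ord_ge 1 (J *: t). Proof. by apply: ordZ; exact: ord_t. Qed.
Let V1 : ord_ge 1 (J^-1 *: E a + kap *: t).
Proof. by apply: ordD; apply: ordZ; [apply: ord_act; exact: ord_a|exact: ord_t]. Qed.

Lemma clin_Smap : clin S. Proof. exact: clin_subst. Qed.
Lemma SmapM x y : S (nmul x y) = nmul (S x) (S y). Proof. exact: substM. Qed.
Lemma Smap1 : S one = one. Proof. exact: subst1. Qed.
Lemma Smap_t : S t = J *: t. Proof. exact: subst_t. Qed.
Lemma Smap_a : S a = J^-1 *: E a + kap *: t. Proof. exact: subst_a. Qed.

Lemma Smap_act h x : S (act h x) = act (fun k => h k * J ^+ k) (S x).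
Proof. exact: (hom_act h x clin_Smap SmapM Smap_t). Qed.

Lemma Smap_ncad x y : S (ncad x y) = ncad (S x) (S y).
Proof. by rewrite ncadE (clinB _ _ clin_Smap) !SmapM. Qed.

Lemma plie_Smap x : plie x -> plie (S x).
Proof.
have pt : plie t by apply/plie_free/freeLie_t.
have pa : plie a by apply/plie_free/freeLie_a.
apply: plie_subst => //; first exact: plieZ.
by apply: plieD; apply: plieZ => //; exact: plie_act.
Qed.

Lemma exp_ncad x y : E (ncad x y) = ncad (E x) (E y).
Proof. by rewrite ncadE (clinB _ _ (clin_act _)) !expM. Qed.

Lemma Smap_act_a h : S (act h a) =
  J^-1 *: act (cauchy (fun k => h k * J ^+ k) (cexc rho)) a + (kap * h 0%N) *: t.
Proof.
rewrite Smap_act Smap_a (clinD (clin_act _)) !(clinZ (clin_act _)) act_act act_t scalerA.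
by rewrite expr0 mulr1.
Qed.

Lemma ord_iter_a k : ord_ge k (iter k (ncad t) a).
Proof. apply: (@ord_geW R k (k + 1)); first by rewrite addn1.
exact: (@ord_iter_ad R 1 k a (@ord_a R)). Qed.

Lemma ord_psi_elt m : ord_ge m (psi_elt R m) /\ ord_ge 1 (psi_elt R m).
Proof.
suff h : ord_ge (m + m).+1 (psi_elt R m).
  by split; apply: (@ord_geW R _ _ _ _ h); lia.
rewrite /psi_elt big_nat; apply: ord_sum => j /andP[j1 j2]; apply: ordZ.
apply: (@ord_geW R _ (j + (2 * m + 1 - j))); first lia.
by apply: ord_ncad; exact: ord_iter_a.
Qed.

Lemma clin_dda (u : ncs) : clin (dda u). Proof. exact: clin_der. Qed.
Lemma dda_mder (u : ncs) : ord_ge 1 u -> mder id (dda u).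
Proof. by move=> u1 x y; exact: derM. Qed.
Lemma dda_t (u : ncs) : ord_ge 1 u -> dda u t = 0.
Proof. by move=> u1; exact: der_t. Qed.
Lemma dda_a (u : ncs) : ord_ge 1 u -> dda u a = u.
Proof. by move=> u1; exact: der_a. Qed.

Lemma ord_dda n (u : ncs) x : ord_ge n u -> ord_ge n (dda u x).
Proof.
move=> un v vn; rewrite /dda /ncder /sum_words big1// => k _; rewrite big1// => w _.
rewrite (_ : ncder_word 0 u w v = 0) ?mulr0//.
suff : ord_ge n (ncder_word 0 u w) by exact.
apply: ord_sum => i _; apply: (@ord_nmul R 0) => //; rewrite -[n]addn0.
by apply: ord_nmul => //; case: nth.
Qed.

(** The component kap t of S(a) is killed by the first ad_t, which is why k must be positive. *)
Lemma Smap_iter_a k : (0 < k)%N ->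
  S (iter k (ncad t) a) = (J ^+ k * J^-1) *: E (iter k (ncad t) a).
Proof.
case: k => // k _; elim: k => [|k IH]; rewrite iterS Smap_ncad Smap_t ncadZl.
  rewrite /= Smap_a ncadDr !ncadZr ncadxx scaler0 addr0 exp_ncad exp_t scalerA.
  by rewrite expr1.
rewrite IH ncadZr scalerA mulrA -exprS; congr (_ *: _).
by rewrite exp_ncad exp_t.
Qed.

Lemma Smap_psi_elt m : S (psi_elt R m) = (J ^+ (2 * m) * J^-1) *: E (psi_elt R m).
Proof.
rewrite /psi_elt (clin_sum _ _ _ clin_Smap) (clin_sum _ _ _ (clin_act _)) scaler_sumr.
rewrite !big_nat; apply: eq_bigr => j /andP[j1 j2].
rewrite (clinZ clin_Smap) (clinZ (clin_act _)) Smap_ncad !Smap_iter_a ?subn_gt0//.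
rewrite ncadZl ncadZr exp_ncad !scalerA; congr (_ *: _).
rewrite -[in RHS](_ : J ^+ j * J ^+ (2 * m + 1 - j) * J^-1 = J ^+ (2 * m)); first by ring.
by rewrite -exprD subnKC 1?ltnW// addn1 exprSr mulfK.
Qed.

(** Two derivations along S that kill t. On a, the left one commutes with the powers of ad_t in
    E(a), and both sides become multiples of E([psi_elt R m]), with exponents compared by
    [Smap_psi_elt]. *)
Lemma dda_Smap m x : J ^+ (2 * m) *: dda (psi_elt R m) (S x) = S (dda (psi_elt R m) x).
Proof.
have [om o1] := ord_psi_elt m.
apply: (mder_eq Smap1 (D := fun x => J ^+ (2 * m) *: dda (psi_elt R m) (S x))
  (D' := fun x => S (dda (psi_elt R m) x))).
- exact: clin_scale (clin_comp (clin_dda _) clin_Smap).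
- exact: clin_comp clin_Smap (clin_dda _).
- by apply: mder_scale; apply: mder_compl SmapM; exact: dda_mder.
- by apply: mder_compr SmapM; [exact: clin_Smap|exact: dda_mder].
- rewrite Smap_t (clinZ (clin_dda _)) dda_t// !scaler0.
  by rewrite (clin0 clin_Smap).
rewrite Smap_a (clinD (clin_dda _)) !(clinZ (clin_dda _)) dda_t// scaler0 addr0.
rewrite (der_act _ _ (clin_dda _) (dda_mder o1) (dda_t o1)) dda_a// Smap_psi_elt.
by rewrite scalerA.
Qed.

Lemma psi_tau_trunc tau x N : ord_ge N (psi_tau tau x - \sum_(1 <= m < N)
  (I2 ^+ (2 * m + 1) / (2 * m)`!%:R * Gseries (m + 1) tau) *: dda (psi_elt R m) x).
Proof.
move=> w wN; rewrite ncBE nc_sumE; apply/eqP; rewrite subr_eq0; apply/eqP.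
rewrite [RHS](@big_cat_nat _ _ _ (size w).+1)//= [X in _ = _ + X]big_nat.
rewrite [X in _ = _ + X]big1 ?addr0// => m /andP[wm _].
have [om _] := ord_psi_elt m.
by rewrite ncZE (@ord_dda m _ x om) ?mulr0.
Qed.

(** The weight 2m + 2 of the Eisenstein series provides J^(2m+2); the conjugation of the m-th
    derivation consumes J^(2m), and J^2 is left for every m. *)
Lemma psi_tau_Smap tau tau' x :
  (forall j, (1 < j)%N -> Gseries j tau' = J ^+ (2 * j) * Gseries j tau) ->
  psi_tau tau' (S x) = J ^+ 2 *: S (psi_tau tau x).
Proof.
move=> hG; apply/funext => v; rewrite ncZE.
have := clin_ord clin_Smap (@psi_tau_trunc tau x (size v).+1) (w := v).
rewrite (clinB _ _ clin_Smap) (clin_sum _ _ _ clin_Smap) ncBE nc_sumE => /(_ (leqnn _))/eqP.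
rewrite subr_eq0 => /eqP ->; rewrite mulr_sumr /psi_tau !big_nat.
apply: eq_bigr => m /andP[m1 _]; rewrite (clinZ clin_Smap) ncZE -dda_Smap ncZE hG; last lia.
rewrite (_ : 2 * (m + 1) = 2 + 2 * m)%N; last lia.
by rewrite [J ^+ (2 + _)]exprD; move: (I2 ^+ _) (J ^+ (2 * m)) (Gseries _ _) (dda _ _ v) (_`!%:R) => *; ring.
Qed.

End Fixed.

Lemma SmapK J kap rho x : J != 0 -> Smap J kap rho (Smap J^-1 (- kap) (- (rho / J)) x) = x.
Proof.
move=> J0; have J1 : J^-1 != 0 by rewrite invr_eq0.
apply: (hom_eq (M := fun x => Smap J kap rho (Smap J^-1 (- kap) (- (rho / J)) x)) (M' := id)) => //.
- exact: clin_comp (clin_Smap _ _ _) (clin_Smap _ _ _).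
- by rewrite !Smap1.
- by move=> y z; rewrite !SmapM.
- by rewrite Smap_t (clinZ (clin_Smap _ _ _)) Smap_t scalerA mulVf// scale1r.
rewrite Smap_a invrK (clinD (clin_Smap _ _ _)) !(clinZ (clin_Smap _ _ _)) Smap_t Smap_act_a.
have -> : (fun k => cexc (- (rho / J)) k * J ^+ k) = cexc (- rho).
  by apply/funext => k; rewrite cexc_scale mulNr divfK.
rewrite cexcD addNr cexc0 act_cst1 cexc_0 mulr1 scalerDr !scalerA mulfV// scale1r.
by rewrite -addrA -scalerDl mulNr mulrC subrr scale0r addr0.
Qed.

(** [SmapK] exhibits a preimage of y inside p, so [pinverse] returns a true preimage. *)
Lemma Smap_pinverse J kap rho y : J != 0 -> plie y ->
  Smap J kap rho (pinverse (Smap J kap rho) y) = y.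
Proof.
move=> J0 hy; rewrite /pinverse pinvK// inE.
exists (Smap J^-1 (- kap) (- (rho / J)) y); last exact: SmapK.
exact: plie_Smap.
Qed.

(* [n1, n2] and [N, P] are the d xi and d tau coefficients of nu at x and at
   g x, [dS] is the differential of S along (v1, v2), and (a1, a2) is the image
   of (v1, v2) under the differential of g. *)
Section Main.
Variables (J c rho v1 v2 : C) (h hg : nat -> C).
Hypothesis J0 : J != 0.
Hypothesis h0 : h 0%N = 1.
Hypothesis hgE : forall k, hg k = J ^+ k * cauchy (cexc (rho / J)) h k.
Local Notation S := (Smap J (I2 * c) rho).
Local Notation E := (act (cexc rho)).
Let I0 : I2 != 0. Proof. exact: twopii_neq0. Qed.
Let n1 := act h a.
Let n2 := I2^-1 *: act (fun k => k%:R * h k.+1) a.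
Let N := act hg a.
Let P := I2^-1 *: act (fun k => k%:R * hg k.+1) a.

Lemma hg_cauchy : hg = cauchy (fun k => h k * J ^+ k) (cexc rho).
Proof.
apply/funext => k; rewrite hgE cauchyC mulrC -cauchy_scale; congr (cauchy _ _ k).
by apply/funext => i; rewrite cexc_scale divfK.
Qed.

Lemma Smap_n1 : S n1 = J^-1 *: N + (I2 * c) *: t.
Proof. by rewrite /n1 Smap_act_a h0 mulr1 /N hg_cauchy. Qed.

(** With generating series in eta, hg(eta) = h(J eta) e(rho eta). The identity is the Leibniz rule
    for eta d/deta in degree k + 1, minus hg itself; the constant term h_0 = 1 leaves
    [cexc rho k.+1]. *)
Lemma hg_deriv k : k%:R * hg k.+1 = I2 * rho * hg k
  + J * cauchy (fun k => k%:R * h k.+1 * J ^+ k) (cexc rho) k - cexc rho k.+1.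
Proof.
have e : k.+1%:R * hg k.+1 = I2 * rho * hg k + \sum_(i < k.+1) i.+1%:R * (h i.+1 * J ^+ i.+1) * cexc rho (k - i)%N.
  rewrite {1}hg_cauchy cauchy_deriv addrC; congr (_ + _); last first.
    by rewrite /cauchy big_ord_recl !mul0r add0r; apply: eq_bigr => i _.
  rewrite hg_cauchy /cauchy big_ord_recr/= subnn mul0r mulr0 addr0 mulr_sumr.
  apply: eq_bigr => i _; rewrite subSn ?leq_ord// /cexc exprS factS natrM.
  have f0 := @fact_neq0 R (k - i); have s0 : (k - i).+1%:R != 0 :> C by rewrite pnatr_eq0.
  move: f0 s0; move: (_`!%:R) (_.+1%:R) (_ ^+ (k - i)) (J ^+ i) => f s X j f0 s0.
  by field; rewrite f0 s0.
have e1 : hg k.+1 = cexc rho k.+1 + \sum_(i < k.+1) h i.+1 * J ^+ i.+1 * cexc rho (k - i)%N.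
  by rewrite {1}hg_cauchy /cauchy big_ord_recl h0 expr0 !mul1r subn0.
have -> : k%:R * hg k.+1 = k.+1%:R * hg k.+1 - hg k.+1 by rewrite -natr1; ring.
rewrite e {}e1 opprD addrA addrAC; congr (_ - _); rewrite -addrA; congr (_ + _).
rewrite /cauchy mulr_sumr -sumrB; apply: eq_bigr => i _.
by rewrite -natr1 exprS; ring.
Qed.

(** The correction [hser rho] stems from the constant term of h, and is exactly what the action of a
    d/dt on e(rho t) requires in [ddt_exp_a]. *)
Lemma P_eq : P = rho *: N + J ^+ 2 *: S n2 - I2^-1 *: hser rho.
Proof.
rewrite /n2 (clinZ (clin_Smap _ _ _)) Smap_act_a mul0r mulr0 scale0r addr0.
rewrite /P /N /hser -!actZ -actD.
have -> : - act (fun k => I2^-1 * cexc rho k.+1) a = act (fun k => -1 * (I2^-1 * cexc rho k.+1)) a.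
  by rewrite [RHS]actZ scaleN1r.
rewrite -actD; congr act; apply/funext => k; rewrite hg_deriv.
by move: (cauchy _ _ k) => X; field; rewrite J0 I0.
Qed.

Variable dS : ncs -> ncs.
Hypothesis cdS : clin dS.
Hypothesis mdS : mder S dS.
Hypothesis dS_t : dS t = (c * v2) *: t.
Hypothesis dS_a : dS a = (- c * v2 / J ^+ 2) *: E a + (I2 * c * v1 / J) *: ncad t (E a).
Variables psi psi' : ncs -> ncs.
Hypothesis psiE : forall x, psi' (S x) = J ^+ 2 *: S (psi x).

Let a1 := (v1 - rho / J * v2) / J.
Let a2 := v2 / J ^+ 2.

Lemma Smap_omega y z : S (v1 *: ncad n1 y + v2 *: (I2^-1 *: z + ncad n2 y)) =
  v1 *: ncad (S n1) (S y) + v2 *: (I2^-1 *: S z + ncad (S n2) (S y)).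
Proof.
have cS := clin_Smap J (I2 * c) rho.
by rewrite (clinD cS (v1 *: _)) (clinZ cS v1) (clinZ cS v2) (clinD cS (I2^-1 *: _)) (clinZ cS I2^-1) !Smap_ncad.
Qed.

Lemma connection_core x :
  a1 *: ncad N (S x) + a2 *: (I2^-1 *: ddt a (S x) + ncad P (S x)) =
  S (v1 *: ncad n1 x + v2 *: (I2^-1 *: ddt a x + ncad n2 x)) - dS x.
Proof.
have cS := clin_Smap J (I2 * c) rho; have hS := @SmapM J (I2 * c) rho.
have cD : clin (ddt a) by exact: clin_der.
have mD : mder id (ddt a) by exact: ddtM.
apply: (mder_eq (@Smap1 J (I2 * c) rho)
  (D := fun x => a1 *: ncad N (S x) + a2 *: (I2^-1 *: ddt a (S x) + ncad P (S x)))
  (D' := fun x => S (v1 *: ncad n1 x + v2 *: (I2^-1 *: ddt a x + ncad n2 x)) - dS x)).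
- apply: clin_add; first exact: clin_scale (clin_comp (clin_ncad N) cS).
  apply: clin_scale; apply: clin_add; first exact: clin_scale (clin_comp cD cS).
  exact: clin_comp (clin_ncad P) cS.
- apply: clin_sub cdS; apply: clin_comp cS _; apply: clin_add; first exact: clin_scale (clin_ncad n1).
  apply: clin_scale; apply: clin_add (clin_ncad n2); exact: clin_scale cD.
- apply: mder_add; first by apply: mder_scale; apply: mder_compl hS; exact: mder_ncad.
  apply: mder_scale; apply: mder_add; last by apply: mder_compl hS; exact: mder_ncad.
  by apply: mder_scale; apply: mder_compl hS.
- apply: mder_add; last first.
    by have := mder_scale (-1) mdS; congr mder; apply/funext => y; rewrite scaleN1r.
  apply: mder_compr hS => //; apply: mder_add; first by apply: mder_scale; exact: mder_ncad.
  apply: mder_scale; apply: mder_add; last exact: mder_ncad.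
  exact: mder_scale.
(* On t: the bracket of [hser] with t replaces a by E(a), and the term 2 pi i c t of S(a) cancels
   against dS(t). *)
- rewrite Smap_omega ddt_t Smap_a Smap_t dS_t.
  rewrite !ncadZr (clinZ cD) ddt_t P_eq Smap_n1 !ncadDl ncadNl !ncadZl ncadxx.
  have -> : ncad (hser rho) t = a - E a by rewrite ncadC ad_hser opprB.
  apply/funext => w; rewrite !(ncDE, ncNE, ncZE, nc0E) /a1 /a2.
  move: (ncad N t w) (ncad (S n2) t w) (E a w) (a w) (t w) => X1 X2 X3 X4 X5.
  by field; rewrite J0 I0.
(* On a: the brackets of [hser] with E(a) cancel. The surplus c E(a) matches the first term of
   dS(a), and the summand 2 pi i c t of S(n1) accounts for the second. *)
rewrite Smap_omega ddt_a (clin0 cS) dS_a.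
rewrite P_eq Smap_n1 !ncadDl ncadNl !ncadZl.
have -> : ncad (hser rho) (S a) = J^-1 *: ncad (hser rho) (E a) + (I2 * c) *: (a - E a).
  by rewrite Smap_a ncadDr !ncadZr [ncad _ t]ncadC ad_hser opprB.
have -> : ddt a (S a) = J^-1 *: ncad (hser rho) (E a) + (I2 * c) *: a.
  by rewrite Smap_a (clinD cD) !(clinZ cD) ddt_t ddt_exp_a.
have -> : ncad t (S a) = J^-1 *: ncad t (E a).
  by rewrite Smap_a ncadDr !ncadZr ncadxx scaler0 addr0.
apply/funext => w; rewrite !(ncDE, ncNE, ncZE, nc0E) /a1 /a2.
move: (ncad N (S a) w) (ncad (S n2) (S a) w) (ncad (hser rho) (E a) w) (ncad t (E a) w) (E a w) (a w).
move=> X1 X2 X3 X4 X5 X6.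
by field; rewrite J0 I0.
Qed.

(** The factor J^2 in [psiE] cancels the J^-2 of a2, so the psi terms agree separately and can be
    added to [connection_core]. *)
Lemma connection_equiv x :
  a1 *: ncad N (S x) + a2 *: (I2^-1 *: ddt a (S x) + psi' (S x) + ncad P (S x)) =
  S (v1 *: ncad n1 x + v2 *: (I2^-1 *: ddt a x + psi x + ncad n2 x)) - dS x.
Proof.
have cS := clin_Smap J (I2 * c) rho; have := connection_core x.
rewrite psiE -[_ + psi x + _]addrAC Smap_omega.
have -> : v1 *: ncad n1 x + v2 *: (I2^-1 *: ddt a x + ncad n2 x + psi x) =
  (v1 *: ncad n1 x + v2 *: (I2^-1 *: ddt a x + ncad n2 x)) + v2 *: psi x.
  by rewrite (scalerDr v2 _ (psi x)) addrA.
rewrite (clinD cS _ (v2 *: _)) Smap_omega (clinZ cS v2) => e.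
apply/funext => w; have := congr1 (fun f : ncs => f w) e.
rewrite !(ncDE, ncNE, ncZE, nc0E) /a2.
move: (ncad N (S x) w) (ddt a (S x) w) (ncad P (S x) w) (S (psi x) w) (ncad (S n1) (S x) w) (S (ddt a x) w) (ncad (S n2) (S x) w) (dS x w).
move=> X1 X2 X3 X4 X5 X6 X7 X8 e'.
transitivity (a1 * X1 + v2 / J ^+ 2 * (I2^-1 * X2 + X3) + v2 * X4).
  by move: (a1 * X1) => A; field; rewrite ?J0 ?I0.
by rewrite e'; ring.
Qed.

End Main.
End Automorphism.

Lemma det2 (A : 'M[int]_2) : \det A = A 0 0 * A 1 1 - A 0 1 * A 1 0.
Proof.
rewrite (expand_det_row _ 0) !big_ord_recl big_ord0 /cofactor !det_mx11 !mxE addr0.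
rewrite !expr0 !mul1r /bump/= expr1 mulN1r mulrN; congr (A _ _ * A _ _ - A _ _ * A _ _); exact: val_inj.
Qed.

Lemma SL2_det (A : SL2Z) : (val A : 'M[int]_2) 0 0 * (val A : 'M[int]_2) 1 1
  - (val A : 'M[int]_2) 0 1 * (val A : 'M[int]_2) 1 0 = 1.
Proof. by rewrite -det2; exact: (eqP (valP A)). Qed.

(** * Differentials of the action and of the automorphy factor *)

Section Differential.
Context {R : realType}.
Local Notation C := (Cplx R).
Implicit Types (f g : C * C -> C) (x v : C * C).

(** The value is paired with differentiability, without which ['d] carries no information. *)
Definition hasd f x v (l : C) := differentiable f x /\ 'd f x v = l.

Lemma hasd_eq f x v l l' : hasd f x v l -> l = l' -> hasd f x v l'.
Proof. by move=> h <-. Qed.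

Lemma hasdD f g x v l l' : hasd f x v l -> hasd g x v l' ->
  hasd (fun z => f z + g z) x v (l + l').
Proof.
move=> [df <-] [dg <-]; split; first exact: differentiableD.
exact: (congr1 (fun h : C * C -> C => h v) (diffD df dg)).
Qed.

Lemma hasdM f g x v l l' : hasd f x v l -> hasd g x v l' ->
  hasd (fun z => f z * g z) x v (l * g x + f x * l').
Proof.
move=> [df <-] [dg <-]; split; first exact: differentiableM.
have e : 'd (fun z => f z * g z) x v = f x * 'd g x v + g x * 'd f x v :=
  congr1 (fun h : C * C -> C => h v) (diffM df dg).
have h (p q k m : C) : p * q + k * m = m * k + p * q by ring.
exact: etrans e (h _ _ _ _).
Qed.

Lemma hasdV f x v l : hasd f x v l -> f x != 0 ->
  hasd (fun z => (f z)^-1) x v (- l / f x ^+ 2).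
Proof.
move=> [df <-] f0; split; first exact: differentiableV.
have e : 'd (fun z => (f z)^-1) x v = - f x ^- 2 * 'd f x v :=
  congr1 (fun h : C * C -> C => h v) (diffV df f0).
have h (p q : C) : - p^-1 * q = - q / p by ring.
exact: etrans e (h _ _).
Qed.

Lemma hasd_cst (k : C) x v : hasd (fun _ => k) x v 0.
Proof.
split; first exact: differentiable_cst.
exact: (congr1 (fun h : C * C -> C => h v) (diff_cst k x)).
Qed.

Lemma hasd_fst x v : hasd (fun z => z.1) x v v.1.
Proof.
have lin : linear (fun z : C * C => z.1) by [].
pose B := GRing.isLinear.Build _ _ _ _ _ lin.
pose L : {linear (C * C)%type -> C} := HB.pack (fun z : C * C => z.1) B.
have cL : continuous L by move=> z; exact: cvg_fst.
split; first exact: (linear_differentiable (f := L)).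
by have := diff_lin x cL => /(congr1 (fun h : C * C -> C => h v)).
Qed.

Lemma hasd_snd x v : hasd (fun z => z.2) x v v.2.
Proof.
have lin : linear (fun z : C * C => z.2) by [].
pose B := GRing.isLinear.Build _ _ _ _ _ lin.
pose L : {linear (C * C)%type -> C} := HB.pack (fun z : C * C => z.2) B.
have cL : continuous L by move=> z; exact: cvg_snd.
split; first exact: (linear_differentiable (f := L)).
by have := diff_lin x cL => /(congr1 (fun h : C * C -> C => h v)).
Qed.

Lemma hasd_sum (I : Type) (s : seq I) (P : pred I) (F : I -> C * C -> C) (l : I -> C) x v :
  (forall i, hasd (F i) x v (l i)) ->
  hasd (fun z => \sum_(i <- s | P i) F i z) x v (\sum_(i <- s | P i) l i).
Proof.
move=> h; elim: s => [|i s IH].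
  rewrite big_nil (_ : (fun z => _) = fun _ => 0); last by apply/funext => z; rewrite big_nil.
  exact: hasd_cst.
rewrite big_cons (_ : (fun z => _) = fun z => if P i then F i z + \sum_(j <- s | P j) F j z else \sum_(j <- s | P j) F j z); last first.
  by apply/funext => z; rewrite big_cons.
by case: (P i) => //; exact: hasdD.
Qed.

Lemma hasdZ (k : C) f x v l : hasd f x v l -> hasd (fun z => k * f z) x v (k * l).
Proof. by move=> h; apply: hasd_eq (hasdM (hasd_cst k x v) h) _; rewrite mul0r add0r. Qed.

Lemma hasdX f x v l n : hasd f x v l ->
  hasd (fun z => f z ^+ n) x v (n%:R * f x ^+ n.-1 * l).
Proof.
move=> h; elim: n => [|n IH]; first by rewrite !mul0r; exact: hasd_cst.
rewrite (_ : (fun z => _) = fun z => f z * f z ^+ n); last by apply/funext => z; rewrite exprS.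
apply: hasd_eq (hasdM h IH) _; case: n {IH} => [|n] /=; first by rewrite expr0; ring.
by rewrite -[n.+2%:R]natr1 exprS; ring.
Qed.

(** The differential depends on the germ only. This is used for M~, whose closed form holds where J
    does not vanish, an open set. *)
Lemma near_hasd f g x v l : (\forall z \near x, f z = g z) -> hasd g x v l -> hasd f x v l.
Proof.
move=> fg [dg dgl].
have e : f \o shift x = cst (f x) + 'd g x +o_ (0 : C * C) id.
  apply/eqaddoP => eps eps0.
  have h := diff_locally dg; move/eqaddoP : h => /(_ eps eps0).
  have fg0 : \forall h \near (0 : C * C), f (h + x) = g (h + x).
    have h0 := fg; rewrite (near_shift 0 x) in h0; apply: filterS h0 => z.
    by rewrite /= subr0.
  apply: filterS2 fg0 => h.
  have -> : f x = g x := nbhs_singleton fg.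
  by rewrite /= !fctE /= => ->.
have de := diff_unique (diff_continuous dg) e.
split; last by rewrite de.
apply/diff_locallyP; rewrite de; split; [exact: diff_continuous|exact: e].
Qed.

Lemma hasd_continuous f x v l : hasd f x v l -> f x != 0 -> \forall z \near x, f z != 0.
Proof.
move=> [df _] f0; have cf := differentiable_continuous df.
have h : \forall y \near f x, y != 0.
  apply/nearC_P; exists (nrm (f x)); first by rewrite nrm_gt0.
  by move=> y; apply: contraTneq => ->; rewrite sub0r nrmN ltxx.
exact: cf h.
Qed.

Section AtPoint.
Local Notation ncs := (ncseries R).
Local Notation one := (mono R [::]).
Local Notation t := (nct R).
Local Notation a := (nca R).
Local Notation I2 := (twopii R).
Variables (A : SL2Z) (u : 'rV[int]_2) (x v : C * C).
Local Notation g := ((A, u) : jacgrp).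
Hypothesis x_uhp : uhp x.2.
Let c : C := entry A 1 0.
Let d : C := entry A 1 1.
Let m : C := (u 0 0)%:~R.
Let n : C := (u 0 1)%:~R.
Let J (z : C * C) : C := c * z.2 + d.
(* M~_g = e(rho t) o M_gamma, with rho = c xi + c n - d m independent of tau. *)
Let rho (z : C * C) : C := c * z.1 + (c * n - d * m).

Lemma J_neq0 : J x != 0.
Proof. exact: (jfac_neq0 x_uhp (SL2_det A)). Qed.
Let J0 := J_neq0.

Lemma hasd_J : hasd J x v (c * v.2).
Proof. by have := hasdD (hasdZ c (hasd_snd x v)) (hasd_cst d x v); rewrite addr0. Qed.

Lemma hasd_rho : hasd rho x v (c * v.1).
Proof. by have := hasdD (hasdZ c (hasd_fst x v)) (hasd_cst (c * n - d * m) x v); rewrite addr0. Qed.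

(** In the tau component the quotient rule produces a d - b c = 1; in the xi component the terms m c
    tau cancel and leave rho. *)
Lemma diff_act : 'd (jacgrp_act g) x v =
  ((v.1 - rho x / J x * v.2) / J x, v.2 / J x ^+ 2).
Proof.
have h1 : hasd (fun z => (z.1 + m * z.2 + n) * (J z)^-1) x v ((v.1 - rho x / J x * v.2) / J x).
  have h := hasdM (hasdD (hasdD (hasd_fst x v) (hasdZ m (hasd_snd x v))) (hasd_cst n x v)) (hasdV hasd_J J0).
  apply: hasd_eq h _; rewrite addr0 /rho; move: J0; rewrite /J; move: x => [x1 x2] /= h.
  by field; exact: h.
have h2 : hasd (fun z => (entry A 0 0 * z.2 + entry A 0 1) * (J z)^-1) x v (v.2 / J x ^+ 2).
  have h := hasdM (hasdD (hasdZ (entry A 0 0) (hasd_snd x v)) (hasd_cst (entry A 0 1) x v)) (hasdV hasd_J J0).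
  have e : entry A 0 0 * d - entry A 0 1 * c = 1 by exact: (detC (R := R) (SL2_det A)).
  apply: hasd_eq h _; rewrite addr0; transitivity ((entry A 0 0 * d - entry A 0 1 * c) * v.2 / J x ^+ 2).
    move: J0; rewrite /J; move: x => [x1 x2] /= h; by field; exact: h.
  by rewrite e mul1r.
have [d1 <-] := h1; have [d2 <-] := h2.
exact: (congr1 (fun h : C * C -> C * C => h v) (diff_pair d1 d2)).
Qed.

Let S (z : C * C) := Smap (J z) (I2 * c) (rho z).

(** The two exponentials in t combine to e((l - m) t). Moving it past M_gamma scales t by J, and (l
    - m) J = rho. *)
Lemma Mtilde_Smap z y : J z != 0 -> Mtilde g z y = S z y.
Proof.
move=> Jz; have Jz' : jfactor A z.2 = J z by [].
set l := entry A 1 0 * (act_trans u z).1 / jfactor A (act_trans u z).2.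
have e : (l - m) * J z = rho z.
  by rewrite /l /rho /act_trans/= Jz' mulrBl divfK// /J -/c -/m -/n; ring.
have Ma : Mauto A z.2 = Smap (J z) (I2 * c) 0.
  by rewrite /Mauto /Smap cexc0 act_cst1 Jz'.
have E w : Mtilde g z w = Smap (J z) (I2 * c) 0 (act (cexc l) (act (cexc (- m)) w)).
  by rewrite -Ma.
have cE (s : C) := clin_act (cexc s) : clin (act (cexc s) : ncs -> ncs).
apply: (hom_eq (M := Mtilde g z) (M' := S z)).
- rewrite (_ : Mtilde g z = fun w => Smap (J z) (I2 * c) 0 (act (cexc l) (act (cexc (- m)) w))); last by apply/funext.
  exact: clin_comp (clin_Smap _ _ _) (clin_comp (cE l) (cE (- m))).
- exact: clin_Smap.
- by rewrite E !exp1 Smap1.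
- exact: Smap1.
- by move=> w w'; rewrite !E !expM SmapM.
- exact: SmapM.
- by rewrite E !exp_t /S !Smap_t.
rewrite E act_act cexcD Smap_act_a cexc_0 mulr1 /S Smap_a cexc0.
rewrite (_ : (fun k => cexc (l - m) k * J z ^+ k) = cexc (rho z)); last first.
  by apply/funext => k; rewrite cexc_scale e.
by rewrite cauchyC; congr (_ *: _ + _); rewrite -act_act act_cst1.
Qed.

Lemma hasd_nmul (F G : C * C -> ncs) (DF DG : ncs) :
  (forall w, hasd (fun z => F z w) x v (DF w)) -> (forall w, hasd (fun z => G z w) x v (DG w)) ->
  forall w, hasd (fun z => nmul (F z) (G z) w) x v ((nmul DF (G x) + nmul (F x) DG) w).
Proof.
move=> hF hG w; rewrite ncDE /nmul -big_split; apply: hasd_sum => i.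
exact: hasdM.
Qed.

Let E z := act (cexc (rho z)) a.

Lemma hasd_exp w : hasd (fun z => E z w) x v (((I2 * c * v.1) *: ncad t (E x) : ncs) w).
Proof.
rewrite ncZE /E ad_act (actE _ _ (leqnn _)) mulr_sumr.
rewrite (_ : (fun z => _) = fun z => \sum_(k < (size w).+1) iter k (ncad t) a w * cexc (rho z) k); last first.
  by apply/funext => z; rewrite (actE _ _ (leqnn _)); apply: eq_bigr => k _; rewrite mulrC.
apply: hasd_sum => k.
have h := hasdZ (k`!%:R)^-1 (hasdX k (hasdZ I2 hasd_rho)).
apply: (@hasd_eq _ _ _ (iter k (ncad t) a w * ((k`!%:R)^-1 * (k%:R * (I2 * rho x) ^+ k.-1 * (I2 * (c * v.1)))))).
  apply: hasdZ; move: h; congr hasd; apply/funext => z; by rewrite /cexc mulrC.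
case: (k : nat) => [|k'] /=; first by ring.
rewrite /cexc factS natrM; have f0 := @fact_neq0 R k'; have s0 : k'.+1%:R != 0 :> C by rewrite pnatr_eq0.
move: f0 s0; move: (k'`!%:R) (k'.+1%:R) (_ ^+ k') (ncad _ _ _) => f s X Y f0 s0.
by field; rewrite f0 s0.
Qed.

Let dV : ncs := (- c * v.2 / J x ^+ 2) *: E x + (I2 * c * v.1 / J x) *: ncad t (E x).

Lemma hasd_V w : hasd (fun z => ((J z)^-1 *: E z + (I2 * c) *: t) w) x v (dV w).
Proof.
have h := hasdD (hasdM (hasdV hasd_J J0) (hasd_exp w)) (hasd_cst (((I2 * c) *: t : ncs) w) x v).
apply: hasd_eq h _; rewrite /dV !(ncDE, ncZE) addr0; ring.
Qed.

Lemma hasd_U w : hasd (fun z => (J z *: t) w) x v (((c * v.2) *: t) w).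
Proof.
by apply: hasd_eq (hasdM hasd_J (hasd_cst (t w) x v)) _; rewrite mulr0 addr0.
Qed.

(** Each coefficient of S z y is a finite linear combination of coefficients of images of words,
    which are differentiable by the product rule, letter by letter. *)
Lemma Smap_differentiable y w : exists l, hasd (fun z => S z y w) x v l.
Proof.
pose W z := foldr (fun (l : bool) y => nmul (if l then (J z)^-1 *: E z + (I2 * c) *: t else J z *: t) y) one.
have hW s : exists D : ncs, forall w', hasd (fun z => W z s w') x v (D w').
  elim: s => [|l s [D hD]]; first by exists 0 => w'; exact: hasd_cst.
  case: l.
    by exists (nmul dV (W x s) + nmul ((J x)^-1 *: E x + (I2 * c) *: t) D); exact: hasd_nmul hasd_V hD.
  by exists (nmul ((c * v.2) *: t) (W x s) + nmul (J x *: t) D); exact: hasd_nmul hasd_U hD.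
have /choice[D hD] := hW.
exists (sum_words (size w) (fun s => y s * D s w)).
by apply: hasd_sum => k; apply: hasd_sum => s; apply: hasdZ; exact: hD.
Qed.

Definition dS y : ncs := fun w => 'd (fun z => S z y w) x v.

Lemma hasd_dS y w : hasd (fun z => S z y w) x v (dS y w).
Proof. by have [l [dl _]] := Smap_differentiable y w. Qed.

Lemma hasd_uniq f l l' : hasd f x v l -> hasd f x v l' -> l = l'.
Proof. by move=> [_ <-] [_ <-]. Qed.

Lemma dMtilde_dS y : dMtilde g x v y = dS y.
Proof.
apply/funext => w; have h : hasd (fun z => Mtilde g z y w) x v (dS y w).
  apply: near_hasd (hasd_dS y w); apply: filterS (hasd_continuous hasd_J J0) => z Jz.
  by rewrite Mtilde_Smap.
by have [_] := h.
Qed.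

Lemma clin_dS : clin dS.
Proof.
have cS z := clin_Smap (J z) (I2 * c) (rho z).
split=> [y y'|k y|k y yk]; last move=> w wk.
- apply/funext => w; apply: (hasd_uniq (hasd_dS (y + y') w)).
  have h := hasdD (hasd_dS y w) (hasd_dS y' w).
  by move: h; congr hasd; apply/funext => z; rewrite /S (clinD (cS z)).
- apply/funext => w; apply: (hasd_uniq (hasd_dS (k *: y) w)).
  have h := hasdZ k (hasd_dS y w).
  by move: h; congr hasd; apply/funext => z; rewrite /S (clinZ (cS z)).
apply: (hasd_uniq (hasd_dS y w)); have h := hasd_cst 0 x v.
by move: h; congr hasd; apply/funext => z; rewrite /S (clin_ord (cS z) yk).
Qed.

Lemma dS_mder : mder (S x) dS.
Proof.
move=> y y'; apply/funext => w; apply: (hasd_uniq (hasd_dS _ w)).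
have h := hasd_nmul (hasd_dS y) (hasd_dS y') w.
by move: h; congr hasd; apply/funext => z; rewrite /S SmapM.
Qed.

Lemma dS_t : dS t = (c * v.2) *: t.
Proof.
apply/funext => w; apply: (hasd_uniq (hasd_dS _ w)); have h := hasd_U w.
by move: h; congr hasd; apply/funext => z; rewrite /S Smap_t.
Qed.

Lemma dS_a : dS a = dV.
Proof.
apply/funext => w; apply: (hasd_uniq (hasd_dS _ w)); have h := hasd_V w.
by move: h; congr hasd; apply/funext => z; rewrite /S Smap_a.
Qed.

End AtPoint.
End Differential.

(** * Equivariance of the connection *)

Section Nu.
Context {R : realType}.
Variables tau xi : Cplx R.
Hypotheses (tau_uhp : uhp tau) (xi_off : off_lattice tau xi).

Lemma nu_xiE : nu_xi xi tau = act (hcoef tau xi) (nca R).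
Proof. by rewrite /nu_xi (expansionE (has_ps_kronF tau_uhp xi_off)). Qed.

Lemma nu_tauE : nu_tau xi tau = (twopii R)^-1 *: act (fun k => k%:R * hcoef tau xi k.+1) (nca R).
Proof. by rewrite /nu_tau (expansionE (has_ps_kronF_tau tau_uhp xi_off)). Qed.

End Nu.

Theorem proposition9p2 (R : realType) (g : jacgrp) (x : Cplx R * Cplx R)
    (x_uhp : uhp x.2) (x_pole : ~ poles x)
    (v : Cplx R * Cplx R) (y : ncseries R) (y_lie : plie y) :
  pullback (jacgrp_act g) omega x v y
  = Ad (Mtilde g x) (omega x v) y
    - dMtilde g x v (pinverse (Mtilde g x) y).
Proof.
case: g => A u; have det1 := SL2_det A; have J0 := jfac_neq0 x_uhp det1.
pose c : Cplx R := entry A 1 0; pose d : Cplx R := entry A 1 1.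
set J := (J in J != 0) in J0.
pose rho := c * x.1 + (c * (u 0 1)%:~R - d * (u 0 0)%:~R).
have ME w : Mtilde (A, u) x w = Smap J (twopii R * c) rho w by exact: Mtilde_Smap.
have MEf : Mtilde (A, u) x = Smap J (twopii R * c) rho by apply/funext.
have yE := Smap_pinverse (twopii R * c) rho J0 y_lie; rewrite -MEf in yE.
(* Writing y = M~(Y) removes the inverse from the identity, which from here on is proved for an
   arbitrary series Y. *)
rewrite /Ad /=; move: yE; move: (pinverse _ y) => Y <- {y y_lie}.
rewrite /pullback diff_act// dMtilde_dS// !ME.
have ox : off_lattice x.2 x.1.
  by move=> m n; apply/eqP => xE; apply: x_pole; exists m, n.
pose tau' := (entry A 0 0 * x.2 + entry A 0 1) / J.
pose xi' := (x.1 + (u 0 0)%:~R * x.2 + (u 0 1)%:~R) / J.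
have gx : jacgrp_act (A, u) x = (xi', tau') by [].
have gu : uhp tau' := gtau_uhp x_uhp det1.
have og : off_lattice tau' xi' := off_gtau x_uhp det1 (off_trans (u 0 0) (u 0 1) ox).
have nx := nu_xiE x_uhp ox; have nt := nu_tauE x_uhp ox.
have nx' := nu_xiE gu og; have nt' := nu_tauE gu og.
have oL w1 w2 z : omega (xi', tau') (w1, w2) z =
    w1 *: ncad (act (hcoef tau' xi') (nca R)) z + w2 *: ((twopii R)^-1 *: ddt (nca R) z + psi_tau tau' z
      + ncad ((twopii R)^-1 *: act (fun k => k%:R * hcoef tau' xi' k.+1) (nca R)) z).
  by rewrite -nx' -nt'.
have oR z : omega x v z =
    v.1 *: ncad (act (hcoef x.2 x.1) (nca R)) z + v.2 *: ((twopii R)^-1 *: ddt (nca R) z + psi_tau x.2 z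
      + ncad ((twopii R)^-1 *: act (fun k => k%:R * hcoef x.2 x.1 k.+1) (nca R)) z).
  by rewrite -nx -nt.
rewrite gx oL oR.
apply: (connection_equiv (h := hcoef x.2 x.1) J0 (hcoef0 x_uhp ox)).
- move=> k; have h := hcoef_equiv (u 0 0) (u 0 1) x_uhp det1 ox k.
  apply: etrans h _; rewrite -/J; congr (_ * cauchy (cexc _) _ _).
  by rewrite /rho -[_%:~R]/c; move: J0; rewrite /J -/c -/d => h; field; exact: h.
- exact: clin_dS.
- exact: dS_mder.
- exact: dS_t.
- exact: dS_a.
move=> z; apply: psi_tau_Smap => // j j1.
exact: (Gseries_mod x_uhp det1 j1).
Qed.
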